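(* Let $(G,H,\alpha,\tau)$ be a Lie crossed module corresponding to a categorical Lie group $\mathbf K$, let $\overline A$ be a connection on a principal $G$-bundle $\pi:P\to M$, and let $C$ be an $L(H)$-valued $C^\infty$ $1$-form on $P$ that is $\alpha$-equivariant in the sense that $C_{pg}(vg)=\alpha(g^{-1})C_p(v)$ for all $p\in P$, $g\in G$, $v\in T_pP$. For any backtrack-erased path $\gamma:[t_0,t_1]\to M$, and any point $u$ on the fiber over $s(\gamma)=\gamma(t_0)$, define $$\gamma^{\rm hor}_u=\bigl(\tilde\gamma_u,h_u(\gamma)\bigr),$$ where $\tilde\gamma_u$ is the $\overline A$-horizontal lift of $\gamma$ through $u$ and $h_u(\gamma)$ is the final point of the path $[t_0,t_1]\to H:t\mapsto h(t)$ satisfying the differential equation $$h(t)^{-1}h'(t)=-C\bigl(\tilde\gamma_u'(t)\bigr)$$ at all $t\in[t_0,t_1]$ where $\gamma'(t)$ exists, with initial point $h(t_0)=e$, the identity in $H$. Then this lifting process defines a connection on the categorical principal bundle $\pi:\mathbb P^{\rm bt}(P)^{\rm dec}_{\overline A}\to\mathbb P^{\rm bt}(M)$.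
   Context: A crossed module $(G,H,\alpha,\tau)$ consists of groups $G,H$ and homomorphisms $\tau:H\to G$, $\alpha:G\to\mathrm{Aut}(H)$ with $\tau(\alpha(g)h)=g\tau(h)g^{-1}$ and $\alpha(\tau(h))(h')=hh'h^{-1}$ for all $g\in G$, $h,h'\in H$. It is a Lie crossed module if $G,H$ are Lie groups, $\tau$ is smooth, and $(g,h)\mapsto\alpha(g)h$ is smooth. $L(H)$ is the Lie algebra of $H$, and the derivative of $\alpha(g)$ on $L(H)$ is again denoted $\alpha(g)$. For $v\in T_pP$, $vg=dR_g|_p(v)\in T_{pg}P$ with $R_g(p)=pg$. A categorical group is a (small) category $\mathbf K$ with a bifunctor $\otimes:\mathbf K\times\mathbf K\to\mathbf K$ making $\mathrm{Obj}(\mathbf K)$ and $\mathrm{Mor}(\mathbf K)$ groups (a categorical Lie group if these are Lie groups and source, target and $x\mapsto1_x$ are smooth homomorphisms). The one corresponding to $(G,H,\alpha,\tau)$ has $\mathrm{Obj}(\mathbf K)=G$, $\mathrm{Mor}(\mathbf K)=H\times G$ with $s(h,a)=a$, $t(h,a)=\tau(h)a$, composition $(h_2,b)\circ(h_1,a)=(h_2h_1,a)$ when $b=\tau(h_1)a$, and group law $(h,a)(k,c)=(h\,\alpha(a)(k),ac)$; so $1_g=(e,g)$. Paths: a parametrized path $c_1$ is identified with $c_2$ if $c_2=c_1\circ\phi$ for a strictly increasing piecewise $C^1$ map $\phi$ of the domain of $c_2$ onto the domain of $c_1$. Piecewise $C^1$ paths $c_1,c_2$ are elementary backtrack equivalent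 if, after such reparametrizations, $\{c_1,c_2\}=\{add^{-1}b,\,ab\}$ for some piecewise $C^1$ paths $a,b,d$ (with $a$ or $b$ possibly a trivial one-point path), where juxtaposition is concatenation and $d^{-1}$ is the reverse of $d$. Backtrack equivalence is the equivalence relation generated by this, and a backtrack-erased path is a backtrack equivalence class; composition is induced by concatenation ($\gamma_2\circ\gamma_1$ is $\gamma_1$ followed by $\gamma_2$), identities are the classes of constant paths, and $s(\gamma),t(\gamma)$ are the initial and final points. In the claim, a representative piecewise $C^1$ path is used. A path $\tilde\gamma$ in $P$ is $\overline A$-horizontal if $\overline A(\tilde\gamma'(t))=0$ wherever $\tilde\gamma'(t)$ exists. $\mathbb P^{\rm bt}(M)$ is the category with object set $M$ and morphisms the backtrack-erased piecewise $C^1$ paths on $M$. $\mathbb P^{\rm bt}(P)^{\rm dec}_{\overline A}$ is the category with object set $P$ and morphisms the pairs $(\tilde\gamma,h)$, $\tilde\gamma$ a backtrack-erased piecewise $C^1$ $\overline A$-horizontal path on $P$ and $h\in H$, with $s(\tilde\gamma,h)=s(\tilde\gamma)$, $t(\tilde\gamma,h)=t(\tilde\gamma)\tau(h^{-1})$, and $(\tilde\gamma_2,h_2)\circ(\tilde\gamma_1,h_1)=(\tilde\gamma_2\tau(h_1)\circ\tilde\gamma_1,h_2h_1)$, where $\tilde\gamma g$ is the right translate. The functor $\pi$ is $p\mapsto\pi(p)$, $(\tilde\gamma,h)\mapsto\pi\circ\tilde\gamma$. The categorical group $\mathbf K$ acts on the right by the action of $G$ on $P$ on objects and by $(\tilde\gamma,h)\cdot(h_1,g_1)=(\tilde\gamma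 g_1,\alpha(g_1^{-1})(h_1^{-1}h))$ on morphisms; with this $\pi$ is a principal categorical bundle, i.e. $\pi$ is surjective on objects and morphisms, and $\mathrm{Obj}(\mathbf K)$, $\mathrm{Mor}(\mathbf K)$ act freely, and transitively on the fibers of $\pi$, on objects and on morphisms respectively. A connection on a principal categorical bundle $\pi:\mathbf P\to\mathbf B$ with structure categorical group $\mathbf K$ is a prescription that associates to each $p\in\mathrm{Obj}(\mathbf P)$ and each $\gamma\in\mathrm{Mor}(\mathbf B)$ with source $\pi(p)$ a morphism $\gamma^{\rm hor}_p:p\to q$ of $\mathbf P$ with $\pi(\gamma^{\rm hor}_p)=\gamma$, which is functorial (if $\zeta\in\mathrm{Mor}(\mathbf B)$ has source $\pi(q)$, $q$ being the target of $\gamma^{\rm hor}_p$, then $(\zeta\circ\gamma)^{\rm hor}_p=\zeta^{\rm hor}_q\circ\gamma^{\rm hor}_p$, and identities lift to identities), and satisfies $\gamma^{\rm hor}_p1_g=\gamma^{\rm hor}_{pg}$ for all $g\in\mathrm{Obj}(\mathbf K)$. *)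

(* Defs.v *)
From HB Require Import structures.
From mathcomp Require Import all_boot all_order all_algebra.
From mathcomp Require Import generic_quotient.
From mathcomp Require Import mathcomp_extra boolp classical_sets functions.
From mathcomp Require Import set_interval.
From mathcomp Require Import reals topology normedtype landau derive.
From mathcomp Require Import lra.
From Stdlib Require Import Relation_Operators.

Set Implicit Arguments.
Unset Strict Implicit.
Unset Printing Implicit Defensive.
Import Order.TTheory GRing.Theory Num.Theory.
Import numFieldNormedType.Exports.

Local Open Scope classical_set_scope.
Local Open Scope quotient_scope.
Local Open Scope ring_scope.

Section Ck.
Context {R : realType}.

(* f is C^k on the open set U; the induction goes through the tangent map
   (x, v) |-> 'd f x v, which for finite-dimensional E is equivalent to
   requiring that the derivative be C^k as an operator-valued map. *)
Fixpoint Ck (k : nat) (E F : normedModType R) (U : set E) (f : E -> F) : Prop :=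
  if k is k'.+1 then
    (forall x, U x -> differentiable f x) /\
    @Ck k' (E * E)%type F (U `*` setT) (fun xv => 'd f (xv.1) (xv.2))
  else forall x, U x -> {for x, continuous f}.

Definition Cinfty (E F : normedModType R) (U : set E) (f : E -> F) : Prop :=
  forall k, Ck k U f.

End Ck.

Record chart {R : realType} (E : normedModType R) (M : topologicalType) := Chart {
  cdom : set M;
  ccod : set E;
  cmap :> M -> E;
  cinv : E -> M;
  cdom_open : open cdom;
  ccod_open : open ccod;
  cmap_cod : forall x, cdom x -> ccod (cmap x);
  cinv_dom : forall y, ccod y -> cdom (cinv y);
  cmapK : forall x, cdom x -> cinv (cmap x) = x;
  cinvK : forall y, ccod y -> cmap (cinv y) = y;
  cmap_continuous : forall x, cdom x -> {for x, continuous cmap};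
  cinv_continuous : forall y, ccod y -> {for y, continuous cinv} }.

(* A C^infinity atlas modelled on E. Manifolds below are modelled on
   E = 'rV[R]_n; general E is only needed for the product of two models.
   The atlas need not be maximal, and chart_at p is a choice of a chart
   around p used to represent tangent vectors. *)
HB.mixin Record isSmoothSpace (R : realType) (E : normedModType R) M of Topological M := {
  atlas : set (chart E M);
  chart_at : M -> chart E M;
  chart_at_atlas : forall p, atlas (chart_at p);
  mem_chart_at : forall p, cdom (chart_at p) p;
  atlas_compat : forall phi psi, atlas phi -> atlas psi ->
    Cinfty (ccod phi `&` cinv phi @^-1` cdom psi) (psi \o cinv phi) }.

#[short(type="smoothSpaceType")]
HB.structure Definition SmoothSpace (R : realType) (E : normedModType R) :=
  { M of Topological M & isSmoothSpace R E M }.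

HB.mixin Record isManifold M of Topological M := {
  manifold_hausdorff : hausdorff_space M;
  manifold_second_countable : @second_countable M }.

#[short(type="manifoldType")]
HB.structure Definition Manifold (R : realType) (E : normedModType R) :=
  { M of SmoothSpace R E M & isManifold M }.

Section Ck_lemmas.
Context {R : realType}.

Lemma openX (T T' : topologicalType) (A : set T) (B : set T') :
  open A -> open B -> open (A `*` B).
Proof.
rewrite !openE => oA oB -[x y] [/= /oA Ax /oB By].
by exists (A, B) => //; split.
Qed.

Lemma near_eq_diff (E F : normedModType R) (f g : E -> F) (x : E) :
  {near x, f =1 g} -> differentiable f x ->
  differentiable g x /\ 'd g x = 'd f x :> (E -> F).
Proof.
move=> fg df.
have cdf : continuous ('d f x) by apply: diff_continuous.
have fgx : f x = g x by apply: nbhs_singleton fg.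
have E1 : g \o shift x = cst (g x) + 'd f x +o_ 0 id.
  apply/eqaddoP => e e0.
  have /eqaddoP/(_ e e0) := diff_locally df.
  have : \forall y \near (0 : E), f (y + x) = g (y + x).
    by move: fg; rewrite [X in X -> _](near_shift 0) subr0.
  by apply: filterS2 => y /= fgy; rewrite !fctE/= fgy fgx.
have dgE := diff_unique cdf E1; split => //.
by apply/diff_locallyP; rewrite dgE; split.
Qed.

Lemma Ck_sub k (E F : normedModType R) (U V : set E) (f : E -> F) :
  V `<=` U -> Ck k U f -> Ck k V f.
Proof.
elim: k E F U V f => [|k IH] E F U V f VU /=.
  by move=> cf x /VU /cf.
move=> [df ck]; split; first by move=> x /VU /df.
by apply: IH ck => -[x v] [/= /VU].
Qed.

Lemma Ck_ext k (E F : normedModType R) (U : set E) (f g : E -> F) :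
  open U -> (forall x, U x -> f x = g x) -> Ck k U f -> Ck k U g.
Proof.
move=> oU fg.
have nfg x : U x -> {near x, f =1 g}.
  by move=> Ux; apply: filterS fg _; exact: open_nbhs_nbhs.
elim: k E F U f g oU fg nfg => [|k IH] E F U f g oU fg nfg /=.
  move=> cf x Ux; suff : g y @[y --> x] --> g x by [].
  rewrite -(fg _ Ux); apply: cvg_trans (cf _ Ux); apply: near_eq_cvg.
  exact: nfg.
move=> [df ck]; split; first by move=> x Ux; have [] := near_eq_diff (nfg _ Ux) (df _ Ux).
have dfg (z : E * E) : (U `*` setT) z -> 'd f (z.1) (z.2) = 'd g (z.1) (z.2).
  by move=> [Uz _]; have [_ ->] := near_eq_diff (nfg _ Uz) (df _ Uz).
have oU' : open (U `*` [set: E]) by apply: openX => //; exact: openT.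
apply: IH ck => // z Uz; apply: filterS dfg _; exact: open_nbhs_nbhs.
Qed.

Lemma Ck_local k (E F : normedModType R) (U : set E) (f : E -> F) :
  (forall x, U x -> exists V, [/\ open V, V x & Ck k V f]) -> Ck k U f.
Proof.
elim: k E F U f => [|k IH] E F U f H /=.
  by move=> x /H[V [_ Vx]]; apply.
split; first by move=> x /H[V [_ Vx [+ _]]]; apply.
apply: IH => -[x v] [/= /H[V [oV Vx [_ ck]]] _].
exists (V `*` setT); split => //.
by apply: openX => //; exact: openT.
Qed.

Lemma CkS k (E F : normedModType R) (U : set E) (f : E -> F) :
  Ck k.+1 U f -> Ck k U f.
Proof.
elim: k E F U f => [|k IH] E F U f.
  by move=> [df _] x /df; exact: differentiable_continuous.
by move=> [df ck]; split => //; exact: IH.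
Qed.

Lemma Ck_lin k (E F : normedModType R) (U : set E) (f : {linear E -> F}) :
  continuous f -> Ck k U f.
Proof.
elim: k E F U f => [|k IH] E F U f cf /=; first by move=> x _; exact: cf.
split; first by move=> x _; exact: linear_differentiable.
have -> : (fun xv : E * E => 'd f (xv.1) (xv.2)) = (f \o snd).
  by apply/funext => -[x v] /=; rewrite diff_lin.
apply: (IH _ _ _ (f \o snd : {linear _ -> _})) => x /=.
by apply: continuous_comp; [exact: cvg_snd|exact: cf].
Qed.

Lemma Ck_pair k (E F G : normedModType R) (U : set E) (f : E -> F) (g : E -> G) :
  open U -> Ck k U f -> Ck k U g -> Ck k U (fun x => (f x, g x)).
Proof.
elim: k E F G U f g => [|k IH] E F G U f g oU /=.
  by move=> cf cg x Ux; apply: cvg_pair; [exact: cf|exact: cg].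
move=> [df cf] [dg cg]; split.
  by move=> x Ux; apply: differentiable_pair; [exact: df|exact: dg].
have oU' : open (U `*` [set: E]) by apply: openX => //; exact: openT.
apply: Ck_ext (IH _ _ _ _ _ _ oU' cf cg) => // -[x v] [/= Ux _].
by rewrite diff_pair//; [exact: df|exact: dg].
Qed.

Lemma Ck_comp k (E F G : normedModType R) (U : set E) (V : set F)
    (f : E -> F) (g : F -> G) :
  open U -> (forall x, U x -> V (f x)) -> Ck k U f -> Ck k V g -> Ck k U (g \o f).
Proof.
elim: k E F G U V f g => [|k IH] E F G U V f g oU UV.
  move=> cf cg x Ux; apply: continuous_comp; first exact: cf.
  by apply: cg; exact: UV.
move=> cf1 [dg cg]; have [df cf] := cf1; split.
  move=> x Ux; apply: differentiable_comp; first exact: df.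
  by apply: dg; exact: UV.
have oU' : open (U `*` [set: E]) by apply: openX => //; exact: openT.
have h : Ck k (U `*` [set: E]) (fun xv => (f xv.1, 'd f (xv.1) (xv.2))).
  apply: Ck_pair => //.
  apply: (IH _ _ _ _ U fst f) => //; first by move=> x [].
  - have := @Ck_lin k (E * E)%type E (U `*` setT) (fst : {linear (E * E)%type -> E}).
    apply => x.
    exact: cvg_fst.
  - exact: CkS.
apply: Ck_ext (IH _ _ _ _ (V `*` setT) _ _ oU' _ h cg) => //.
- move=> [x v] [/= Ux _]; have dfx := df _ Ux; have dgx := dg _ (UV _ Ux).
  by rewrite (diff_comp dfx dgx).
- by move=> [x v] [/= Ux _]; split => //; exact: UV.
Qed.

End Ck_lemmas.

Section Ck_lemmas2.
Context {R : realType}.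

Lemma Ck_cst k (E F : normedModType R) (U : set E) (a : F) :
  Ck k U (cst a).
Proof.
elim: k E F U a => [|k IH] E F U a /=; first by move=> x _; exact: cvg_cst.
split; first by move=> x _; exact: differentiable_cst.
rewrite (_ : (fun _ => _) = cst 0); first exact: IH.
by apply/funext => -[x v] /=; rewrite diff_cst.
Qed.

Lemma Ck_affine k (E F : normedModType R) (U : set E) (f : {linear E -> F}) (a : F) :
  continuous f -> Ck k U (fun x => a + f x).
Proof.
case: k => [|k] cf.
  by move=> x _; apply: cvgD; [exact: cvg_cst|exact: cf].
have df x : differentiable f x by exact: linear_differentiable.
split; first by move=> x _; apply: differentiableD => //; exact: differentiable_cst.
have -> : (fun xv : E * E => 'd (fun x => a + f x) (xv.1) (xv.2)) = (f \o snd).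
  apply/funext => -[x v] /=.
  have dc : differentiable (cst a : E -> F) x by exact: differentiable_cst.
  by rewrite (diffD dc (df x)) fctE/= diff_cst add0r diff_lin.
apply: (@Ck_lin _ _ (E * E)%type F _ (f \o snd : {linear (E * E)%type -> F})) => x /=.
by apply: continuous_comp; [exact: cvg_snd|exact: cf].
Qed.

Lemma open_preimage_on (T T' : topologicalType) (f : T -> T') (A : set T) (B : set T') :
  open A -> (forall x, A x -> {for x, continuous f}) -> open B ->
  open (A `&` f @^-1` B).
Proof.
move=> oA cf oB; rewrite openE => x [Ax Bfx].
apply: filterI; first exact: open_nbhs_nbhs.
by apply: (cf _ Ax); exact: open_nbhs_nbhs.
Qed.
End Ck_lemmas2.

Section prod_chart.
Context {R : realType} {E F : normedModType R} {M N : topologicalType}.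
Variables (phi : chart E M) (psi : chart F N).

Lemma prod_continuous_on (S S' T T' : topologicalType) (f : S -> T) (g : S' -> T') z :
  {for z.1, continuous f} -> {for z.2, continuous g} ->
  {for z, continuous (fun z : S * S' => (f z.1, g z.2))}.
Proof.
case: z => x y /= cf cg.
apply: cvg_pair => /=.
  by apply: (@continuous_comp _ _ _ fst f (x, y)) cf; exact: cvg_fst.
by apply: (@continuous_comp _ _ _ snd g (x, y)) cg; exact: cvg_snd.
Qed.

Fact prod_cmap_cod z : (cdom phi `*` cdom psi) z ->
  (ccod phi `*` ccod psi) (phi z.1, psi z.2).
Proof. by case=> ? ?; split; exact: cmap_cod. Qed.

Fact prod_cinv_dom z : (ccod phi `*` ccod psi) z ->
  (cdom phi `*` cdom psi) (cinv phi z.1, cinv psi z.2).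
Proof. by case=> ? ?; split; exact: cinv_dom. Qed.

Fact prod_cmapK z : (cdom phi `*` cdom psi) z ->
  (cinv phi (phi z.1), cinv psi (psi z.2)) = z.
Proof. by case: z => x y [? ?]; rewrite !cmapK. Qed.

Fact prod_cinvK z : (ccod phi `*` ccod psi) z ->
  (phi (cinv phi z.1), psi (cinv psi z.2)) = z.
Proof. by case: z => x y [? ?]; rewrite !cinvK. Qed.

Fact prod_cmap_continuous z : (cdom phi `*` cdom psi) z ->
  {for z, continuous (fun z => (phi z.1, psi z.2))}.
Proof.
by case=> ? ?; apply: prod_continuous_on; exact: cmap_continuous.
Qed.

Fact prod_cinv_continuous z : (ccod phi `*` ccod psi) z ->
  {for z, continuous (fun z => (cinv phi z.1, cinv psi z.2))}.
Proof.
by case=> ? ?; apply: prod_continuous_on; exact: cinv_continuous.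
Qed.

Definition prod_chart : chart (E * F)%type (M * N)%type :=
  @Chart _ _ _ _ _ (fun z => (phi z.1, psi z.2))
    (fun z => (cinv phi z.1, cinv psi z.2))
    (openX (cdom_open phi) (cdom_open psi))
    (openX (ccod_open phi) (ccod_open psi))
    prod_cmap_cod prod_cinv_dom prod_cmapK prod_cinvK
    prod_cmap_continuous prod_cinv_continuous.

End prod_chart.

Section prod_smooth.
Context {R : realType} {E F : normedModType R}
  (M : smoothSpaceType E) (N : smoothSpaceType F).

Definition prod_atlas : set (chart (E * F)%type (M * N)%type) :=
  [set prod_chart phi psi | phi in atlas & psi in atlas].

Fact prod_chart_at_atlas (p : M * N) :
  prod_atlas (prod_chart (chart_at p.1) (chart_at p.2)).
Proof.
by exists (chart_at p.1); [exact: chart_at_atlas|];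
  exists (chart_at p.2) => //; exact: chart_at_atlas.
Qed.

Fact prod_mem_chart_at (p : M * N) :
  cdom (prod_chart (chart_at p.1) (chart_at p.2)) p.
Proof. by split; exact: mem_chart_at. Qed.

Fact prod_atlas_compat phi psi : prod_atlas phi -> prod_atlas psi ->
  Cinfty (ccod phi `&` cinv phi @^-1` cdom psi) (psi \o cinv phi).
Proof.
move=> [a1 Aa1 [b1 Ab1 <-]] [a2 Aa2 [b2 Ab2 <-]] k /=.
have o1 : open (ccod a1 `&` cinv a1 @^-1` cdom a2).
  apply: open_preimage_on; [exact: ccod_open| |exact: cdom_open].
  by move=> x; exact: cinv_continuous.
have o2 : open (ccod b1 `&` cinv b1 @^-1` cdom b2).
  apply: open_preimage_on; [exact: ccod_open| |exact: cdom_open].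
  by move=> x; exact: cinv_continuous.
apply: (@Ck_sub _ _ _ _ ((ccod a1 `&` cinv a1 @^-1` cdom a2) `*`
  (ccod b1 `&` cinv b1 @^-1` cdom b2))); first by move=> [x y] /= [[? ?] [? ?]].
apply: (@Ck_pair _ _ (E * F)%type E F _ ((a2 \o cinv a1) \o fst) ((b2 \o cinv b1) \o snd)).
- exact: openX.
- have := @Ck_comp R k (E * F)%type E E ((ccod a1 `&` cinv a1 @^-1` cdom a2) `*`
  (ccod b1 `&` cinv b1 @^-1` cdom b2)) _ fst (a2 \o cinv a1) _ _ _ (atlas_compat _ _ Aa1 Aa2 k).
  apply.
  + exact: openX.
  + by move=> x [].
  + have := @Ck_lin R k (E * F)%type E _ (fst : {linear (E * F)%type -> E}).
    by apply => x; exact: cvg_fst.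
- have := @Ck_comp R k (E * F)%type F F ((ccod a1 `&` cinv a1 @^-1` cdom a2) `*`
  (ccod b1 `&` cinv b1 @^-1` cdom b2)) _ snd (b2 \o cinv b1) _ _ _ (atlas_compat _ _ Ab1 Ab2 k).
  apply.
  + exact: openX.
  + by move=> x [].
  + have := @Ck_lin R k (E * F)%type F _ (snd : {linear (E * F)%type -> F}).
    by apply => x; exact: cvg_snd.
Qed.

HB.instance Definition _ := isSmoothSpace.Build R (E * F)%type (M * N)%type
  prod_chart_at_atlas prod_mem_chart_at prod_atlas_compat.

End prod_smooth.

Section real_line.
Context {R : realType}.

Definition id_chart : chart R^o R^o :=
  @Chart _ _ _ setT setT id id openT openT (fun=> id) (fun=> id)
    (fun _ _ => erefl) (fun _ _ => erefl)
    (fun _ _ => cvg_id) (fun _ _ => cvg_id).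

Fact id_atlas_compat (phi psi : chart R^o R^o) : [set id_chart] phi -> [set id_chart] psi ->
  Cinfty (ccod phi `&` cinv phi @^-1` cdom psi) (psi \o cinv phi).
Proof.
move=> -> -> k /=.
have := @Ck_lin R k R^o R^o _ (idfun : {linear R^o -> R^o}).
by apply => x; exact: cvg_id.
Qed.

Fact id_chart_at_atlas (p : R^o) : [set id_chart] id_chart. Proof. by []. Qed.

Fact mem_id_chart (p : R^o) : cdom id_chart p. Proof. by []. Qed.

HB.instance Definition _ := isSmoothSpace.Build R R^o R^o
  id_chart_at_atlas mem_id_chart id_atlas_compat.
End real_line.


Section maps.
Context {R : realType} {E F : normedModType R}.

(* Only used for open U. *)
Definition Ckmap (M : smoothSpaceType E) (N : smoothSpaceType F) (k : nat) (U : set M) (f : M -> N) : Prop :=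
  (forall x, U x -> {for x, continuous f}) /\
  forall phi psi, atlas phi -> atlas psi ->
    Ck k (ccod phi `&` cinv phi @^-1` (U `&` f @^-1` cdom psi)) (psi \o f \o cinv phi).

End maps.

Definition smooth_on {R : realType} {E F : normedModType R}
    {M : smoothSpaceType E} {N : smoothSpaceType F} (U : set M) (f : M -> N) :=
  forall k, Ckmap k U f.

Definition smooth {R : realType} {E F : normedModType R}
    {M : smoothSpaceType E} {N : smoothSpaceType F} (f : M -> N) :=
  smooth_on setT f.

HB.mixin Record isLieGroup (R : realType) (E : normedModType R) G
    of SmoothSpace R E G & Group G := {
  mulg_smooth : smooth (fun z : G * G => z.1 * z.2)%g;
  invg_smooth : smooth (fun x : G => x^-1)%g }.

#[short(type="lieGroupType")]
HB.structure Definition LieGroup (R : realType) (E : normedModType R) :=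
  { G of Manifold R E G & Group G & isLieGroup R E G }.

Section tangent.
Context {R : realType}.

(* A tangent vector at p is represented by its coordinates in chart_at p. *)
Definition tangent {E : normedModType R} {M : smoothSpaceType E} (p : M) :
  normedModType R := E.

Definition tmap {E F : normedModType R} {M : smoothSpaceType E}
    {N : smoothSpaceType F} (f : M -> N) (p : M) :
    {linear tangent p -> tangent (f p)} :=
  'd (chart_at (f p) \o f \o cinv (chart_at p)) (chart_at p p).

(* Smoothness of a V-valued 1-form w, tested in every chart phi: the vector
   'd (chart_at (cinv phi x) \o cinv phi) x v is the constant-coordinate field
   v of phi at the point cinv phi x, rewritten in the preferred chart there. *)
Definition smooth_form {E V : normedModType R} {M : smoothSpaceType E}
    (w : forall p : M, {linear tangent p -> V}) :=
  forall phi, atlas phi -> forall v : E,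
    Cinfty (ccod phi)
      (fun x => w (cinv phi x) ('d (chart_at (cinv phi x) \o cinv phi) x v)).

End tangent.

Section crossed_module.
Local Open Scope group_scope.
Record lieCrossedModule {R : realType} {E F : normedModType R}
    (G : lieGroupType E) (H : lieGroupType F) := LieCrossedModule {
  xtau : H -> G;
  xalpha : G -> H -> H;
  xtauM : {morph xtau : h k / h * k};
  xalphaM : forall g, {morph xalpha g : h k / h * k};
  xalpha1 : forall h, xalpha 1 h = h;
  xalphaA : forall g g' h, xalpha (g * g') h = xalpha g (xalpha g' h);
  xtau_alpha : forall g h, xtau (xalpha g h) = g * xtau h * g^-1;
  xalpha_tau : forall h k, xalpha (xtau h) k = h * k * h^-1;
  xtau_smooth : smooth xtau;
  xalpha_smooth : smooth (fun z : G * H => xalpha z.1 z.2) }.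

Record principalBundle {R : realType} {E EP EM : normedModType R}
    (G : lieGroupType E) (P : manifoldType EP) (M : manifoldType EM) :=
    PrincipalBundle {
  bproj : P -> M;
  bact : P -> G -> P;
  bact1 : forall p, bact p 1 = p;
  bactM : forall p g g', bact p (g * g') = bact (bact p g) g';
  bproj_smooth : smooth bproj;
  bact_smooth : smooth (fun z : P * G => bact z.1 z.2);
  (* psi and psi' are mutually inverse G-equivariant diffeomorphisms between
     the preimage of U and U * G over U; outside these sets their values are
     irrelevant. *)
  btriv : forall x : M, exists U : set M,
    exists (psi : P -> M * G) (psi' : M * G -> P), [/\ open U, U x,
      smooth_on (bproj @^-1` U) psi, smooth_on (U `*` setT) psi' &
      [/\ forall p, U (bproj p) -> psi' (psi p) = p,
      forall z, U z.1 -> psi (psi' z) = z,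
      forall p, U (bproj p) -> (psi p).1 = bproj p,
      forall z, U z.1 -> bproj (psi' z) = z.1 &
      forall z g, U z.1 -> bact (psi' z) g = psi' (z.1, z.2 * g)]] }.

End crossed_module.

Section connection.
Local Open Scope group_scope.
Record connectionForm {R : realType} {E EP EM : normedModType R}
    (G : lieGroupType E) (P : manifoldType EP) (M : manifoldType EM)
    (B : principalBundle G P M) := ConnectionForm {
  cform :> forall p : P, {linear tangent p -> tangent (1 : G)};
  cform_smooth : smooth_form cform;
  cform_equiv : forall p g (v : tangent p),
    cform (bact B p g) (tmap ((bact B)^~ g) p v) =
    tmap (fun x : G => g^-1 * x * g) 1 (cform p v);
  (* tmap (bact B p) 1 X is the fundamental vector field of X at p. *)
  cform_fund : forall p (X : tangent (1 : G)), cform p (tmap (bact B p) 1 X) = X }.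
End connection.

Section paths.
Context {R : realType}.

Inductive piecewise (Q : R -> R -> Prop) : R -> R -> Prop :=
| piecewise1 a b of a <= b & Q a b : piecewise Q a b
| piecewise_cat a b c of piecewise Q a b & piecewise Q b c : piecewise Q a c.

(* C^1 on a closed interval: restriction of a C^1 map defined on an open
   neighbourhood of it. *)
Definition C1_on {E : normedModType R} {M : smoothSpaceType E}
    (c : R^o -> M) (a b : R) :=
  exists (U : set R^o) (c' : R^o -> M), [/\ open U, `[a, b] `<=` U, Ckmap 1 U c' &
    {in `[a, b], c =1 c'}].

(* Only the values of pfun on [pstart, pstop] matter; one-point domains
   pstart = pstop are allowed (trivial paths). *)
Record pc1path {E : normedModType R} (M : smoothSpaceType E) := PC1Path {
  pstart : R;
  pstop : R;
  pfun :> R^o -> M;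
  pcont : {within `[pstart, pstop], continuous pfun};
  ppiecewise : piecewise (C1_on pfun) pstart pstop }.

Definition pinit {E} {M : smoothSpaceType E} (c : pc1path M) : M := c (pstart c).
Definition pfinal {E} {M : smoothSpaceType E} (c : pc1path M) : M := c (pstop c).

(* c'(t) exists and equals v, for c defined on [a, b]; the derivative is
   one-sided at the end points, and a one-point path has no velocity. *)
Definition has_velocity {E} {M : smoothSpaceType E} (c : R^o -> M) (a b t : R)
    (v : tangent (c t)) :=
  [/\ a < b, t \in `[a, b] &
    (s - t)^-1 *: (chart_at (c t) (c s) - chart_at (c t) (c t))
      @[s --> within `[a, b] t^'] --> (v : E)].

End paths.

Arguments has_velocity {R E M} c a b t v.

Section Ckmap_comp.
Context {R : realType}.

Lemma Ckmap_comp k (E F G : normedModType R) (M : smoothSpaceType E)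
    (N : smoothSpaceType F) (L : smoothSpaceType G)
    (U : set M) (V : set N) (f : M -> N) (g : N -> L) :
  open U -> open V -> (forall x, U x -> V (f x)) ->
  Ckmap k U f -> Ckmap k V g -> Ckmap k U (g \o f).
Proof.
move=> oU oV UV [cf kf] [cg kg]; split.
  by move=> x Ux; apply: continuous_comp; [exact: cf|exact: (cg _ (UV _ Ux))].
move=> phi psi Aphi Apsi; apply: Ck_local => x [cx [Ux dx]].
pose chi := chart_at (f (cinv phi x)).
have Achi : atlas chi by exact: chart_at_atlas.
have oW1 : open (V `&` g @^-1` cdom psi).
  by apply: open_preimage_on => //; exact: cdom_open.
have oW2 : open (U `&` f @^-1` (cdom chi `&` (V `&` g @^-1` cdom psi))).
  by apply: open_preimage_on => //; apply: openI => //; exact: cdom_open.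
exists (ccod phi `&` cinv phi @^-1`
  (U `&` f @^-1` (cdom chi `&` (V `&` g @^-1` cdom psi)))); split.
- apply: open_preimage_on => //; first exact: ccod_open.
  by move=> y; exact: cinv_continuous.
- split => //; split => //; split; first exact: mem_chart_at.
  by split => //; exact: UV.
set W := (X in Ck _ X _).
have oW : open W.
  apply: open_preimage_on => //; first exact: ccod_open.
  by move=> y; exact: cinv_continuous.
have := @Ck_comp R k E F G W _ (chi \o f \o cinv phi) (psi \o g \o cinv chi) oW
  _ _ (kg chi psi Achi Apsi).
move=> H; apply: Ck_ext oW _ (H _ _).
- by move=> y [_ [Uy [dy _]]] /=; rewrite cmapK.
- move=> y [_ [Uy [dy [Vy gy]]]] /=; split; first exact: cmap_cod.
  by rewrite /= cmapK.
- by apply: Ck_sub (kf phi chi Aphi Achi) => y [? [? [? _]]].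
Qed.

Lemma Ckmap_cst k (E F : normedModType R) (M : smoothSpaceType E)
    (N : smoothSpaceType F) (U : set M) (a : N) : Ckmap k U (cst a : M -> N).
Proof.
split; first by move=> x _; exact: cvg_cst.
by move=> phi psi _ _; rewrite (_ : _ \o _ = cst (psi a)) //; exact: Ck_cst.
Qed.

Lemma Ckmap_pairr k (E F : normedModType R) (M : smoothSpaceType E)
    (N : smoothSpaceType F) (a : N) : Ckmap k [set: M] (fun x => (x, a)).
Proof.
split; first by move=> x _; apply: cvg_pair; [exact: cvg_id|exact: cvg_cst].
move=> phi _ Aphi [psi Apsi [chi Achi <-]].
have o1 : open (ccod phi `&` cinv phi @^-1` cdom psi).
  apply: open_preimage_on; [exact: ccod_open| |exact: cdom_open].
  by move=> x; exact: cinv_continuous.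
apply: (@Ck_sub _ _ _ _ (ccod phi `&` cinv phi @^-1` cdom psi)).
  by move=> x [? [_ []]].
apply: (@Ck_pair _ k E E F _ (psi \o cinv phi) (cst (chi a))) => //.
- exact: atlas_compat.
- exact: Ck_cst.
Qed.

Lemma Ckmap_affine k (U : set R^o) (m r : R) :
  Ckmap k U (fun t : R^o => m + r * t : R^o).
Proof.
split.
  move=> x _; apply: (@cvgD _ _ _ _ _ (cst m)); first exact: cvg_cst.
  by apply: cvgMr; exact: cvg_id.
move=> _ _ -> -> /=.
have := @Ck_affine R k R^o R^o (setT `&` (U `&` setT)) ( *:%R r : {linear R^o -> R^o}) m.
by apply => x; apply: cvgZr; exact: cvg_id.
Qed.

End Ckmap_comp.

Section path_lemmas.
Context {R : realType}.
Implicit Types a b d s t m : R.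

Lemma piecewise_le Q a b : piecewise Q a b -> a <= b.
Proof. by elim=> // x y z _ + _; exact: le_trans. Qed.

Lemma piecewise_sub (Q Q' : R -> R -> Prop) a b : piecewise Q a b ->
  (forall s t, a <= s -> s <= t -> t <= b -> Q s t -> Q' s t) -> piecewise Q' a b.
Proof.
elim=> [x y xy Qxy H|x y z xy IH1 yz IH2 H].
  by apply: piecewise1 => //; exact: H.
have ? := piecewise_le xy; have ? := piecewise_le yz.
apply: piecewise_cat; [apply: IH1|apply: IH2] => s t ? ? ?; apply: H => //.
  exact: le_trans (piecewise_le yz).
exact: le_trans (piecewise_le xy) _.
Qed.

Lemma piecewise_shift (Q Q' : R -> R -> Prop) m a b : piecewise Q a b ->
  (forall s t, a <= s -> s <= t -> t <= b -> Q s t -> Q' (m + s) (m + t)) ->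
  piecewise Q' (m + a) (m + b).
Proof.
elim=> [x y xy Qxy H|x y z xy IH1 yz IH2 H].
  by apply: piecewise1; [rewrite lerD2l|exact: H].
have ? := piecewise_le xy; have ? := piecewise_le yz.
apply: piecewise_cat; [apply: IH1|apply: IH2] => s t ? ? ?; apply: H => //.
  exact: le_trans (piecewise_le yz).
exact: le_trans (piecewise_le xy) _.
Qed.

Lemma piecewise_rev (Q Q' : R -> R -> Prop) m a b : piecewise Q a b ->
  (forall s t, a <= s -> s <= t -> t <= b -> Q s t -> Q' (m - t) (m - s)) ->
  piecewise Q' (m - b) (m - a).
Proof.
elim=> [x y xy Qxy H|x y z xy IH1 yz IH2 H].
  by apply: piecewise1; [rewrite lerD2l lerN2|exact: H].
have ? := piecewise_le xy; have ? := piecewise_le yz.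
apply: piecewise_cat; [apply: IH2|apply: IH1] => s t ? ? ?; apply: H => //.
  exact: le_trans (piecewise_le xy) _.
exact: le_trans (piecewise_le yz).
Qed.

Variables (E : normedModType R) (M : smoothSpaceType E).
Implicit Types c : R^o -> M.

Lemma C1_on_eq c c' a b : {in `[a, b], c =1 c'} -> C1_on c a b -> C1_on c' a b.
Proof.
move=> cc' [U [d [oU abU dU cd]]]; exists U, d; split => // t tab.
by rewrite -cc'// cd.
Qed.

Lemma C1_on_affine c a b a' b' m r :
  (forall t, t \in `[a', b'] -> m + r * t \in `[a, b]) ->
  C1_on c a b -> C1_on (fun t => c (m + r * t)) a' b'.
Proof.
move=> sub [U [d [oU abU dU cd]]].
have aff := @Ckmap_affine R 1 setT m r.
exists ((fun t : R^o => m + r * t : R^o) @^-1` U), (fun t => d (m + r * t)).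
have oV : open ((fun t : R^o => m + r * t : R^o) @^-1` U).
  rewrite -[X in open X]setTI; apply: open_preimage_on => //; first exact: openT.
  by case: aff.
split => //.
- by move=> t /= /sub /abU.
- apply: (Ckmap_comp (V := U)) dU => //.
  split; first by move=> x _; case: aff => + _; apply.
  move=> _ _ -> ->; apply: Ck_sub (aff.2 id_chart id_chart erefl erefl) => //.
- by move=> t /sub /cd.
Qed.

Lemma continuous_affine_within c a b a' b' m r :
  (forall t, t \in `[a', b'] -> m + r * t \in `[a, b]) ->
  {within `[a, b], continuous c} ->
  {within `[a', b'], continuous (fun t : R => c (m + r * t))}.
Proof.
move=> sub /(@subspace_continuousP R) cc; apply/(@subspace_continuousP R) => t /= tab.
move=> W /(cc _ (sub _ tab)); rewrite /= /fmap/= /within/= => H.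
have cvg : (m + r * s) @[s --> t] --> m + r * t.
  apply: cvgD; first exact: cvg_cst.
  by apply: cvgMr; exact: cvg_id.
have K : \forall s \near t, [set` `[a, b]] (m + r * s) -> W (c (m + r * s)).
  exact: cvg _ H.
by apply: filterS K => s Ws sab; exact/Ws/sub.
Qed.

Lemma continuous_within_eq c c' a b : {in `[a, b], c =1 c'} ->
  {within `[a, b], continuous c} -> {within `[a, b], continuous c'}.
Proof.
move=> cc'; apply: subspace_eq_continuous => x; rewrite inE => xab.
by apply: cc'.
Qed.

Lemma continuous_within_cat c a b d : a <= b -> b <= d ->
  {within `[a, b], continuous c} -> {within `[b, d], continuous c} ->
  {within `[a, d], continuous c}.
Proof.
move=> ab bd c1 c2.
have -> : [set` `[a, d]] = [set` `[a, b]] `|` [set` `[b, d]].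
  apply/seteqP; split => t /=; rewrite !in_itv/=.
    by move=> /andP[? ?]; have [?|?] := lerP t b; [left|right]; lra.
  by case; lra.
by apply: withinU_continuous => //; exact: itv_closed.
Qed.

End path_lemmas.

Section path_ops.
Context {R : realType} {E : normedModType R} {M : smoothSpaceType E}.
Implicit Types c : pc1path M.

Lemma pc1path_le c : pstart c <= pstop c.
Proof. exact: piecewise_le (ppiecewise c). Qed.

Fact path_cst_cont (p : M) : {within `[0, 0 : R], continuous (cst p : R^o -> M)}.
Proof. by apply: continuous_subspaceT => x; exact: cvg_cst. Qed.

Fact path_cst_piecewise (p : M) :
  piecewise (C1_on (cst p : R^o -> M)) (0 : R) 0.
Proof.
apply: piecewise1 => //; exists setT, (cst p); split => //; first exact: openT.
exact: Ckmap_cst.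
Qed.

Definition path_cst (p : M) : pc1path M :=
  PC1Path (@path_cst_cont p) (path_cst_piecewise p).

Definition path_rev_fun c : R^o -> M := fun t => c (pstart c + pstop c - t).

Let revE c : path_rev_fun c = fun t => c (pstart c + pstop c + (-1) * t).
Proof. by apply/funext => t; rewrite /path_rev_fun mulN1r. Qed.

Fact path_rev_cont c :
  {within `[pstart c, pstop c], continuous (path_rev_fun c)}.
Proof.
rewrite revE; apply: continuous_affine_within (@pcont _ _ _ c) => t.
by rewrite !in_itv/=; lra.
Qed.

Fact path_rev_piecewise c :
  piecewise (C1_on (path_rev_fun c)) (pstart c) (pstop c).
Proof.
have := @piecewise_rev R (C1_on c) (C1_on (path_rev_fun c)) (pstart c + pstop c)
  _ _ (ppiecewise c).
rewrite addrK (addrC (pstart c)) addrK; apply => s t ? ? ?.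
rewrite revE.
by apply: C1_on_affine => x; rewrite !in_itv/=; lra.
Qed.

Definition path_rev c : pc1path M :=
  PC1Path (@path_rev_cont c) (path_rev_piecewise c).

Definition path_cat_fun c1 c2 : R^o -> M := fun t =>
  if t <= pstop c1 then c1 t else c2 (pstart c2 - pstop c1 + t).

Let path_cat_l c1 c2 : {in `[pstart c1, pstop c1], c1 =1 path_cat_fun c1 c2}.
Proof. by move=> t; rewrite in_itv/= /path_cat_fun => /andP[_ ->]. Qed.

Let path_cat_r c1 c2 e : pfinal c1 = pinit c2 ->
  {in `[pstop c1, e],
    (fun t => c2 (pstart c2 - pstop c1 + 1 * t)) =1 path_cat_fun c1 c2}.
Proof.
move=> c12 t; rewrite in_itv/= /path_cat_fun mul1r => /andP[ct _].
case: ifPn => // tc; have -> : t = pstop c1 by apply/eqP; rewrite eq_le tc ct.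
by rewrite subrK -/(pinit c2) -c12.
Qed.

Fact path_cat_cont c1 c2 : pfinal c1 = pinit c2 ->
  {within `[pstart c1, pstop c1 - pstart c2 + pstop c2],
    continuous (path_cat_fun c1 c2)}.
Proof.
move=> c12; have ? := pc1path_le c1; have ? := pc1path_le c2.
apply: (@continuous_within_cat _ _ _ _ _ (pstop c1)) => //; first by lra.
  by apply: continuous_within_eq (@pcont _ _ _ c1); exact: path_cat_l.
apply: (continuous_within_eq (path_cat_r (e := pstop c1 - pstart c2 + pstop c2) c12)).
apply: continuous_affine_within (@pcont _ _ _ c2) => t.
by rewrite !in_itv/=; lra.
Qed.

Fact path_cat_piecewise c1 c2 : pfinal c1 = pinit c2 ->
  piecewise (C1_on (path_cat_fun c1 c2)) (pstart c1)
    (pstop c1 - pstart c2 + pstop c2).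
Proof.
move=> c12; apply: (@piecewise_cat _ _ _ (pstop c1)).
  apply: piecewise_sub (ppiecewise c1) _ => s t ? ? ?.
  apply: C1_on_eq => x; rewrite in_itv/= => ?; apply: path_cat_l.
  by rewrite in_itv/=; lra.
have := @piecewise_shift R (C1_on c2) (C1_on (path_cat_fun c1 c2))
  (pstop c1 - pstart c2) _ _ (ppiecewise c2).
rewrite subrK; apply => s t ? ? ? H.
apply: (@C1_on_eq _ _ _ (fun t => c2 (pstart c2 - pstop c1 + 1 * t))).
  move=> x; rewrite in_itv/= => ?.
  by apply: (path_cat_r (e := pstop c1 - pstart c2 + t)) => //; rewrite in_itv/=; lra.
by apply: C1_on_affine H => x; rewrite !in_itv/=; lra.
Qed.

(* c1 followed by c2; the value is irrelevant when they are not composable. *)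
Definition path_cat c1 c2 : pc1path M :=
  if pselect (pfinal c1 = pinit c2) is left c12
  then PC1Path (path_cat_cont c12) (path_cat_piecewise c12) else c1.

End path_ops.

Section path_map.
Context {R : realType} {E F : normedModType R} {M : smoothSpaceType E}
  {N : smoothSpaceType F} (f : M -> N) (fS : smooth f) (c : pc1path M).

Fact path_map_cont : {within `[pstart c, pstop c], continuous (f \o c)}.
Proof.
apply/(@subspace_continuousP R) => t tc.
have /(@subspace_continuousP R) /(_ _ tc) H := @pcont _ _ _ c.
by apply: cvg_comp H _; have [+ _] := fS 0%N; apply.
Qed.

Fact path_map_piecewise : piecewise (C1_on (f \o c)) (pstart c) (pstop c).
Proof.
apply: piecewise_sub (ppiecewise c) _ => s t _ _ _ [U [d [oU stU dU cd]]].
exists U, (f \o d); split => //.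
- by apply: (Ckmap_comp (V := setT)) dU (fS 1%N) => //; exact: openT.
- by move=> x /cd /= ->.
Qed.

Definition path_map : pc1path N := PC1Path path_map_cont path_map_piecewise.

End path_map.

Section velocity.
Context {R : realType} {E : normedModType R} {M : smoothSpaceType E}.
Implicit Types (c : R^o -> M) (a b t : R) (v : E).

Lemma has_velocity_sub c a b a' b' t v :
  a <= a' -> b' <= b -> a' < b' -> t \in `[a', b'] ->
  has_velocity c a b t v -> has_velocity c a' b' t v.
Proof.
move=> aa bb ab' tab [ab _ cv]; split => //.
apply: cvg_trans cv; apply: cvg_app; apply: within_subset => s /=.
by rewrite !in_itv/=; lra.
Qed.

Lemma has_velocity_eq c c' a b t v :
  {in `[a, b], c =1 c'} -> has_velocity c a b t v -> has_velocity c' a b t v.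
Proof.
move=> cc' [ab tab cv]; split => //.
rewrite -(cc' _ tab); apply: cvg_trans cv; apply: fmap_within_eq => s; rewrite inE => sab.
by rewrite -(cc' _ sab).
Qed.

Lemma has_velocity_shift c a b t v m :
  has_velocity (fun s => c (m + s)) a b t v ->
  has_velocity c (m + a) (m + b) (m + t) v.
Proof.
move=> [ab tab cv]; split; first by rewrite ltrD2l.
  by move: tab; rewrite !in_itv/= !lerD2l.
move=> W /cv; rewrite /= /fmap/= /within/= => H.
have cvg : (s - m) @[s --> m + t] --> t.
  rewrite -[X in _ --> X](addrK m) (addrC t).
  by apply: cvgB; [exact: cvg_id|exact: cvg_cst].
have : \forall s \near m + t, s - m != t -> s - m \in `[a, b] ->
  W ((s - m - t)^-1 *: (chart_at (c (m + t)) (c (m + (s - m))) -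
     chart_at (c (m + t)) (c (m + t)))) := cvg _ H.
apply: filterS => s.
have -> : m + (s - m) = s by rewrite addrC subrK.
have -> : s - m - t = s - (m + t) by rewrite opprD addrA.
move=> Ws smt sab; apply: Ws.
  by apply: contra_neq smt => <-; rewrite addrC subrK.
by move: sab; rewrite /= !in_itv/=; lra.
Qed.

Lemma within_itv_proper a b t : a < b -> t \in `[a, b] ->
  ProperFilter (within `[a, b] t^').
Proof.
move=> ab; rewrite in_itv/= => /andP[at_ tb]; split; last exact: within_filter.
rewrite /within/= => /nbhs_ballP[e /= e0 H].
suff [s [sab st se]] : exists s, [/\ s \in `[a, b], s != t & `|t - s| < e].
  exact: (H s se st sab).
have [tb'|tb'] := ltrP t b.
- exists (t + Num.min (e / 2) (b - t)).
  have m0 : 0 < Num.min (e / 2) (b - t).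
    by rewrite lt_min; apply/andP; split; lra.
  have [m1 m2] : Num.min (e / 2) (b - t) <= e / 2 /\ Num.min (e / 2) (b - t) <= b - t.
    by split; rewrite ge_min lexx ?orbT.
  set m := Num.min _ _ in m0 m1 m2 *.
  split; first by rewrite in_itv/=; lra.
    by apply/eqP; lra.
  by rewrite opprD addrA subrr sub0r normrN gtr0_norm//; lra.
- have tE : t = b by apply/eqP; rewrite eq_le tb tb'.
  exists (t - Num.min (e / 2) (b - a)).
  have m0 : 0 < Num.min (e / 2) (b - a).
    by rewrite lt_min; apply/andP; split; lra.
  have [m1 m2] : Num.min (e / 2) (b - a) <= e / 2 /\ Num.min (e / 2) (b - a) <= b - a.
    by split; rewrite ge_min lexx ?orbT.
  set m := Num.min _ _ in m0 m1 m2 *.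
  split; first by rewrite in_itv/=; lra.
    by apply/eqP; lra.
  by rewrite opprD addrA subrr sub0r opprK gtr0_norm//; lra.
Qed.

Lemma has_velocity_unique c a b t v w :
  has_velocity c a b t v -> has_velocity c a b t w -> v = w.
Proof.
move=> [ab tab cv] [_ _ cw].
have PF := within_itv_proper ab tab.
by apply: (cvg_unique _ cv cw); exact: norm_hausdorff.
Qed.

End velocity.

Section velocity_map.
Context {R : realType} {E F : normedModType R} {M : smoothSpaceType E}
  {N : smoothSpaceType F}.

Lemma has_velocity_map (f : M -> N) (c : R^o -> M) (a b t : R) (v : E) :
  smooth f -> {within `[a, b], continuous c} ->
  has_velocity c a b t v -> has_velocity (f \o c) a b t (tmap f (c t) v).
Proof.
move=> fS /(@subspace_continuousP R) cc [ab tab cv]; split => //.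
pose phi := chart_at (c t); pose psi := chart_at (f (c t)).
have Aphi : atlas phi by exact: chart_at_atlas.
have Apsi : atlas psi by exact: chart_at_atlas.
pose G := within [set` `[a, b]] t^'.
have FG : Filter G by exact: within_filter.
have lG (P : set R) : within [set` `[a, b]] (nbhs t) P -> G P.
  exact: nbhs_dnbhs.
have nG : \forall s \near G, cdom phi (c s).
  apply: lG; apply: (cc _ tab).
  by apply: open_nbhs_nbhs; split; [exact: cdom_open|exact: mem_chart_at].
have xc : phi (c s) @[s --> G] --> phi (c t).
  have H : phi (c s) @[s --> within [set` `[a, b]] (nbhs t)] --> phi (c t).
    apply: cvg_comp (cc _ tab) _; apply: (@cmap_continuous _ _ _ phi).
    exact: mem_chart_at.
  by move=> W /H; exact: lG.
pose x0 := phi (c t); pose g := psi \o f \o cinv phi; pose D := 'd g x0.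
have dg : differentiable g x0.
  have [_ /(_ _ _ Aphi Apsi)[+ _]] := fS 1%N; apply; split.
    by apply: cmap_cod; exact: mem_chart_at.
  split => //=; rewrite cmapK; exact: mem_chart_at.
pose q s := (s - t)^-1 *: (phi (c s) - x0).
have Dq : D (q s) @[s --> G] --> D v.
  by apply: (cvg_comp _ _ cv); apply: diff_continuous.
pose r s := (s - t)^-1 *: (g (phi (c s)) - g x0 - D (phi (c s) - x0)).
have r0 : r s @[s --> G] --> (0 : F).
  apply/cvgr0Pnorm_le => e e0.
  have v1 : 0 < `|v| + 1 by rewrite ltr_wpDl.
  have e1 : 0 < e / (`|v| + 1) by rewrite divr_gt0.
  have /eqaddoP/(_ _ e1) Ho := diff_locally dg.
  have hs : (phi (c s) - x0) @[s --> G] --> (0 : E).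
    by rewrite -(subrr x0); apply: cvgB => //; exact: cvg_cst.
  have nq : \forall s \near G, `|q s| <= `|v| + 1.
    by apply: (cvgr_norm_le _ cv); rewrite ltrDl.
  have {}Ho : \forall s \near G, `|(g \o shift x0 - (cst (g x0) + D)) (phi (c s) - x0)|
      <= e / (`|v| + 1) * `|phi (c s) - x0| := hs _ Ho.
  apply: filterS2 nq Ho => s qs /=; rewrite !fctE /= subrK opprD addrA => Ho.
  rewrite /r normrZ; apply: le_trans (ler_wpM2l (normr_ge0 _) Ho) _.
  by rewrite mulrCA -normrZ -/(q s) mulrAC ler_pdivrMr// ler_pM2l.
suff : (s - t)^-1 *: (psi (f (c s)) - psi (f (c t))) @[s --> G] --> D v by [].
have Dr := cvgD Dq r0; rewrite addr0 in Dr.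
move=> W /Dr DW; change (G [set s | W ((s - t)^-1 *: (psi (f (c s)) - psi (f (c t))))]).
have {}DW : G [set s | W (D (q s) + r s)] := DW.
apply: (@filterS2 _ G FG _ _ _ _ nG DW) => s cs; rewrite /= /r /q linearZ/= -scalerDr.
by rewrite [D _ + _]addrC subrK /g /= !cmapK//; exact: mem_chart_at.
Qed.
End velocity_map.

Section backtrack.
Context {R : realType} {E : normedModType R} {M : smoothSpaceType E}.
Implicit Types c : pc1path M.

Definition velocity c (t : R) (v : tangent (c t)) : Prop :=
  has_velocity c (pstart c) (pstop c) t v.
Arguments velocity c t v : clear implicits.

Definition reparam c1 c2 : Prop :=
  exists phi : R^o -> R^o, [/\
    piecewise (C1_on phi) (pstart c2) (pstop c2),
    {in `[pstart c2, pstop c2] &, {homo phi : s t / s < t}},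
    phi @` `[pstart c2, pstop c2]%classic = `[pstart c1, pstop c1]%classic &
    {in `[pstart c2, pstop c2], c2 =1 c1 \o phi}].

Definition reparam_equiv : pc1path M -> pc1path M -> Prop :=
  clos_refl_sym_trans _ reparam.

(* The symmetric case is covered by bt_equiv; reparametrization is the case of
   trivial b and d. *)
Definition backtrack c1 c2 : Prop :=
  exists a b d : pc1path M, [/\ pfinal a = pinit d, pfinal a = pinit b,
    reparam_equiv c1 (path_cat (path_cat (path_cat a d) (path_rev d)) b) &
    reparam_equiv c2 (path_cat a b)].

Definition bt_equiv : pc1path M -> pc1path M -> Prop :=
  clos_refl_sym_trans _ backtrack.

HB.instance Definition _ := gen_eqMixin (pc1path M).
HB.instance Definition _ := gen_choiceMixin (pc1path M).

Definition bt_equivb c1 c2 : bool := `[< bt_equiv c1 c2 >].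

Fact bt_equivb_refl : reflexive bt_equivb.
Proof. by move=> c; apply/asboolP; exact: rst_refl. Qed.

Fact bt_equivb_sym : symmetric bt_equivb.
Proof.
by move=> c1 c2; apply/idP/idP => /asboolP ?; apply/asboolP; exact: rst_sym.
Qed.

Fact bt_equivb_trans : transitive bt_equivb.
Proof.
by move=> c2 c1 c3 /asboolP ? /asboolP ?; apply/asboolP; exact: (@rst_trans _ _ _ c2).
Qed.

Canonical bt_equiv_rel :=
  EquivRel bt_equivb bt_equivb_refl bt_equivb_sym bt_equivb_trans.

End backtrack.

Arguments velocity {R E M} c t v.

Definition btpath {R : realType} {E : normedModType R} (M : smoothSpaceType E) :=
  {eq_quot (@bt_equiv_rel R E M)}.
HB.instance Definition _ {R : realType} {E : normedModType R} (M : smoothSpaceType E) := Quotient.on (btpath M).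

Definition btclass {R : realType} {E : normedModType R} {M : smoothSpaceType E}
  (c : pc1path M) : btpath M := \pi_(btpath M) c.

Section horizontal.
Context {R : realType} {E EP EM : normedModType R} {G : lieGroupType E}
  {P : manifoldType EP} {M : manifoldType EM} {B : principalBundle G P M}.
Variable A : connectionForm B.

Definition horizontal (c : pc1path P) : Prop :=
  forall t (v : tangent (c t)), velocity c t v -> A (c t) v = 0.

(* Backtrack-erased horizontal paths: horizontal paths up to backtrack
   equivalence of paths on P, i.e. the backtrack classes on P that contain a
   horizontal path. *)
Record hpath := HPath { hpath_val :> pc1path P; hpathP : horizontal hpath_val }.

HB.instance Definition _ := gen_eqMixin hpath.
HB.instance Definition _ := gen_choiceMixin hpath.

Definition hbt_equivb (c1 c2 : hpath) : bool := bt_equivb c1 c2.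

Fact hbt_equivb_refl : reflexive hbt_equivb.
Proof. by move=> c; exact: bt_equivb_refl. Qed.

Fact hbt_equivb_sym : symmetric hbt_equivb.
Proof. by move=> c1 c2; exact: bt_equivb_sym. Qed.

Fact hbt_equivb_trans : transitive hbt_equivb.
Proof. by move=> c2 c1 c3; exact: bt_equivb_trans. Qed.

Canonical hbt_equiv_rel :=
  EquivRel hbt_equivb hbt_equivb_refl hbt_equivb_sym hbt_equivb_trans.

Definition hbtpath := {eq_quot hbt_equiv_rel}.

HB.instance Definition _ := Quotient.on hbtpath.

Fact horizontal_cst p : horizontal (path_cst p).
Proof. by move=> t v []; rewrite ltxx. Qed.

Fact bact_smoothr g : smooth (fun p => bact B p g).
Proof.
move=> k; apply: (@Ckmap_comp _ _ _ _ _ _ _ _ setT setT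
  (fun p => (p, g)) (fun z => bact B z.1 z.2)) => //; try exact: openT.
  exact: Ckmap_pairr.
exact: bact_smooth.
Qed.

Definition path_act (c : pc1path P) g : pc1path P := path_map (bact_smoothr g) c.

Fact horizontal_act c (g : G) : horizontal c -> horizontal (path_act c g).
Proof.
move=> hc t v vv.
have bactK p : bact B (bact B p g) g^-1%g = p.
  by rewrite -bactM mulgV bact1.
have cE : (fun p => bact B p g^-1%g) \o path_act c g = c.
  by apply/funext => s; rewrite /= bactK.
pose w := tmap (fun p => bact B p g^-1%g) (path_act c g t) v.
have vw : has_velocity c (pstart c) (pstop c) t w.
  have := has_velocity_map (bact_smoothr g^-1%g) (@pcont _ _ _ (path_act c g)) vv.
  by rewrite cE.
have := has_velocity_map (bact_smoothr g) (@pcont _ _ _ c) vw.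
move=> /(has_velocity_unique vv) ->.
by rewrite cform_equiv (hc _ _ vw) linear0.
Qed.

Fact horizontal_cat c1 c2 : horizontal c1 -> horizontal c2 ->
  horizontal (path_cat c1 c2).
Proof.
move=> h1 h2; rewrite /path_cat; case: pselect => // c12 t v.
rewrite /velocity /= => vv.
have [lt_ad] := vv; rewrite in_itv/= => /andP[at_ td] _.
have le1 := pc1path_le c1; have le2 := pc1path_le c2.
have e1 : {in `[pstart c1, pstop c1], path_cat_fun c1 c2 =1 c1}.
  by move=> s; rewrite in_itv/= /path_cat_fun => /andP[_ ->].
have [/andP[ta tb]|] := boolP ((pstart c1 < pstop c1) && (t <= pstop c1)).
  have tI : t \in `[pstart c1, pstop c1] by rewrite in_itv/= at_.
  have vv1 : has_velocity (path_cat_fun c1 c2) (pstart c1) (pstop c1) t v.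
    by apply: has_velocity_sub vv => //; lra.
  rewrite (e1 _ tI); apply: h1.
  exact: has_velocity_eq e1 vv1.
move=> H.
have bt : pstop c1 <= t.
  move: H; rewrite negb_and -leNgt -ltNge => /orP[|/ltW//].
  by move=> ?; lra.
have bd : pstop c1 < pstop c1 - pstart c2 + pstop c2.
  move: H; rewrite negb_and -leNgt -ltNge => /orP[?|?]; lra.
have e2 : {in `[pstop c1, pstop c1 - pstart c2 + pstop c2],
    path_cat_fun c1 c2 =1 (fun s => c2 (pstart c2 - pstop c1 + s))}.
  move=> s; rewrite in_itv/= /path_cat_fun => /andP[cs _].
  case: ifPn => // sc; have -> : s = pstop c1 by apply/eqP; rewrite eq_le sc cs.
  by rewrite subrK -/(pinit c2) -c12.
have tI : t \in `[pstop c1, pstop c1 - pstart c2 + pstop c2].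
  by rewrite in_itv/= bt.
have vv1 : has_velocity (path_cat_fun c1 c2) (pstop c1)
    (pstop c1 - pstart c2 + pstop c2) t v.
  by apply: has_velocity_sub vv => //; lra.
have vv2 := has_velocity_shift (has_velocity_eq e2 vv1).
rewrite (e2 _ tI); apply: h2; rewrite /velocity.
have eb : pstart c2 - pstop c1 + pstop c1 = pstart c2 by lra.
have ed : pstart c2 - pstop c1 + (pstop c1 - pstart c2 + pstop c2) = pstop c2.
  by lra.
by rewrite eb ed in vv2.
Qed.

Definition hpath_cst (p : P) : hpath := HPath (@horizontal_cst p).

Definition hpath_act (c : hpath) (g : G) : hpath :=
  HPath (@horizontal_act c g (@hpathP c)).

Definition hpath_cat (c1 c2 : hpath) : hpath :=
  HPath (@horizontal_cat c1 c2 (@hpathP c1) (@hpathP c2)).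

Definition hclass (c : hpath) : hbtpath := \pi_hbtpath c.

End horizontal.

(* comp g f is g after f; its value is irrelevant unless src g = tgt f. *)
Record precategory := PreCategory {
  obj : Type;
  mor : Type;
  src : mor -> obj;
  tgt : mor -> obj;
  idm : obj -> mor;
  comp : mor -> mor -> mor }.

Record is_category (C : precategory) : Prop := IsCategory {
  src_idm : forall x : obj C, src (idm x) = x;
  tgt_idm : forall x : obj C, tgt (idm x) = x;
  src_comp : forall g f : mor C, src g = tgt f -> src (comp g f) = src f;
  tgt_comp : forall g f : mor C, src g = tgt f -> tgt (comp g f) = tgt g;
  comp_idr : forall f : mor C, comp f (idm (src f)) = f;
  comp_idl : forall f : mor C, comp (idm (tgt f)) f = f;
  comp_assoc : forall h g f : mor C, src h = tgt g -> src g = tgt f ->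
    comp h (comp g f) = comp (comp h g) f }.

Record is_functor (C D : precategory) (fo : obj C -> obj D)
    (fm : mor C -> mor D) : Prop := IsFunctor {
  functor_src : forall f, src (fm f) = fo (src f);
  functor_tgt : forall f, tgt (fm f) = fo (tgt f);
  functor_idm : forall x, fm (idm x) = idm (fo x);
  functor_comp : forall g f, src g = tgt f ->
    fm (comp g f) = comp (fm g) (fm f) }.

Record precatgroup := PreCatGroup {
  kobj : groupType;
  kmor : groupType;
  ksrc : kmor -> kobj;
  ktgt : kmor -> kobj;
  kidm : kobj -> kmor;
  kcomp : kmor -> kmor -> kmor }.

Definition catgroup_cat (K : precatgroup) : precategory :=
  PreCategory (@ksrc K) (@ktgt K) (@kidm K) (@kcomp K).

Coercion catgroup_cat : precatgroup >-> precategory.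

Section categorical.
Local Open Scope group_scope.
Record is_catgroup (K : precatgroup) : Prop := IsCatGroup {
  catgroup_is_category : is_category K;
  ksrcM : {morph @ksrc K : f g / f * g};
  ktgtM : {morph @ktgt K : f g / f * g};
  kidmM : {morph @kidm K : x y / x * y};
  kcompM : forall f2 f1 g2 g1 : kmor K, ksrc f2 = ktgt f1 -> ksrc g2 = ktgt g1 ->
    kcomp f2 f1 * kcomp g2 g1 = kcomp (f2 * g2) (f1 * g1) }.

Record precatbundle (K : precatgroup) := PreCatBundle {
  total : precategory;
  base : precategory;
  cproj_obj : obj total -> obj base;
  cproj_mor : mor total -> mor base;
  cact_obj : obj total -> kobj K -> obj total;
  cact_mor : mor total -> kmor K -> mor total }.

(* Both actions are right actions and together form a functor
   total * K -> total. *)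
Record is_principal_catbundle K (X : precatbundle K) : Prop :=
    IsPrincipalCatBundle {
  total_is_category : is_category (total X);
  base_is_category : is_category (base X);
  group_is_catgroup : is_catgroup K;
  cproj_is_functor : is_functor (@cproj_obj K X) (@cproj_mor K X);
  cact_obj1 : forall x : obj (total X), cact_obj x 1 = x;
  cact_objM : forall (x : obj (total X)) a b,
    cact_obj x (a * b) = cact_obj (cact_obj x a) b;
  cact_mor1 : forall f : mor (total X), cact_mor f 1 = f;
  cact_morM : forall (f : mor (total X)) k l,
    cact_mor f (k * l) = cact_mor (cact_mor f k) l;
  cact_src : forall (f : mor (total X)) k,
    src (cact_mor f k) = cact_obj (src f) (ksrc k);
  cact_tgt : forall (f : mor (total X)) k,
    tgt (cact_mor f k) = cact_obj (tgt f) (ktgt k);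
  cact_idm : forall (x : obj (total X)) a,
    cact_mor (idm x) (kidm a) = idm (cact_obj x a);
  cact_comp : forall (g f : mor (total X)) (l k : kmor K),
    src g = tgt f -> ksrc l = ktgt k ->
    cact_mor (comp g f) (kcomp l k) = comp (cact_mor g l) (cact_mor f k);
  cproj_obj_surj : forall y : obj (base X), exists x, cproj_obj x = y;
  cproj_mor_surj : forall f : mor (base X), exists m, cproj_mor m = f;
  cact_obj_free : forall (x : obj (total X)) a, cact_obj x a = x -> a = 1;
  cact_mor_free : forall (f : mor (total X)) k, cact_mor f k = f -> k = 1;
  cact_obj_fiber : forall x y : obj (total X),
    cproj_obj x = cproj_obj y <-> exists a, y = cact_obj x a;
  cact_mor_fiber : forall f g : mor (total X),
    cproj_mor f = cproj_mor g <-> exists k, g = cact_mor f k }.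

(* lift p f is only meaningful when src f = cproj_obj p. *)
Record is_catconnection K (X : precatbundle K)
    (lift : obj (total X) -> mor (base X) -> mor (total X)) : Prop :=
    IsCatConnection {
  lift_src : forall p f, src f = cproj_obj p -> src (lift p f) = p;
  lift_proj : forall p f, src f = cproj_obj p -> cproj_mor (lift p f) = f;
  lift_idm : forall p, lift p (idm (cproj_obj p)) = idm p;
  lift_comp : forall p f g, src f = cproj_obj p ->
    src g = cproj_obj (tgt (lift p f)) ->
    lift p (comp g f) = comp (lift (tgt (lift p f)) g) (lift p f);
  lift_act : forall p f a, src f = cproj_obj p ->
    cact_mor (lift p f) (kidm a) = lift (cact_obj p a) f }.

End categorical.

Section path_category.
Context {R : realType} {E : normedModType R} (M : smoothSpaceType E).

(* Operations on backtrack classes are computed on representatives. *)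
Definition btcomp (f2 f1 : btpath M) : btpath M :=
  btclass (path_cat (repr f1) (repr f2)).

Definition path_category : precategory :=
  PreCategory (fun f : btpath M => pinit (repr f))
    (fun f : btpath M => pfinal (repr f)) (fun p => btclass (path_cst p)) btcomp.

End path_category.

Section crossed_catgroup.
Local Open Scope group_scope.
Context {R : realType} {E F : normedModType R} {G : lieGroupType E}
  {H : lieGroupType F}.

(* H * G with the semidirect product law; an alias because H * G already
   carries the direct product group structure. *)
Definition xmor (X : lieCrossedModule G H) : Type := (H * G)%type.

Variable X : lieCrossedModule G H.
HB.instance Definition _ := Choice.on (xmor X).

Definition xmor_mul (f g : xmor X) : xmor X :=
  (f.1 * xalpha X f.2 g.1, f.2 * g.2).
Definition xmor_one : xmor X := (1, 1).
Definition xmor_inv (f : xmor X) : xmor X :=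
  (xalpha X f.2^-1 f.1^-1, f.2^-1).

Let xalphag1 a : xalpha X a 1 = 1.
Proof. by apply: (mulgI (xalpha X a 1)); rewrite -xalphaM !mulg1. Qed.

Fact xmor_mulA : associative xmor_mul.
Proof.
by move=> [h a] [k b] [l c]; rewrite /xmor_mul /= xalphaM xalphaA !mulgA.
Qed.
Fact xmor_mul1g : left_id xmor_one xmor_mul.
Proof. by move=> [h a]; rewrite /xmor_mul /= xalpha1 !mul1g. Qed.
Fact xmor_mulg1 : right_id xmor_one xmor_mul.
Proof. by move=> [h a]; rewrite /xmor_mul /= xalphag1 !mulg1. Qed.
Fact xmor_mulVg : left_inverse xmor_one xmor_inv xmor_mul.
Proof.
by move=> [h a]; rewrite /xmor_mul /= -xalphaM !mulVg xalphag1.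
Qed.
Fact xmor_mulgV : right_inverse xmor_one xmor_inv xmor_mul.
Proof.
by move=> [h a]; rewrite /xmor_mul /= -xalphaA !mulgV xalpha1 mulgV.
Qed.

HB.instance Definition _ := isGroup.Build (xmor X)
  xmor_mulA xmor_mul1g xmor_mulg1 xmor_mulVg xmor_mulgV.

Definition xcatgroup : precatgroup := {|
  kobj := G;
  kmor := xmor X;
  ksrc := fun f : xmor X => f.2;
  ktgt := fun f : xmor X => xtau X f.1 * f.2;
  kidm := fun a : G => (1, a) : xmor X;
  kcomp := fun f2 f1 : xmor X => (f2.1 * f1.1, f1.2) : xmor X |}.

End crossed_catgroup.

Section decorated.
Local Open Scope group_scope.
Context {R : realType} {E F EP EM : normedModType R} {G : lieGroupType E}
  {H : lieGroupType F} {P : manifoldType EP} {M : manifoldType EM}.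
Variables (X : lieCrossedModule G H) (B : principalBundle G P M)
  (A : connectionForm B).

Definition decmor : Type := (hbtpath A * H)%type.

Definition hact (f : hbtpath A) (g : G) : hbtpath A :=
  hclass (hpath_act (repr f) g).

Definition hcomp (f2 f1 : hbtpath A) : hbtpath A :=
  hclass (hpath_cat (repr f1) (repr f2)).

Definition decorated_category : precategory := {|
  obj := P;
  mor := decmor;
  src := fun f : decmor => pinit (repr f.1);
  tgt := fun f : decmor => bact B (pfinal (repr f.1)) (xtau X f.2^-1);
  idm := fun p => (hclass (hpath_cst A p), 1);
  comp := fun f2 f1 => (hcomp (hact f2.1 (xtau X f1.2)) f1.1, f2.2 * f1.2) |}.

Definition decorated_bundle : precatbundle (xcatgroup X) :=
  @PreCatBundle (xcatgroup X) decorated_category (path_category M)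
    (bproj B)
    (fun f : decmor => btclass (path_map (bproj_smooth B) (repr f.1)) : btpath M)
    (bact B)
    (fun (f : decmor) (k : xmor X) =>
      (hact f.1 k.2, xalpha X k.2^-1 (k.1^-1 * f.2))).

Definition is_hlift (c : pc1path M) (u : P) (ct : hpath A) : Prop :=
  [/\ pstart ct = pstart c, pstop ct = pstop c,
    {in `[pstart c, pstop c], bproj B \o ct =1 c} & pinit ct = u].

(* h solves h^-1 h' = - C(ct') with h = 1 initially, where ct is a lift of c. *)
Definition is_hsol (C : forall p : P, {linear tangent p -> tangent (1 : H)})
    (c : pc1path M) (ct : hpath A) (h : pc1path H) : Prop :=
  [/\ pstart h = pstart c, pstop h = pstop c, pinit h = 1 &
    forall t, (exists v, velocity c t v) ->
      exists (w : tangent (ct t)) (k : tangent (h t)),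
        [/\ velocity ct t w, velocity h t k &
            tmap (fun x : H => (h t)^-1 * x) (h t) k = (- C (ct t) w)%R]].

End decorated.

(* Main.v *)
(* Over a local section s of the bundle, a horizontal lift of c is
   (s o c) k^-1 with k^-1 k' = A((s o c)'), and h solves h^-1 h' = -C(ct'); both
   are left-invariant equations on a Lie group. They are solved locally by Picard
   iteration in the chart at 1, and the local solutions are translated and
   concatenated. Uniqueness needs no Lipschitz estimate: the quotient of two
   solutions has zero velocity. Uniqueness also shows that the solution
   (ct, h(final)) over a concatenation, a reversal or a reparametrization of paths
   is obtained from the solutions over the pieces, so a backtrack d d^-1 lifts to
   a backtrack and contributes g g^-1 = 1 to h(final); hence the lift depends only
   on the backtrack class. Functoriality and equivariance follow from
   alpha(tau(g)^-1)(k) = g^-1 k g and from the equivariance of C. *)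
Require Import Defs.
From mathcomp Require Import all_boot all_order all_algebra.
From mathcomp Require Import generic_quotient.
From mathcomp Require Import mathcomp_extra boolp classical_sets functions.
From mathcomp Require Import set_interval.
From mathcomp Require Import reals ereal topology normedtype landau derive.
From mathcomp Require Import prodnormedzmodule realfun.
From mathcomp Require Import sequences measure lebesgue_measure.
From mathcomp Require Import lebesgue_integral ftc.
From mathcomp Require Import lra.
From Stdlib Require Import Relation_Operators.

Set Implicit Arguments.
Unset Strict Implicit.
Unset Printing Implicit Defensive.
Import Order.TTheory GRing.Theory Num.Theory.
Import numFieldNormedType.Exports.

Local Open Scope classical_set_scope.
Local Open Scope quotient_scope.
Local Open Scope ring_scope.

Local Notation path_map := Defs.path_map.

(** * Piecewise paths and backtracking *)

Section piecewise.
Context {R : realType}.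
Implicit Types (a b s t : R) (Q : R -> R -> Prop).

(** The obstacle that shapes the proof is the break points. The equation for h is demanded wherever
    c has a velocity, which may include a break point of the chosen subdivision, while solving on
    each side of it gives only one-sided velocities. The proof therefore works with predicates on
    pieces, with one-sided velocities at their ends, and recovers the two-sided statement at the
    very end from the velocity of c: a horizontal vector is determined by its projection to M, and a
    tangent vector of H by its Maurer-Cartan image. Global existence rests on translation
    invariance: every initial value is a translate of one fixed local solution, so the length of the
    local interval does not depend on the initial value and no solution escapes in finite time.
    Tangent vectors are coordinates in a preferred chart that may jump from point to point. Mean
    value arguments are therefore carried out in one fixed chart, and base points that are equal
    only by a group law are exchanged by small lemmas or by [etrans] rather than by rewriting inside
    dependent types. *)

Definition itv_closed_pred Q := forall a b a' b',
  a <= a' -> a' <= b' -> b' <= b -> Q a b -> Q a' b'.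

(** Compactness of the interval in the form of a supremum argument: the local hypothesis at the
    supremum of the reachable points carries a piece across it, unless it is already [b]. *)
Lemma piecewise_local Q a b : a <= b ->
  (forall t, a <= t <= b -> exists2 d, 0 < d & forall s s',
    a <= s -> s <= s' -> s' <= b -> t - d < s -> s' < t + d -> Q s s') ->
  piecewise Q a b.
Proof.
move=> ab H; pose S := [set t | a <= t <= b /\ piecewise Q a t].
have Sa : S a.
  split; first by rewrite lexx.
  apply: piecewise1 => //; have [|d d0] := H a; first by rewrite lexx.
  by apply=> //; lra.
have ubS : ubound S b by move=> t [/andP[]].
have supS : has_sup S by split; [exists a|exists b].
have aS : a <= sup S by apply: ub_le_sup => //; exists b.
have Sb : sup S <= b by apply: ge_sup => //; exists a.
have [|d d0 Hd] := H (sup S); first by rewrite aS.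
have [t [/andP[at_ tb] Qat] dt] := sup_adherent d0 supS.
have tS : t <= sup S by apply: ub_le_sup; [exists b|split; rewrite ?at_].
(* A reachable point beyond the supremum would contradict it, so the minimum must be [b]. *)
pose s := Num.min b (sup S + d / 2).
have sb : s <= b by rewrite ge_min lexx.
have sd : s <= sup S + d / 2 by rewrite ge_min lexx orbT.
have Ss : sup S <= s by rewrite le_min Sb/=; lra.
have Qas : piecewise Q a s.
  by apply: (piecewise_cat Qat); apply: piecewise1; [lra|apply: Hd => //; lra].
suff <- : s = b by [].
have : s <= sup S by apply: ub_le_sup; [exists b|split => //; lra].
rewrite /s; have [//|?] := leP b (sup S + d / 2); lra.
Qed.

Lemma piecewise_restrict Q a b s t : itv_closed_pred Q -> piecewise Q a b ->
  a <= s -> s <= t -> t <= b -> piecewise Q s t.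
Proof.
move=> HQ H; elim: H s t => {a b} [a b ab Qab|a m b Qam IH1 Qmb IH2] s t as_ st tb.
  by apply: piecewise1 => //; exact: HQ Qab.
have [tm|mt] := leP t m; first exact: IH1.
have [ms|sm] := leP m s; first exact: IH2.
by apply: (@piecewise_cat _ _ _ m); [apply: IH1|apply: IH2] => //; exact: ltW.
Qed.

(** The form in which uniqueness results are used: agreement at the left end of a piece spreads over
    the piece, and its right end starts the next one. *)
Lemma piecewise_eq (T : Type) (f g : R -> T) a b :
  piecewise (fun s t => f s = g s -> {in `[s, t], f =1 g}) a b ->
  f a = g a -> {in `[a, b], f =1 g}.
Proof.
elim=> {a b} [//|a m b H1 IH1 H2 IH2 fa t].
rewrite in_itv/= => /andP[at_ tb]; have am := piecewise_le H1.
have [tm|mt] := leP t m; first by apply: IH1 => //; rewrite in_itv/= at_.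
apply: IH2; last by rewrite in_itv/= (ltW mt) tb.
by apply: IH1 => //; rewrite in_itv/= am lexx.
Qed.

(** Common refinement of two subdivisions; cutting the pieces of one along the other needs both
    predicates to pass to subintervals. *)
Lemma piecewise_and Q Q' a b : itv_closed_pred Q -> itv_closed_pred Q' ->
  piecewise Q a b -> piecewise Q' a b -> piecewise (fun s t => Q s t /\ Q' s t) a b.
Proof.
move=> HQ HQ'; elim=> {a b} [a b ab Qab H|a m b Qam IH1 Qmb IH2 H].
  by apply: piecewise_sub H _ => s t as_ st tb Q'st; split => //; exact: HQ Qab.
have ? := piecewise_le Qam; have ? := piecewise_le Qmb.
by apply: (@piecewise_cat _ _ _ m); [apply: IH1|apply: IH2];
  apply: piecewise_restrict H _ _ _.
Qed.

Definition increasing_onto (phi : R -> R) a b a' b' :=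
  {in `[a, b] &, {homo phi : s t / s < t}} /\
  phi @` `[a, b]%classic = `[a', b']%classic.

Lemma increasing_onto_le phi a b a' b' : increasing_onto phi a b a' b' ->
  {in `[a, b] &, {homo phi : s t / s <= t}}.
Proof.
move=> [mon _] s t sab tab; rewrite le_eqVlt => /predU1P[->//|st].
by apply/ltW/mon.
Qed.

Lemma increasing_onto_ends phi a b a' b' : a <= b -> a' <= b' ->
  increasing_onto phi a b a' b' -> phi a = a' /\ phi b = b'.
Proof.
move=> ab ab' H; have mon := increasing_onto_le H; have [_ im] := H.
have aI : a \in `[a, b] by rewrite in_itv/= lexx.
have bI : b \in `[a, b] by rewrite in_itv/= lexx andbT.
have phiI t : t \in `[a, b] -> a' <= phi t <= b'.
  move=> tI; have : (phi @` `[a, b]) (phi t) by exists t.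
  by rewrite im /= in_itv.
have [s sI sa] : (phi @` `[a, b]) a' by rewrite im /= in_itv/= lexx.
have [t tI tb] : (phi @` `[a, b]) b' by rewrite im /= in_itv/= lexx andbT.
split; apply/eqP; rewrite eq_le.
- have /andP[-> _] := phiI a aI; rewrite andbT -sa mon//.
  by move: sI; rewrite /= in_itv/= => /andP[].
- have /andP[_ ->] := phiI b bI; rewrite /= -tb mon//.
  by move: tI; rewrite /= in_itv/= => /andP[].
Qed.

(** Surjectivity stands in for the intermediate value theorem: a preimage in [a, b] of a value
    between [phi s] and [phi t] lies in [s, t] by strict monotonicity. *)
Lemma increasing_onto_restrict phi a b a' b' s t : increasing_onto phi a b a' b' ->
  a <= s -> s <= t -> t <= b -> increasing_onto phi s t (phi s) (phi t).
Proof.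
move=> H as_ st tb; have mon := increasing_onto_le H; have [smon im] := H.
have sub x : x \in `[s, t] -> x \in `[a, b] by rewrite !in_itv/=; lra.
have sI : s \in `[a, b] by rewrite in_itv/=; lra.
have tI : t \in `[a, b] by rewrite in_itv/=; lra.
split; first by move=> x y /sub ? /sub ?; exact: smon.
apply/seteqP; split => [_ [x /= xst <-]|y /=].
  have := xst; rewrite !in_itv/= => /andP[? ?].
  by rewrite (mon _ _ sI (sub _ xst))// (mon _ _ (sub _ xst) tI).
rewrite in_itv/= => /andP[sy yt].
have phiI u : u \in `[a, b] -> a' <= phi u <= b'.
  move=> uI; have : (phi @` `[a, b]) (phi u) by exists u.
  by rewrite im /= in_itv.
have [x xab xy] : (phi @` `[a, b]) y.
  rewrite im /= in_itv/=; have := phiI _ sI; have := phiI _ tI; lra.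
exists x => //=; rewrite in_itv/=; apply/andP; split; rewrite leNgt; apply/negP => lt.
  by have := smon _ _ xab sI lt; rewrite xy ltNge sy.
by have := smon _ _ tI xab lt; rewrite xy ltNge yt.
Qed.

(** Each cut is pulled back to its preimage; the source interval shrinks with every cut and is
    therefore generalized in the induction. *)
Lemma piecewise_pullback Q phi a b a' b' : a <= b ->
  increasing_onto phi a b a' b' -> piecewise Q a' b' ->
  piecewise (fun s t => Q (phi s) (phi t)) a b.
Proof.
move=> ab H Qab; elim: Qab a b ab H => {a' b'} [a' b' ab' Q1|a' m b' Q1 IH1 Q2 IH2] a b ab H.
  by apply: piecewise1 => //; have [-> ->] := increasing_onto_ends ab ab' H.
have am := piecewise_le Q1; have mb := piecewise_le Q2.
have [Ea Eb] := increasing_onto_ends ab (le_trans am mb) H.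
have [x xab xm] : (phi @` `[a, b]) m by rewrite H.2 /= in_itv/= am.
move: xab; rewrite /= in_itv/= => /andP[ax xb].
apply: (@piecewise_cat _ _ _ x).
  by apply: IH1 => //; rewrite -Ea -xm; exact: increasing_onto_restrict H _ _ _.
by apply: IH2 => //; rewrite -Eb -xm; exact: increasing_onto_restrict H _ _ _.
Qed.

End piecewise.

Section C1_on.
Context {R : realType}.
Implicit Types a b s t : R.

Lemma Ckmap_sub k (E F : normedModType R) (M : smoothSpaceType E)
    (N : smoothSpaceType F) (U V : set M) (f : M -> N) :
  V `<=` U -> Ckmap k U f -> Ckmap k V f.
Proof.
move=> VU [cf kf]; split; first by move=> x /VU /cf.
by move=> phi psi Aphi Apsi; apply: Ck_sub (kf _ _ Aphi Apsi) => x [? [/VU]].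
Qed.

Variables (E : normedModType R) (M : smoothSpaceType E).
Implicit Types c : R^o -> M.

Lemma C1_on_sub c : itv_closed_pred (C1_on c).
Proof.
move=> a b a' b' aa ab bb [U [d [oU sub Ud cd]]]; exists U, d; split => //.
  by move=> t /= tI; apply: sub; move: tI; rewrite /= !in_itv/=; lra.
by move=> t tI; apply: cd; move: tI; rewrite !in_itv/=; lra.
Qed.

Lemma C1_on_continuous c a b : C1_on c a b -> {within `[a, b], continuous c}.
Proof.
move=> [U [d [oU sub [cd _] ce]]].
apply: (@continuous_within_eq _ _ _ d); first by move=> t /ce.
by apply: continuous_in_subspaceT => t; rewrite inE => /sub /cd.
Qed.

Lemma C1_on_comp c (phi : R^o -> R^o) a b a' b' : C1_on phi a b -> C1_on c a' b' ->
  (forall t, t \in `[a, b] -> phi t \in `[a', b']) -> C1_on (c \o phi) a b.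
Proof.
move=> [V [psi [oV sV Vpsi psiE]]] [U [d [oU sU Ud dE]]] H.
have oW : open (V `&` psi @^-1` U).
  by apply: open_preimage_on => // x Vx; have [+ _] := Vpsi; apply.
exists (V `&` psi @^-1` U), (d \o psi); split => //.
- move=> t tI; split; first exact: sV.
  by rewrite /= -psiE//; apply: sU; exact: H.
- apply: (Ckmap_comp oW oU) Ud; first by move=> x [].
  by apply: Ckmap_sub Vpsi => x [].
- by move=> t tI /=; rewrite -psiE// dE//; exact: H.
Qed.

Lemma C1_on_map (F : normedModType R) (N : smoothSpaceType F) (f : M -> N) c a b :
  smooth f -> C1_on c a b -> C1_on (f \o c) a b.
Proof.
move=> fS [U [d [oU stU dU cd]]]; exists U, (f \o d); split => //.
  by apply: (Ckmap_comp (V := setT)) dU (fS 1%N) => //; exact: openT.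
by move=> x /cd /= ->.
Qed.

Lemma piecewise_continuous c a b : piecewise (C1_on c) a b ->
  {within `[a, b], continuous c}.
Proof.
elim=> {a b} [a b ab|a m b H1 IH1 H2 IH2]; first exact: C1_on_continuous.
exact: continuous_within_cat (piecewise_le H1) (piecewise_le H2) IH1 IH2.
Qed.

Definition mkpath c a b (H : piecewise (C1_on c) a b) : pc1path M :=
  PC1Path (piecewise_continuous H) H.

End C1_on.

(** Made for concatenation with a fixed path, which respects a relation only between composable
    paths: the end point [v] is constant along a chain, so the condition [v x = z] holds at every
    link. *)
Lemma rst_map (T T' C : Type) (r : T -> T -> Prop) (r' : T' -> T' -> Prop)
    (f : T -> T') (v : T -> C) (z : C) x y :
  (forall x y, r x y -> v x = v y) ->
  (forall x y, r x y -> v x = z -> clos_refl_sym_trans _ r' (f x) (f y)) ->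
  clos_refl_sym_trans _ r x y -> v x = z -> clos_refl_sym_trans _ r' (f x) (f y).
Proof.
move=> rv rf xy; suff : (v x = z -> clos_refl_sym_trans _ r' (f x) (f y)) /\ v x = v y.
  by case.
elim: xy => {x y} [x y xy|x|x y _ [IH1 IH2]|x y w _ [IH1 IH2] _ [IH3 IH4]].
- by split; [exact: rf|exact: rv].
- by split => // _; exact: rst_refl.
- by split => // yz; apply: rst_sym; apply: IH1; rewrite IH2.
- by split => [xz|]; [apply: rst_trans (IH1 xz) (IH3 _); rewrite -IH2|rewrite IH2].
Qed.

Lemma rst_inv (T C : Type) (r : T -> T -> Prop) (v : T -> C) x y :
  (forall x y, r x y -> v x = v y) -> clos_refl_sym_trans _ r x y -> v x = v y.
Proof.
move=> rv; elim=> {x y} [|//|x y _ ->//|x y z _ -> _ ->//]; exact: rv.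
Qed.

(** * Reparametrization and concatenation of paths *)

Section path_algebra.
Context {R : realType} {E : normedModType R} {M : smoothSpaceType E}.
Implicit Types a b c d : pc1path M.

Lemma reparamP c1 c2 : reparam c1 c2 <-> exists phi : R^o -> R^o,
  [/\ piecewise (C1_on phi) (pstart c2) (pstop c2),
    increasing_onto phi (pstart c2) (pstop c2) (pstart c1) (pstop c1) &
    {in `[pstart c2, pstop c2], c2 =1 c1 \o phi}].
Proof.
split=> [[phi [? ? ? ?]]|[phi [? [? ?] ?]]]; exists phi; split => //.
Qed.

Lemma C1_on_shift (m s t : R) : C1_on (fun x : R^o => m + x : R^o) s t.
Proof.
exists setT, (fun x => m + 1 * x); split => //; first exact: openT.
  exact: Ckmap_affine.
by move=> x _; rewrite mul1r.
Qed.

Lemma reparam_shift c1 c2 m : pstart c1 = m + pstart c2 ->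
  pstop c1 = m + pstop c2 -> {in `[pstart c2, pstop c2], forall t, c2 t = c1 (m + t)} ->
  reparam c1 c2.
Proof.
move=> e1 e2 H; apply/reparamP; exists (fun t => m + t); split => //.
  by apply: piecewise1; [exact: pc1path_le|exact: C1_on_shift].
split; first by move=> s t _ _; rewrite ltrD2l.
apply/seteqP; split => [_ [t /= tI <-]|t /=]; rewrite e1 e2.
  by move: tI; rewrite !in_itv/= !lerD2l.
move=> tI; exists (t - m); last by rewrite subrKC.
by move: tI; rewrite /= !in_itv/=; lra.
Qed.

Lemma reparam_eq c1 c2 : pstart c1 = pstart c2 -> pstop c1 = pstop c2 ->
  {in `[pstart c1, pstop c1], c1 =1 c2} -> reparam c1 c2.
Proof.
move=> e1 e2 H; apply: (@reparam_shift _ _ 0); rewrite ?add0r// -e1 -e2.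
by move=> t tI; rewrite add0r H.
Qed.

Lemma reparam_ends c1 c2 : reparam c1 c2 ->
  (pinit c1, pfinal c1) = (pinit c2, pfinal c2).
Proof.
move=> /reparamP[phi [_ H cE]].
have [E1 E2] := increasing_onto_ends (pc1path_le c2) (pc1path_le c1) H.
have le := pc1path_le c2.
rewrite /pinit /pfinal !cE/= ?E1 ?E2 ?in_itv/= ?lexx ?le//.
Qed.

Lemma reparam_equiv_ends c1 c2 : reparam_equiv c1 c2 ->
  (pinit c1, pfinal c1) = (pinit c2, pfinal c2).
Proof. exact: (rst_inv reparam_ends). Qed.

Lemma path_cat_start c1 c2 : pstart (path_cat c1 c2) = pstart c1.
Proof. by rewrite /path_cat; case: pselect. Qed.

Section composable.
Variables c1 c2 : pc1path M.
Hypothesis c12 : pfinal c1 = pinit c2.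

Lemma path_cat_stop : pstop (path_cat c1 c2) = pstop c1 - pstart c2 + pstop c2.
Proof. by rewrite /path_cat; case: pselect. Qed.

Lemma path_catE t : path_cat c1 c2 t = path_cat_fun c1 c2 t.
Proof. by rewrite /path_cat; case: pselect. Qed.

Lemma path_catEl t : t <= pstop c1 -> path_cat c1 c2 t = c1 t.
Proof. by rewrite path_catE /path_cat_fun => ->. Qed.

Lemma path_catEr t : pstop c1 <= t ->
  path_cat c1 c2 t = c2 (pstart c2 - pstop c1 + t).
Proof.
rewrite path_catE /path_cat_fun => ct; case: ifPn => // tc.
have -> : t = pstop c1 by apply/eqP; rewrite eq_le tc ct.
by rewrite subrK -/(pinit c2) -c12.
Qed.

Lemma path_cat_init : pinit (path_cat c1 c2) = pinit c1.
Proof. by rewrite /pinit path_cat_start path_catEl ?pc1path_le. Qed.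

Lemma path_cat_final : pfinal (path_cat c1 c2) = pfinal c2.
Proof.
rewrite /pfinal path_cat_stop path_catEr.
  by congr (c2 _); lra.
by have := pc1path_le c2; lra.
Qed.

End composable.

Lemma path_rev_init c : pinit (path_rev c) = pfinal c.
Proof. by rewrite /pinit /= /path_rev_fun addrAC subrr add0r. Qed.

Lemma path_rev_final c : pfinal (path_rev c) = pinit c.
Proof. by rewrite /pfinal /= /path_rev_fun addrK. Qed.

End path_algebra.

Section path_cat_reparam.
Context {R : realType} {E : normedModType R} {M : smoothSpaceType E}.
Implicit Types a b c d : pc1path M.

(* The concatenated reparametrization is itself a concatenation of paths in
   the real line. *)
Lemma reparam_cat c1 c1' c2 c2' : pfinal c1 = pinit c2 ->
  reparam c1 c1' -> reparam c2 c2' -> reparam (path_cat c1 c2) (path_cat c1' c2').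
Proof.
move=> c12 r1 r2.
have c12' : pfinal c1' = pinit c2'.
  by have [_ <-] := reparam_ends r1; have [<- _] := reparam_ends r2.
have [p1 [P1 I1 F1]] := (reparamP _ _).1 r1; have [p2 [P2 I2 F2]] := (reparamP _ _).1 r2.
have le1 := pc1path_le c1; have le1' := pc1path_le c1'.
have le2 := pc1path_le c2; have le2' := pc1path_le c2'.
have [Ea1 Eb1] := increasing_onto_ends le1' le1 I1.
have [Ea2 Eb2] := increasing_onto_ends le2' le2 I2.
(* [path_cat] moves the domain of [c2] by [m], so the values of the second reparametrization have to
   be moved by the same amount. *)
pose m := pstop c1 - pstart c2.
have P2' : piecewise (C1_on (fun t => m + p2 t : R^o)) (pstart c2') (pstop c2').
  apply: piecewise_sub P2 _ => s t ? ? ? Pst.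
  apply: (C1_on_comp Pst (@C1_on_shift _ m (pstart c2) (pstop c2))) => x.
  rewrite in_itv/= => /andP[sx xt].
  have xI : x \in `[pstart c2', pstop c2'] by rewrite in_itv/=; lra.
  have : (p2 @` `[pstart c2', pstop c2']) (p2 x) by exists x.
  by rewrite I2.2.
pose q1 := mkpath P1; pose q2 := mkpath P2'.
have q12 : pfinal q1 = pinit q2.
  by rewrite /pfinal /pinit /= Ea2 Eb1 /m subrK.
pose phi := path_cat q1 q2.
have phis : pstart phi = pstart (path_cat c1' c2') by rewrite !path_cat_start.
have phie : pstop phi = pstop (path_cat c1' c2') by rewrite !path_cat_stop.
have phil t : t <= pstop c1' -> phi t = p1 t by move=> ?; rewrite [phi t]path_catEl.
have phir t : pstop c1' <= t -> phi t = m + p2 (pstart c2' - pstop c1' + t).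
  by move=> ?; rewrite [phi t]path_catEr.
pose e := pstop c1' - pstart c2' + pstop c2'.
have p1le t : t \in `[pstart c1', pstop c1'] -> pstart c1 <= p1 t <= pstop c1.
  move=> tI; have : (p1 @` `[pstart c1', pstop c1']) (p1 t) by exists t.
  by rewrite I1.2 /= in_itv.
have p2le t : t \in `[pstart c2', pstop c2'] -> pstart c2 <= p2 t <= pstop c2.
  move=> tI; have : (p2 @` `[pstart c2', pstop c2']) (p2 t) by exists t.
  by rewrite I2.2 /= in_itv.
apply/reparamP; exists phi; rewrite -phis -phie; split; first exact: ppiecewise.
  rewrite phis phie !path_cat_start !path_cat_stop// -/m -/e.
  split=> [s t|].
    rewrite !in_itv/= => /andP[s1 s2] /andP[t1 t2] st.
    have [tb|bt] := leP t (pstop c1').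
      rewrite !phil//; last by lra.
      by apply: I1.1 => //; rewrite in_itv/=; lra.
    have [sb|bs] := leP s (pstop c1').
      rewrite phil// phir; last exact: ltW.
      have /andP[_ ?] : pstart c1 <= p1 s <= pstop c1 by apply: p1le; rewrite in_itv/= s1.
      have : p2 (pstart c2') < p2 (pstart c2' - pstop c1' + t).
        by apply: I2.1; rewrite ?in_itv/=; rewrite /e in t2; lra.
      by rewrite Ea2 /m; lra.
    rewrite !phir ?ltrD2l; [|exact: ltW|exact: ltW].
    by apply: I2.1; rewrite ?in_itv/= ?ltrD2l//; rewrite /e in s2 t2; lra.
  apply/seteqP; split => [_ [t /= tI <-]|y /=].
    move: tI; rewrite !in_itv/= /e => /andP[t1 t2].
    have [tb|/ltW bt] := leP t (pstop c1').
      have := p1le t; rewrite phil// in_itv/= t1 tb => /(_ isT); rewrite /m; lra.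
    have := p2le (pstart c2' - pstop c1' + t); rewrite phir// in_itv/= => H.
    have /H : pstart c2' <= pstart c2' - pstop c1' + t <= pstop c2' by lra.
    by rewrite /m; lra.
  rewrite in_itv/= => /andP[y1 y2]; have [yb|/ltW by_] := leP y (pstop c1).
    have [x xI <-] : (p1 @` `[pstart c1', pstop c1']) y by rewrite I1.2 /= in_itv/= y1.
    move: xI; rewrite /= in_itv/= => /andP[x1 x2].
    by exists x; [rewrite /= in_itv/= /e; lra|rewrite phil].
  have [x xI xy] : (p2 @` `[pstart c2', pstop c2']) (y - m).
    by rewrite I2.2 /= in_itv/=; rewrite /m in y2 *; lra.
  move: xI; rewrite /= in_itv/= => /andP[x1 x2].
  exists (pstop c1' - pstart c2' + x); first by rewrite /= in_itv/= /e; lra.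
  rewrite phir; last by lra.
  rewrite (_ : _ + (_ + x) = x); last by lra.
  by rewrite xy subrKC.
rewrite phis phie path_cat_start path_cat_stop// => t; rewrite in_itv/= => /andP[t1 t2] /=.
have [tb|/ltW bt] := leP t (pstop c1').
  have tI : t \in `[pstart c1', pstop c1'] by rewrite in_itv/= t1.
  rewrite path_catEl// phil// F1// path_catEl//.
  by have /andP[] := p1le t tI.
have tI : pstart c2' - pstop c1' + t \in `[pstart c2', pstop c2'] by rewrite in_itv/=; lra.
rewrite path_catEr// phir// F2// path_catEr//; last first.
  by have /andP[+ _] := p2le _ tI; rewrite /m; lra.
by congr (c2 _) => /=; rewrite /m; lra.
Qed.

Lemma reparam_refl c : reparam c c.
Proof. exact: reparam_eq. Qed.

Lemma reparam_equiv_catl c1 c1' c2 : pfinal c1 = pinit c2 ->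
  reparam_equiv c1 c1' -> reparam_equiv (path_cat c1 c2) (path_cat c1' c2).
Proof.
move=> c12 r1.
apply: (rst_map (f := fun c => path_cat c c2) (v := pfinal) _ _ r1 c12).
  by move=> ? ? /reparam_ends[].
move=> x y xy xz; apply: rst_step.
exact: reparam_cat xz xy (reparam_refl _).
Qed.

Lemma reparam_equiv_catr c1 c2 c2' : pfinal c1 = pinit c2 ->
  reparam_equiv c2 c2' -> reparam_equiv (path_cat c1 c2) (path_cat c1 c2').
Proof.
move=> c12 r2.
apply: (rst_map (f := path_cat c1) (v := pinit) _ _ r2 (esym c12)).
  by move=> ? ? /reparam_ends[].
move=> x y xy xz; apply: rst_step.
exact: reparam_cat (esym xz) (reparam_refl _) xy.
Qed.

(** Concatenation moves only the later paths, so both sides have the same domain and the same values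
    on it. *)
Lemma path_catA c1 c2 c3 : pfinal c1 = pinit c2 -> pfinal c2 = pinit c3 ->
  reparam (path_cat (path_cat c1 c2) c3) (path_cat c1 (path_cat c2 c3)).
Proof.
move=> c12 c23; have le1 := pc1path_le c1; have le2 := pc1path_le c2.
have c12_3 : pfinal (path_cat c1 c2) = pinit c3 by rewrite path_cat_final.
have c1_23 : pfinal c1 = pinit (path_cat c2 c3) by rewrite path_cat_init.
apply: reparam_eq.
- by rewrite !path_cat_start.
- rewrite path_cat_stop// path_cat_stop// path_cat_stop// path_cat_stop//.
  by rewrite path_cat_start; lra.
move=> t _.
have [t1|/ltW t1] := leP t (pstop c1).
  have t1' : t <= pstop (path_cat c1 c2).
    by rewrite path_cat_stop//; have := pc1path_le c2; lra.
  by rewrite (path_catEl c12_3 t1') (path_catEl c12 t1) (path_catEl c1_23 t1).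
rewrite [RHS](path_catEr c1_23 t1) path_cat_start.
have [t2|/ltW t2] := leP t (pstop (path_cat c1 c2)).
  rewrite (path_catEl c12_3 t2) (path_catEr c12 t1) path_catEl//.
  by rewrite path_cat_stop// in t2; lra.
rewrite (path_catEr c12_3 t2); rewrite path_cat_stop// in t2 *.
by rewrite path_catEr//; [congr (c3 _); lra|lra].
Qed.

Lemma path_cat_cst_r c (p : M) : pfinal c = p -> reparam (path_cat c (path_cst p)) c.
Proof.
move=> cp; apply: reparam_eq; first by rewrite path_cat_start.
- by rewrite path_cat_stop//= subr0 addr0.
- rewrite path_cat_start path_cat_stop//= subr0 addr0 => t.
  by rewrite in_itv/= => /andP[_ ?]; rewrite path_catEl.
Qed.

(** Unlike the case on the right, this needs a shift: the constant path lives on [0, 0], so [c] is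
    moved to start at 0. *)
Lemma path_cat_cst_l c (p : M) : p = pinit c -> reparam c (path_cat (path_cst p) c).
Proof.
move=> cp; have pc : pfinal (path_cst p) = pinit c by [].
apply: (@reparam_shift _ _ _ _ _ (pstart c)).
- by rewrite path_cat_start addr0.
- by rewrite path_cat_stop//=; lra.
- rewrite path_cat_start => t; rewrite in_itv/= => /andP[t0 _].
  by rewrite path_catEr//= subr0.
Qed.

Lemma path_rev_cst (p : M) : reparam (path_rev (path_cst p)) (path_cst p).
Proof. exact: reparam_eq. Qed.

Lemma reparam_equiv_backtrack c1 c2 : reparam_equiv c1 c2 -> backtrack c1 c2.
Proof.
move=> r12; exists c2, (path_cst (pfinal c2)), (path_cst (pfinal c2)).
have e1 : pfinal c2 = pinit (path_cst (pfinal c2)) by [].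
have e2 : pfinal (path_cat c2 (path_cst (pfinal c2))) =
  pinit (path_rev (path_cst (pfinal c2))) by rewrite path_cat_final.
split => //; last by apply/rst_sym/rst_step; exact: path_cat_cst_r.
apply: rst_trans r12 _; apply: rst_sym.
apply: rst_trans (_ : reparam_equiv _ (path_cat c2 (path_cst (pfinal c2)))) _.
  apply: reparam_equiv_catl; first by rewrite path_cat_final.
  apply: rst_trans (_ : reparam_equiv _ 
      (path_cat (path_cat c2 (path_cst (pfinal c2))) (path_cst (pfinal c2)))) _.
    by apply: reparam_equiv_catr e2 _; apply: rst_step; exact: path_rev_cst.
  apply: rst_trans (rst_step _ _ _ _ (path_cat_cst_r (erefl (pfinal c2)))).
  by apply: rst_step; apply: path_cat_cst_r; rewrite path_cat_final.
exact: rst_step (path_cat_cst_r (erefl (pfinal c2))).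
Qed.

Lemma reparam_bt c1 c2 : reparam c1 c2 -> bt_equiv c1 c2.
Proof. by move=> r; apply: rst_step; apply: reparam_equiv_backtrack; exact: rst_step. Qed.

Section backtrack_ends.
Variables a d b : pc1path M.
Hypotheses (ad : pfinal a = pinit d) (ab : pfinal a = pinit b).

Lemma cat_rev_composable : pfinal (path_cat a d) = pinit (path_rev d).
Proof. by rewrite path_cat_final// path_rev_init. Qed.

Lemma cat_rev_cat_composable :
  pfinal (path_cat (path_cat a d) (path_rev d)) = pinit b.
Proof. by rewrite path_cat_final ?path_rev_final -?ad// cat_rev_composable. Qed.

End backtrack_ends.

Lemma backtrack_ends c1 c2 : backtrack c1 c2 ->
  (pinit c1, pfinal c1) = (pinit c2, pfinal c2).
Proof.
move=> [a [b [d [ad ab /reparam_equiv_ends[-> ->] /reparam_equiv_ends[-> ->]]]]].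
have c1' := cat_rev_composable ad; have c2' := cat_rev_cat_composable ad ab.
rewrite (path_cat_init c2') (path_cat_init c1') (path_cat_init ad) (path_cat_init ab).
by rewrite (path_cat_final c2') (path_cat_final ab).
Qed.

Lemma bt_ends c1 c2 : bt_equiv c1 c2 -> (pinit c1, pfinal c1) = (pinit c2, pfinal c2).
Proof. exact: (rst_inv backtrack_ends). Qed.

Lemma bt_init c1 c2 : bt_equiv c1 c2 -> pinit c1 = pinit c2.
Proof. by move=> /bt_ends[]. Qed.

Lemma bt_final c1 c2 : bt_equiv c1 c2 -> pfinal c1 = pfinal c2.
Proof. by move=> /bt_ends[]. Qed.

(** A spike in [c1] is a spike in the concatenation, with [c2] absorbed into the tail [b]. *)
Lemma bt_catl c1 c1' c2 : pfinal c1 = pinit c2 ->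
  bt_equiv c1 c1' -> bt_equiv (path_cat c1 c2) (path_cat c1' c2).
Proof.
move=> c12 r1.
apply: (rst_map (f := fun c => path_cat c c2) (v := pfinal) _ _ r1 c12).
  by move=> ? ? /backtrack_ends[].
move=> x y [a [b [d [ad ab rx ry]]]] xz; apply: rst_step.
have bz : pfinal b = pinit c2.
  have [_ <-] : (pinit y, pfinal y) = (pinit a, pfinal b).
    by rewrite (reparam_equiv_ends ry) path_cat_init// path_cat_final.
  have [_ <-//] : (pinit x, pfinal x) = (pinit y, pfinal y).
  by apply: backtrack_ends; exists a, b, d.
have c3 := cat_rev_cat_composable ad ab.
exists a, (path_cat b c2), d; split => //; first by rewrite path_cat_init.
- apply: rst_trans (reparam_equiv_catl xz rx) _.
  by apply: rst_step; exact: path_catA.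
- apply: rst_trans (reparam_equiv_catl _ ry) _; last by apply: rst_step; exact: path_catA.
  by have [_ ->] := reparam_equiv_ends ry; rewrite path_cat_final.
Qed.

(** Here [c1] is absorbed into the head [a], which is nested innermost, so the reassociation has to
    pass [b], [path_rev d] and [d] in turn. *)
Lemma bt_catr c1 c2 c2' : pfinal c1 = pinit c2 ->
  bt_equiv c2 c2' -> bt_equiv (path_cat c1 c2) (path_cat c1 c2').
Proof.
move=> c12 r2.
apply: (rst_map (f := path_cat c1) (v := pinit) _ _ r2 (esym c12)).
  by move=> ? ? /backtrack_ends[].
move=> x y [a [b [d [ad ab rx ry]]]] xz; apply: rst_step.
have ya : pinit y = pinit a.
  by have [-> _] := reparam_equiv_ends ry; rewrite path_cat_init.
have xy : pinit x = pinit y.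
  have [->//] : (pinit x, pfinal x) = (pinit y, pfinal y).
  by apply: backtrack_ends; exists a, b, d.
have ca : pfinal c1 = pinit a by rewrite -ya -xy xz.
have cad : pfinal (path_cat c1 a) = pinit d by rewrite path_cat_final.
have cab : pfinal (path_cat c1 a) = pinit b by rewrite path_cat_final.
have d1 := cat_rev_composable ad; have d2 := cat_rev_composable cad.
have f1 := cat_rev_cat_composable ad ab; have f2 := cat_rev_cat_composable cad cab.
have i1 : pinit (path_cat a d) = pinit a by rewrite path_cat_init.
have i2 : pinit (path_cat (path_cat a d) (path_rev d)) = pinit a by rewrite path_cat_init.
exists (path_cat c1 a), b, d; split => //.
- apply: rst_trans (reparam_equiv_catr (esym xz) rx) _; apply: rst_sym.
  apply: rst_trans (_ : reparam_equiv _
    (path_cat (path_cat c1 (path_cat (path_cat a d) (path_rev d))) b)) _; last first.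
    by apply: rst_step; apply: path_catA => //; rewrite i2.
  apply: reparam_equiv_catl => //.
  apply: rst_trans (_ : reparam_equiv _
    (path_cat (path_cat c1 (path_cat a d)) (path_rev d))) _; last first.
    by apply: rst_step; apply: path_catA => //; rewrite i1.
  by apply: reparam_equiv_catl => //; apply: rst_step; exact: path_catA.
- apply: rst_trans (reparam_equiv_catr _ ry) _; first by rewrite -xy xz.
  by apply/rst_sym/rst_step; exact: path_catA.
Qed.

Lemma bt_cat c1 c1' c2 c2' : pfinal c1 = pinit c2 ->
  bt_equiv c1 c1' -> bt_equiv c2 c2' -> bt_equiv (path_cat c1 c2) (path_cat c1' c2').
Proof.
move=> c12 r1 r2; apply: rst_trans (bt_catl c12 r1) (bt_catr _ r2).
by rewrite -(bt_final r1).
Qed.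

End path_cat_reparam.

(** * Images of paths under smooth maps *)

Section path_map_bt.
Context {R : realType} {E F : normedModType R} {M : smoothSpaceType E}
  {N : smoothSpaceType F} (f : M -> N) (fS : smooth f).
Implicit Types c : pc1path M.

Lemma reparam_map c1 c2 : reparam c1 c2 -> reparam (path_map fS c1) (path_map fS c2).
Proof.
move=> /reparamP[phi [P I F1]]; apply/reparamP; exists phi; split => //.
by move=> t /F1 /= ->.
Qed.

Lemma reparam_equiv_map c1 c2 : reparam_equiv c1 c2 ->
  reparam_equiv (path_map fS c1) (path_map fS c2).
Proof.
move=> r; apply: (rst_map (f := path_map fS) (v := fun=> tt) _ _ r (erefl tt)) => //.
move=> x y /reparam_map H _.
exact: rst_step.
Qed.

Lemma path_map_cat c1 c2 : pfinal c1 = pinit c2 ->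
  reparam (path_map fS (path_cat c1 c2)) (path_cat (path_map fS c1) (path_map fS c2)).
Proof.
move=> c12.
have fc12 : pfinal (path_map fS c1) = pinit (path_map fS c2).
  by rewrite /pfinal /pinit /= [c1 _]c12.
apply: reparam_eq; first by rewrite /= !path_cat_start.
  by rewrite /= !path_cat_stop.
move=> t _ /=; have [t1|/ltW t1] := leP t (pstop c1); first by rewrite !path_catEl.
by rewrite !path_catEr.
Qed.

Lemma path_map_rev c : reparam (path_map fS (path_rev c)) (path_rev (path_map fS c)).
Proof. exact: reparam_eq. Qed.

Lemma bt_map c1 c2 : bt_equiv c1 c2 -> bt_equiv (path_map fS c1) (path_map fS c2).
Proof.
move=> r; apply: (rst_map (f := path_map fS) (v := fun=> tt) _ _ r (erefl tt)) => // {r c1 c2}.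
move=> x y [a [b [d [ad ab rx ry]]]] _; apply: rst_step.
have mapC c1 c2 : pfinal c1 = pinit c2 ->
  pfinal (path_map fS c1) = pinit (path_map fS c2).
  by rewrite /pfinal /pinit /= => ->.
have c1 := cat_rev_composable ad; have c2 := cat_rev_cat_composable ad ab.
exists (path_map fS a), (path_map fS b), (path_map fS d); split; try exact: mapC.
  apply: rst_trans (reparam_equiv_map rx) _.
  apply: rst_trans (rst_step _ _ _ _ (path_map_cat c2)) _.
  apply: reparam_equiv_catl; first exact: mapC.
  apply: rst_trans (rst_step _ _ _ _ (path_map_cat c1)) _.
  apply: rst_trans (reparam_equiv_catl _ (rst_step _ _ _ _ (path_map_cat ad))) _.
    exact: mapC.
  apply: reparam_equiv_catr; last by apply: rst_step; exact: path_map_rev.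
  by rewrite path_cat_final; apply: mapC; rewrite ?path_rev_init.
apply: rst_trans (reparam_equiv_map ry) _.
exact: rst_step (path_map_cat ab).
Qed.

End path_map_bt.

(** * Picard iteration *)

Section ode.
Context {R : realType}.

(** The only use of integration. The fundamental theorem of calculus is applied to the right of the
    base point [a], which is later placed below the interval of interest. *)
Lemma antiderivative_real (f : R -> R) (a : R) : continuous f ->
  exists F : R -> R, forall x, a < x -> is_derive x 1 F (f x).
Proof.
move=> cf.
pose F x := (\int[lebesgue_measure]_(t in `[a, x]) f t)%R.
have : forall x, a < x -> derivable F x 1 /\ derive1 F x = f x.
  move=> x ax; apply: (@continuous_FTC1_closed _ f a x (x + 1)) => //; last exact: cf.
    by rewrite ltrDl.
  apply: continuous_compact_integrable; first exact: segment_compact.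
  exact: continuous_subspaceT.
move: F => F HF; exists F => x /HF[dF <-].
by rewrite derive1E; exact/derivableP.
Qed.

Variable n : nat.
Local Notation E := 'rV[R]_n.

Lemma norm_rVP (v : E) (K : R) : 0 <= K ->
  (forall i, `|v ord0 i| <= K) <-> `|v| <= K.
Proof.
move=> K0; rewrite [`|v|]/Num.Def.normr/= mx_normrE; split => [H|H i].
  by apply: bigmax_le => // -[i j] _; rewrite (ord1 i).
apply: le_trans H.
by have := @le_bigmax _ _ _ 0 (fun i : 'I_1 * 'I_n => `|v i.1 i.2|) (ord0, i).
Qed.

Lemma is_derive_rVP (f : R -> E) (t : R) (v : E) :
  (forall i, is_derive t 1 (fun s => f s ord0 i) (v ord0 i)) <->
  is_derive t 1 f v.
Proof.
split=> [H|[df <-] i].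
  have df : derivable f t 1.
    by apply/derivable_mxP => i j; rewrite (ord1 i); have [] := H j.
  apply: DeriveDef => //; rewrite derive_mx//; apply/matrixP => i j.
  by rewrite mxE (ord1 i); have [] := H j.
have dfi : derivable (fun x => f x ord0 i) t 1 by move/derivable_mxP : df; apply.
by apply: DeriveDef => //; rewrite derive_mx// mxE.
Qed.

Lemma antiderivative (f : R -> E) (a : R) : continuous f ->
  exists F : R -> E, forall x, a < x -> is_derive x 1 F (f x).
Proof.
move=> cf.
have H i : exists F : R -> R, forall x, a < x -> is_derive x 1 F (f x ord0 i).
  apply: antiderivative_real => x.
  exact: (continuous_comp (cf x) (@coord_continuous _ _ _ ord0 i (f x))).
have {}[F HF] := choice H.
exists (fun x => \row_i F i x) => x ax; apply/is_derive_rVP => i.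
rewrite (_ : (fun s => _) = F i); first exact: HF.
by apply/funext => s; rewrite mxE.
Qed.

Lemma is_derive_continuous (W : normedModType R) (f : R -> W) (x : R) (v : W) :
  is_derive x 1 f v -> {for x, continuous f}.
Proof. by case=> df _; exact/differentiable_continuous/derivable1_diffP. Qed.

(** The norm of a row is the maximum of its coordinates, so the real mean value theorem in each
    coordinate gives the bound without loss. *)
Lemma mvt_rV (f df : R -> E) (a b K : R) : a <= b -> 0 <= K ->
  (forall x, x \in `]a, b[ -> is_derive x 1 f (df x)) ->
  {within `[a, b], continuous f} ->
  (forall x, x \in `]a, b[ -> `|df x| <= K) ->
  `|f b - f a| <= K * (b - a).
Proof.
move=> ab K0 Hd cf Hb; have K1 : 0 <= K * (b - a) by rewrite mulr_ge0// subr_ge0.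
apply/norm_rVP => // i.
move: ab; rewrite le_eqVlt => /predU1P[<-|ab]; first by rewrite !mxE !subrr normr0 mulr0.
have := @MVT R (fun s => f s ord0 i) (fun s => df s ord0 i) a b ab.
case.
- by move=> x /Hd /is_derive_rVP.
- move=> x; exact: (continuous_comp (cf x) (@coord_continuous _ _ _ ord0 i (f x))).
move=> c cab E1; rewrite !mxE E1 normrM [`|b - a|]gtr0_norm ?subr_gt0//.
by apply: ler_wpM2r; [rewrite subr_ge0 ltW|by have /(norm_rVP _ K0) := Hb _ cab; apply].
Qed.

Lemma lipschitz_continuous_R (V : normedModType R) (x : R -> V) (K : R) :
  (forall s t, `|x s - x t| <= K * `|s - t|) -> continuous x.
Proof.
move=> xK t; apply/cvgrPdist_lt => e e0; near=> s.
apply: (le_lt_trans (xK t s)).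
have K1 : 0 < `|K| + 1 by rewrite ltr_wpDl.
have : `|t - s| < e / (`|K| + 1).
  near: s; apply: (@nbhsx_ballx _ _ t); exact: divr_gt0.
rewrite ltr_pdivlMr// mulrC; apply: le_lt_trans; apply: ler_wpM2r => //.
by apply: le_trans (ler_norm _) _; rewrite lerDl.
Unshelve. all: by end_near. Qed.

Lemma mvt_itv (f df : R -> E) (a b K s t : R) : 0 <= K ->
  (forall x, x \in `[a, b] -> is_derive x 1 f (df x)) ->
  (forall x, x \in `[a, b] -> `|df x| <= K) ->
  s \in `[a, b] -> t \in `[a, b] -> `|f s - f t| <= K * `|s - t|.
Proof.
move=> K0 Hd Hb.
wlog ts : s t / t <= s.
  move=> H; have [/H//|/ltW st] := leP t s.
  by move=> sJ tJ; rewrite distrC (distrC s); exact: H.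
rewrite !in_itv/= => sJ tJ; rewrite (ger0_norm (_ : 0 <= s - t)) ?subr_ge0//.
have sub x : x \in `]t, s[ -> x \in `[a, b] by rewrite !in_itv/=; lra.
have sub' x : x \in `[t, s] -> x \in `[a, b] by rewrite !in_itv/=; lra.
apply: (mvt_rV ts K0 (fun x xts => Hd x (sub x xts)) _
  (fun x xts => Hb x (sub x xts))).
apply: continuous_in_subspaceT => x; rewrite inE/= => /sub' /Hd.
exact: is_derive_continuous.
Qed.

Lemma clamp_dist (a b s t : R) :
  `|Num.max a (Num.min b s) - Num.max a (Num.min b t)| <= `|s - t|.
Proof.
wlog ts : s t / t <= s.
  by move=> H; have [/H//|/ltW st] := leP t s; rewrite distrC (distrC s); exact: H.
have m1 : Num.min b t <= Num.min b s.
  by rewrite le_min !ge_min lexx ts orbT.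
have m2 : Num.max a (Num.min b t) <= Num.max a (Num.min b s).
  by rewrite ge_max !le_max lexx m1 orbT.
rewrite !ger0_norm ?subr_ge0// lerBlDr ge_max; apply/andP; split.
  by rewrite -[leLHS]add0r lerD ?subr_ge0// le_max lexx.
have : s - t + Num.min b t <= s - t + Num.max a (Num.min b t).
  by rewrite lerD2l le_max lexx orbT.
apply: le_trans; rewrite ge_min -lerBlDl.
have [bt|tb] := leP b t; first by rewrite -subr_ge0; apply/orP; left; lra.
by apply/orP; right; lra.
Qed.

Lemma pow2_small (c e : R) : 0 <= c -> 0 < e -> exists k, c / 2 ^+ k < e.
Proof.
move=> c0 e0; exists (Num.bound (c / e)).
rewrite ltr_pdivrMr ?exprn_gt0// mulrC -ltr_pdivrMr//.
exact: upper_nthrootP.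
Qed.

Lemma closed_norm_le (c : R) : closed [set v : E | `|v| <= c].
Proof.
rewrite (_ : [set v : E | `|v| <= c] = (@Num.norm _ E) @^-1` [set x | x <= c])//.
apply: closed_comp => // x _; exact: norm_continuous.
Qed.

Section picard.
Variables (f : R -> E -> E) (t0 : R) (x0 : E) (d K L : R).
Hypothesis d0 : 0 < d.
Hypothesis K0 : 0 <= K.
Hypothesis L0 : 0 <= L.
Hypothesis f_continuous : forall x : R -> E, continuous x ->
  continuous (fun t => f t (x t)).
Hypothesis f_bound : forall t x, `|f t x| <= K.
Hypothesis f_lipschitz : forall t x y, `|f t x - f t y| <= L * `|x - y|.
Hypothesis Ld : L * d <= 2^-1.

Notation J := `[t0 - d, t0 + d].

(** The retraction to [J] and the primitive vanishing at [t0] are kept abstract, so that the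
    iteration uses these properties only. *)
Variable clamp : R -> R.
Hypothesis clampJ : forall t, clamp t \in J.
Hypothesis clampE : forall t, t \in J -> clamp t = t.
Hypothesis clamp_lip : forall s t, `|clamp s - clamp t| <= `|s - t|.

Variable int : (R -> E) -> R -> E.
Hypothesis int0 : forall g, continuous g -> int g t0 = 0.
Hypothesis int_derive : forall g t, continuous g -> t \in J ->
  is_derive t 1 (int g) (g t).

Let t0J : t0 \in J.
Proof. by have d1 := d0; rewrite in_itv/=; lra. Qed.

(* Comparing with the derivative of [int g1 - int g2] avoids integrals of
   norms. *)
Let int_dist g1 g2 c s t : continuous g1 -> continuous g2 -> 0 <= c ->
  (forall x, x \in J -> `|g1 x - g2 x| <= c) -> s \in J -> t \in J ->
  `|(int g1 s - int g2 s) - (int g1 t - int g2 t)| <= c * `|s - t|.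
Proof.
move=> cg1 cg2 c0 Hc.
move=> sJ tJ; have := @mvt_itv (fun x => int g1 x - int g2 x)
  (fun x => g1 x - g2 x) _ _ c _ _ c0 _ Hc sJ tJ.
by apply=> x xJ; apply: is_deriveB; exact: int_derive.
Qed.

(** Clamping the time makes every iterate [K]-Lipschitz on the whole line, hence continuous,
    although [int] is controlled on [J] alone. *)
Let step (x : R -> E) : R -> E := fun t => x0 + int (fun s => f s (x s)) (clamp t).

Let step_lip x s t : continuous x -> `|step x s - step x t| <= K * `|s - t|.
Proof.
move=> cx; rewrite /step opprD addrACA subrr add0r.
have cg := f_continuous cx; set g := fun _ => _ in cg *.
apply: le_trans (_ : K * `|clamp s - clamp t| <= _); last exact: ler_wpM2l.
have gK x1 : x1 \in J -> `|g x1| <= K by move=> _; exact: f_bound.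
have D x1 : x1 \in J -> is_derive x1 1 (int g) (g x1) by exact: int_derive.
exact: (@mvt_itv (int g) g _ _ K _ _ K0 D gK (clampJ s) (clampJ t)).
Qed.

(** Contraction by 1/2: both primitives vanish at [t0], the clamped time is within [d] of it, and L
    * d <= 1/2. *)
Let step_dist x y c : continuous x -> continuous y -> 0 <= c ->
  (forall t, `|x t - y t| <= c) -> forall t, `|step x t - step y t| <= c / 2.
Proof.
move=> cx cy c0 xy t; rewrite /step opprD addrACA subrr add0r.
have cg := f_continuous cx; have cg' := f_continuous cy.
have gg s : s \in J -> `|f s (x s) - f s (y s)| <= L * c.
  by move=> _; exact: le_trans (f_lipschitz _ _ _) (ler_wpM2l L0 (xy s)).
have := int_dist cg cg' (mulr_ge0 L0 c0) gg (clampJ t) t0J.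
rewrite (int0 cg) (int0 cg') subrr subr0 => H; apply: (le_trans H).
have cd : `|clamp t - t0| <= d.
  by have := clampJ t; rewrite in_itv/= ler_norml; lra.
apply: le_trans (ler_wpM2l (mulr_ge0 L0 c0) cd) _.
by rewrite mulrAC mulrC; exact: ler_wpM2l.
Qed.

Let X k : R -> E := iter k step (cst x0).

Let X_lip k s t : `|X k s - X k t| <= K * `|s - t|.
Proof.
elim: k s t => [|k IH] s t; first by rewrite /X/= subrr normr0 mulr_ge0.
by apply: step_lip; exact: lipschitz_continuous_R.
Qed.

Let X_continuous k : continuous (X k).
Proof. exact: lipschitz_continuous_R (X_lip k). Qed.

Let step_t0 x : continuous x -> step x t0 = x0.
Proof.
by move=> cx; rewrite /step (clampE t0J) (int0 (f_continuous cx)) addr0.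
Qed.

Let X_step k t : `|X k.+1 t - X k t| <= K * d / 2 ^+ k.
Proof.
elim: k t => [|k IH] t.
  rewrite expr0 divr1.
  (* The constant iterate equals the value of [X 1] at [t0], so the first increment is bounded
     through the Lipschitz constant of [X 1]. *)
  have -> : X 0 t = X 1 t0 by rewrite /X/= step_t0//; exact: cst_continuous.
  have -> : X 1 t = X 1 (clamp t).
    by rewrite /X/= /step; congr (_ + int _ _); rewrite [RHS]clampE.
  apply: le_trans (X_lip _ _ _) _; apply: ler_wpM2l => //.
  by have := clampJ t; rewrite in_itv/= ler_norml; lra.
have -> : K * d / 2 ^+ k.+1 = (K * d / 2 ^+ k) / 2.
  by rewrite exprS invfM mulrA mulrAC.
have Kd : 0 <= K * d / 2 ^+ k by rewrite divr_ge0 ?exprn_ge0// mulr_ge0// ltW.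
exact: (step_dist (@X_continuous k.+1) (@X_continuous k) Kd IH).
Qed.

Let X_dist k m t : `|X (k + m) t - X k t| <= 2 * (K * d) / 2 ^+ k.
Proof.
have Kd : 0 <= K * d by rewrite mulr_ge0// ltW.
have p0 j : 0 <= K * d / 2 ^+ j by rewrite divr_ge0// exprn_ge0.
(* The geometric sum with its remainder kept; without the remainder the induction on [m] would not
   close. *)
suff : `|X (k + m) t - X k t| <= 2 * (K * d / 2 ^+ k) - 2 * (K * d / 2 ^+ (k + m)).
  by have := p0 (k + m)%N; rewrite -[2 * _ / _]mulrA; lra.
elim: m => [|m IH]; first by rewrite addn0 !subrr normr0.
rewrite addnS; have := X_step (k + m) t.
have E1 : K * d / 2 ^+ (k + m) = 2 * (K * d / 2 ^+ (k + m).+1).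
  by rewrite exprS invfM [RHS]mulrCA mulVKf.
move=> H; rewrite -[_ - X k t](subrKA (X (k + m) t)); apply: le_trans (ler_normD _ _) _.
apply: le_trans (lerD H IH) _.
rewrite E1; lra.
Qed.

Let X_cvg t : exists l : E, X k t @[k --> \oo] --> l.
Proof.
have Kd : 0 <= 2 * (K * d) by rewrite !mulr_ge0// ltW.
suff /cauchy_cvg/cvg_ex[l Hl] : cauchy (X k t @[k --> \oo]) by exists l.
apply: cauchy_exP => e e0.
have [k ke] := pow2_small Kd e0.
exists (X k t); exists k => // m /= km.
rewrite -ball_normE/= distrC -(subnKC km).
exact: le_lt_trans (X_dist _ _ _) ke.
Qed.

Let sol t : E := projT1 (cid (X_cvg t)).

Let sol_dist k t : `|sol t - X k t| <= 2 * (K * d) / 2 ^+ k.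
Proof.
rewrite /sol; case: cid => l /= Hl.
have cl : (X m t - X k t) @[m --> \oo] --> l - X k t.
  by apply: cvgB => //; exact: cvg_cst.
apply: (closed_cvg (fun v => `|v| <= 2 * (K * d) / 2 ^+ k) _ _ _ cl).
  exact: closed_norm_le.
by exists k => // m /= km; rewrite -(subnKC km); exact: X_dist.
Qed.

Let dist_small (v : E) : (forall k, `|v| <= 4 * (K * d) / 2 ^+ k) -> v = 0.
Proof.
move=> Hv; apply/eqP/negPn/negP => v0.
have Kd : 0 <= 4 * (K * d) by rewrite !mulr_ge0// ltW.
have v1 : 0 < `|v| by rewrite normr_gt0.
have [k ke] := pow2_small Kd v1.
by have := Hv k; rewrite leNgt ke.
Qed.

Let sol_lip s t : `|sol s - sol t| <= K * `|s - t|.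
Proof.
apply/ler_addgt0Pr => e e0.
have Kd : 0 <= 2 * (2 * (K * d)) by rewrite !mulr_ge0// ltW.
have [k ke] := pow2_small Kd e0.
have -> : sol s - sol t = (X k s - X k t) + ((sol s - X k s) - (sol t - X k t)).
  by rewrite opprB addrACA subrKC addKr.
have Hs := sol_dist k s; have Ht := sol_dist k t.
apply: le_trans (ler_normD _ _) _; apply: lerD (X_lip k s t) _.
apply: le_trans (ler_normB _ _) _.
by rewrite -mulrA in ke; lra.
Qed.

Let sol_continuous : continuous sol.
Proof. exact: lipschitz_continuous_R sol_lip. Qed.

(** Passing through [X k.+1 = step (X k)] bounds the defect by two errors, one from the convergence
    to [sol] and one from the contraction, both of order 2^-k. *)
Let sol_step t : sol t = step sol t.
Proof.
apply/eqP; rewrite -subr_eq0; apply/eqP; apply: dist_small => k.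
have Kd : 0 <= 2 * (K * d) / 2 ^+ k.
  by rewrite divr_ge0 ?exprn_ge0// !mulr_ge0// ltW.
have H1 := sol_dist k.+1 t.
have H2 : `|step (X k) t - step sol t| <= 2 * (K * d) / 2 ^+ k / 2.
  apply: (step_dist (@X_continuous k) sol_continuous Kd) => s.
  by rewrite distrC; exact: sol_dist.
rewrite -[_ - step _ _](subrKA (X k.+1 t)).
apply: le_trans (ler_normD _ _) _.
have E1 : 2 * (K * d) / 2 ^+ k.+1 = 2 * (K * d) / 2 ^+ k / 2.
  by rewrite exprS invfM [LHS]mulrA [LHS]mulrAC.
have E2 : 4 * (K * d) / 2 ^+ k = 2 * (2 * (K * d) / 2 ^+ k).
  by rewrite !mulrA; congr (_ * _ * _ / _); lra.
rewrite E1 in H1; rewrite E2.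
change (step (X k) t) with (X k.+1 t) in H2.
lra.
Qed.

Lemma picard_aux : exists x : R -> E, [/\ x t0 = x0,
  forall s t, `|x s - x t| <= K * `|s - t| &
  forall t, t \in `]t0 - d, t0 + d[ -> is_derive t 1 x (f t (x t))].
Proof.
exists sol; split => //; first by rewrite sol_step step_t0.
move=> t tJ'.
have tJ : t \in J by move: tJ'; rewrite !in_itv/=; lra.
have D : is_derive t 1 (fun t => x0 + int (fun s => f s (sol s)) t) (f t (sol t)).
  rewrite -[f t (sol t)]add0r; apply: is_deriveD; apply: int_derive => //.
  exact: f_continuous.
(* Near an interior point the clamp is the identity, so the fixed point equation holds there in its
   unclamped form; at the ends of [J] this would fail. *)
apply: near_eq_is_derive D; near=> s.
have sJ : s \in `]t0 - d, t0 + d[ by near: s; exact: near_in_itvoo.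
rewrite [RHS]sol_step /step clampE//.
by move: sJ; rewrite !in_itv/=; lra.
Unshelve. all: by end_near. Qed.
End picard.

(** The bounds are global in [x], so the iterates need not be kept inside a ball; [local_ode]
    arranges this by clamping. Continuity is asked only along continuous curves, which is all that
    the integrand requires. *)
Lemma picard (f : R -> E -> E) (t0 : R) (x0 : E) (d K L : R) :
  0 < d -> 0 <= K -> 0 <= L -> L * d <= 2^-1 ->
  (forall x : R -> E, continuous x -> continuous (fun t => f t (x t))) ->
  (forall t x, `|f t x| <= K) ->
  (forall t x y, `|f t x - f t y| <= L * `|x - y|) ->
  exists x : R -> E, [/\ x t0 = x0,
    forall s t, `|x s - x t| <= K * `|s - t| &
    forall t, t \in `]t0 - d, t0 + d[ -> is_derive t 1 x (f t (x t))].
Proof.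
move=> d0 K0 L0 Ld fc fK fL.
have prim (g : R -> E) : exists I : R -> E, continuous g ->
    I t0 = 0 /\ forall t, t \in `[t0 - d, t0 + d] -> is_derive t 1 I (g t).
  have [cg|] := pselect (continuous g); last by exists 0.
  (* Any base point below [t0 - d] will do: the derivative is then known on the closed interval,
     ends included. *)
  have [F HF] := antiderivative (t0 - d - 1) cg.
  exists (fun t => F t - F t0) => _; split; first by rewrite subrr.
  move=> t; rewrite in_itv/= => tJ.
  have -> : g t = g t - 0 by rewrite subr0.
  by apply: is_deriveB; apply: HF; lra.
have [int intP] := choice prim.
apply: (@picard_aux f t0 x0 d K L d0 K0 L0 fc fK fL Ld
  (fun t => Num.max (t0 - d) (Num.min (t0 + d) t)) _ _ _ int).
- by move=> t; rewrite in_itv/= le_max lexx/= ge_max ge_min lexx /= andbT; lra.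
- move=> t; rewrite in_itv/= => /andP[t1 t2].
  by rewrite (min_idPr t2) (max_idPr t1).
- by move=> s t; exact: clamp_dist.
- by move=> g /intP[].
- by move=> g t /intP[_]; apply.
Qed.

End ode.

(** * Local existence for equations with a continuous parameter *)

Section local_ode.
Context {R : realType}.
Variable n : nat.
Local Notation E := 'rV[R]_n.

(** Rescaling [v] to norm r / 2, strictly inside the ball, gives the constant 2 / r. *)
Lemma linear_bound (V : normedModType R) (f : {linear V -> E}) (r : R) :
  0 < r -> (forall v, `|v| < r -> `|f v| < 1) -> forall v, `|f v| <= 2 / r * `|v|.
Proof.
move=> r0 H v; have [->|v0] := eqVneq v 0; first by rewrite linear0 !normr0 mulr0.
have nv : 0 < `|v| by rewrite normr_gt0.
have c0 : 0 < r / 2 / `|v| by rewrite !divr_gt0.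
set c := r / 2 / `|v| in c0.
have cv : `|c *: v| < r.
  by rewrite normrZ gtr0_norm// /c divfK ?gt_eqF// ltr_pdivrMr//; lra.
have := H _ cv; rewrite linearZ/= normrZ gtr0_norm// => /ltW fv.
have -> : 2 / r * `|v| = c^-1 by rewrite /c !invfM !invrK [2 / r]mulrC.
by rewrite -[leRHS]mulr1 ler_pdivlMl.
Qed.

Lemma is_derive_line (V : normedModType R) (a w : V) (s : R) :
  is_derive s (1 : R) (fun t : R => a + t *: w) w.
Proof.
have H : h^-1 *: (((fun t : R => a + t *: w) \o shift s) (h *: (1 : R)) -
    (a + s *: w)) @[h --> 0^'] --> w.
  apply: cvg_near_cst; near=> h.
  have h0 : h != 0 by near: h; exact: nbhs_dnbhs_neq.
  rewrite /= opprD addrACA subrr add0r -scalerBl addrK scalerA.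
  by rewrite mulrA mulVf// mul1r scale1r.
apply: DeriveDef; first by apply/cvg_ex; exists w.
exact/cvg_lim.
Unshelve. all: by end_near. Qed.

(** Continuity of the tangent map at (z0, 0) bounds the operator norms of the differentials
    uniformly near [z0]; the mean value inequality along segments of the ball then gives the
    Lipschitz constant. *)
Lemma Ck1_local_lipschitz (V : normedModType R) (F : V -> E) (U : set V) (z0 : V) :
  open U -> Ck 1 U F -> U z0 ->
  exists r L, [/\ 0 < r, 0 <= L, (forall z, `|z - z0| < r -> U z) &
    forall z z', `|z - z0| < r -> `|z' - z0| < r -> `|F z - F z'| <= L * `|z - z'|].
Proof.
move=> oU [dF cF] Uz0.
have H1 : nbhs (z0, 0 : V) [set zv | `|'d F (zv.1) (zv.2)| < 1].
  have := cF (z0, 0) (conj Uz0 I); rewrite /prop_for /continuous_at /= linear0.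
  by move=> /cvgr0_norm_lt; apply.
have H2 : nbhs (z0, 0 : V) [set zv | U zv.1].
  by apply: (@cvg_fst _ _ (nbhs z0) (nbhs (0 : V))); exact: open_nbhs_nbhs.
have H3 : nbhs (z0, 0 : V) ([set zv | U zv.1] `&` [set zv | `|'d F (zv.1) (zv.2)| < 1]).
  exact: filterI.
move/nbhs_ballP : H3 => [r /= r0 H].
have {}H z v : `|z - z0| < r -> `|v| < r -> U z /\ `|'d F z v| < 1.
  move=> zr vr; have := H (z, v); rewrite /ball/= /prod_ball/= => /(_ _)[].
    split; first by rewrite -ball_normE/= distrC.
    by rewrite -ball_normE/= sub0r normrN.
  by move=> /=.
have UB z : `|z - z0| < r -> U z by move=> zr; have [] := H z 0 zr; rewrite ?normr0.
exists r, (2 / r); split => //; first by rewrite divr_ge0// ltW.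
move=> z z' zr zr'.
pose g (s : R) : V := z' + s *: (z - z').
have gB s : 0 <= s <= 1 -> `|g s - z0| < r.
  move=> /andP[s0 s1]; have -> : g s - z0 = (1 - s) *: (z' - z0) + s *: (z - z0).
    rewrite /g scalerBl scale1r -[RHS]addrA [- _ + _]addrC -scalerBr opprB subrKA.
    by rewrite addrAC.
  (* The strict bound is drawn from the term with weight [s], so the weight must be positive. *)
  have [/eqP s0'|s0'] := boolP (s == 0).
    by rewrite s0' subr0 scale1r scale0r addr0.
  apply: le_lt_trans (ler_normD _ _) _; rewrite !normrZ.
  rewrite [`|s|]ger0_norm// [`|1 - s|]ger0_norm ?subr_ge0//.
  have sp : 0 < s by rewrite lt_neqAle eq_sym s0'.
  have h1 : (1 - s) * `|z' - z0| <= (1 - s) * r by rewrite ler_wpM2l ?subr_ge0// ltW.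
  have h2 : s * `|z - z0| < s * r by rewrite ltr_pM2l.
  by lra.
have dg (s : R) : is_derive s (1 : R) g (z - z') := is_derive_line _ _ _.
have D (s : R) : 0 <= s <= 1 -> is_derive s (1 : R) (F \o g) ('d F (g s) (z - z')).
  move=> s01; have dFg := dF _ (UB _ (gB _ s01)).
  have dgs : differentiable g s by apply/derivable1_diffP; have [] := dg s.
  have dc : differentiable (F \o g) s by exact: differentiable_comp.
  apply: DeriveDef; first exact/derivable1_diffP.
  rewrite -derive1E derive1E'// diff_comp//=; congr ('d F _ _).
  by rewrite -derive1E'// derive1E; have [_ ->] := dg s.
have := @mvt_rV R n (F \o g) (fun s => 'd F (g s) (z - z')) 0 1 (2 / r * `|z - z'|).
rewrite /g /= scale1r scale0r addr0 subrKC subr0 mulr1; apply => //.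
- by rewrite mulr_ge0// divr_ge0// ltW.
- by move=> s; rewrite in_itv/= => /andP[? ?]; apply: D; rewrite !ltW.
- apply: continuous_in_subspaceT => s; rewrite inE/= in_itv/= => /D.
  exact: is_derive_continuous.
- move=> s; rewrite in_itv/= => /andP[s0 s1]; apply: linear_bound => // v vr.
  by have [] := H (g s) v (gB s _) vr; rewrite ?ltW.
Qed.

Lemma clamp_near (a r t : R) : 0 <= r ->
  `|Num.max (a - r) (Num.min (a + r) t) - a| <= r.
Proof.
move=> r0; rewrite ler_norml; apply/andP; split.
  by rewrite lerBrDl le_max lexx.
by rewrite lerBlDl ge_max ge_min lexx/= andbT; lra.
Qed.

(* Precomposition with it turns a map defined on a ball into a global one. *)
Definition clamp_rV (x0 : E) (r : R) (x : E) : E :=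
  \row_i Num.max (x0 ord0 i - r) (Num.min (x0 ord0 i + r) (x ord0 i)).

Lemma clamp_rV_dist x0 r x y : `|clamp_rV x0 r x - clamp_rV x0 r y| <= `|x - y|.
Proof.
apply/norm_rVP => // i; rewrite !mxE; apply: le_trans (clamp_dist _ _ _ _) _.
by have /(norm_rVP _ (normr_ge0 (x - y)))/(_ i) := lexx `|x - y|; rewrite !mxE.
Qed.

Lemma nonexpansive_continuous (V W : normedModType R) (f : V -> W) :
  (forall x y, `|f x - f y| <= `|x - y|) -> continuous f.
Proof.
move=> Hf x; apply/cvgrPdist_lt => e e0; near=> y.
apply: le_lt_trans (Hf _ _) _; suff : ball x e y by rewrite -ball_normE.
by near: y; exact: nbhsx_ballx.
Unshelve. all: by end_near. Qed.

Lemma clamp_rV_continuous x0 r : continuous (clamp_rV x0 r).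
Proof. by apply: nonexpansive_continuous => x y; exact: clamp_rV_dist. Qed.

Lemma clamp_rV_ball x0 r x : 0 <= r -> `|clamp_rV x0 r x - x0| <= r.
Proof.
by move=> r0; apply/norm_rVP => // i; rewrite !mxE; exact: clamp_near.
Qed.

Lemma clamp_rV_id x0 r x : `|x - x0| <= r -> clamp_rV x0 r x = x.
Proof.
move=> xr; have r0 : 0 <= r by exact: le_trans xr.
have {}xr i : `|x ord0 i - x0 ord0 i| <= r.
  by have /(norm_rVP _ r0)/(_ i) := xr; rewrite !mxE.
apply/rowP => i; rewrite !mxE; have := xr i; rewrite ler_norml => /andP[h1 h2].
by rewrite (min_idPr _) ?(max_idPr _)//; lra.
Qed.

(** Time enters through the merely continuous curve [a], so the right-hand side is C^1 in [x] but
    only continuous in [t]. Clamping [x] and [t] produces the global bounds required by [picard],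
    and the solution stays where both clamps are the identity. *)
Lemma local_ode (V : normedModType R) (F : E * V -> E) (U : set (E * V)%type)
    (a : R -> V) (N : set R) (t0 : R) (x0 : E) :
  open U -> Ck 1 U F -> open N -> N t0 -> (forall t, N t -> {for t, continuous a}) ->
  U (x0, a t0) ->
  exists d (x : R -> E), [/\ 0 < d, x t0 = x0 &
    forall t, t \in `]t0 - d, t0 + d[ ->
      [/\ N t, U (x t, a t) & is_derive t 1 x (F (x t, a t))]].
Proof.
move=> oU CF oN Nt0 ca Ux0.
have [r [L [r0 L0 rU FL]]] := Ck1_local_lipschitz oU CF Ux0.
have prodB (y : E) (v : V) : `|y - x0| < r -> `|v - a t0| < r ->
  `|((y, v) - (x0, a t0) : ((E * V)%type : normedModType R))| < r.
  by rewrite prod_normE/= gt_max => -> ->.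
have H : \forall t \near t0, N t /\ `|a t - a t0| < r.
  apply: filterI; first exact: open_nbhs_nbhs.
  have : a t @[t --> t0] --> a t0 by exact: ca.
  by move=> /cvgr_distC_lt; apply.
have [d1 /= d10 {}H] := H.
have Ha t : `|t - t0| < d1 -> N t /\ `|a t - a t0| < r.
  by move=> td; apply: H; rewrite /= distrC.
pose K := `|F (x0, a t0)| + L * r.
have K0 : 0 <= K by rewrite addr_ge0// mulr_ge0// ltW.
(* The three bounds keep the time where [a] is controlled, make the iteration contract by 1/2, and
   keep a [K]-Lipschitz solution within r / 2 of [x0]. Adding 1 avoids division by zero. *)
pose d := Num.min (d1 / 2) (Num.min (2 * L + 1)^-1 (r / 2 / (K + 1))).
have L1 : 0 < 2 * L + 1 by lra.
have K1 : 0 < K + 1 by lra.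
have d0 : 0 < d.
  by rewrite !lt_min invr_gt0 L1 !divr_gt0.
have dd1 : d <= d1 / 2 by rewrite ge_min lexx.
have dL : d <= (2 * L + 1)^-1 by rewrite !ge_min lexx orbT.
have dK : d <= r / 2 / (K + 1) by rewrite !ge_min lexx !orbT.
pose ct t := Num.max (t0 - d) (Num.min (t0 + d) t).
have ctJ t : `|ct t - t0| < d1.
  by have := clamp_near t0 t (ltW d0); rewrite -/(ct t); lra.
have ct_cont : continuous ct.
  by apply: (@lipschitz_continuous_R _ _ _ 1) => s t; rewrite mul1r; exact: clamp_dist.
pose f t x := F (clamp_rV x0 (r / 2) x, a (ct t)).
have zB t x :
    `|((clamp_rV x0 (r / 2) x, a (ct t)) - (x0, a t0) : ((E * V)%type : normedModType R))| < r.
  apply: prodB; last by case: (Ha _ (ctJ t)).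
  have r2 : 0 <= r / 2 by lra.
  by apply: le_lt_trans (clamp_rV_ball x0 x r2) _; lra.
have z0B : `|((x0, a t0) - (x0, a t0) : ((E * V)%type : normedModType R))| < r.
  by rewrite subrr normr0.
have := @picard R n f t0 x0 d K L d0 K0 L0.
case.
- have : L * d <= L * (2 * L + 1)^-1 by rewrite ler_wpM2l.
  move=> /le_trans; apply; rewrite ler_pdivrMr//; lra.
- move=> x cx t.
  have cF : {for (clamp_rV x0 (r / 2) (x t), a (ct t)), continuous F}.
    by have [dF _] := CF; apply/differentiable_continuous/dF/rU/zB.
  have c1 : {for t, continuous (fun t => clamp_rV x0 (r / 2) (x t))}.
    apply: (continuous_comp (cx t)); exact: clamp_rV_continuous.
  have c2 : {for t, continuous (fun t => a (ct t))}.
    by apply: (continuous_comp (ct_cont t)); apply: ca; case: (Ha _ (ctJ t)).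
  have c12 : {for t, continuous (fun t => (clamp_rV x0 (r / 2) (x t), a (ct t)))}.
    exact: (cvg_pair c1 c2).
  exact: (continuous_comp c12 cF).
- move=> t x; rewrite -[f t x](subrK (F (x0, a t0))).
  apply: le_trans (ler_normD _ _) _; rewrite /K [leLHS]addrC lerD2l.
  by apply: le_trans (FL _ _ (zB _ _) z0B) _; rewrite ler_wpM2l// ltW.
- move=> t x y; apply: le_trans (FL _ _ (zB _ _) (zB _ _)) _.
  rewrite ler_wpM2l// prod_normE/= subrr normr0 ge_max normr_ge0 andbT.
  exact: clamp_rV_dist.
move=> x [xt0 xK xD]; exists d, x; split => // t tJ.
have tJ' : `|t - t0| < d by move: tJ; rewrite in_itv/= ltr_norml; lra.
have ctE : ct t = t.
  move: tJ; rewrite in_itv/= => /andP[t1 t2].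
  by rewrite /ct (min_idPr (ltW t2)) (max_idPr (ltW t1)).
have xtr : `|x t - x0| <= r / 2.
  rewrite -xt0; apply: le_trans (xK _ _) _.
  apply: le_trans (ler_wpM2l K0 (ltW tJ')) _; apply: le_trans (ler_wpM2l K0 dK) _.
  by rewrite mulrCA ger_pMr ?ler_pdivrMr//; lra.
have := xD t tJ; rewrite /f ctE clamp_rV_id// => Dx; split => //.
- by have [] := Ha t (lt_le_trans tJ' (le_trans dd1 _)) => //; lra.
- by apply: rU; have := zB t (x t); rewrite ctE clamp_rV_id.
Qed.

End local_ode.

(** * Tangent maps and velocities *)

Section difference_quotient.
Context {R : realType}.

(** The filter is a parameter so that one-sided and two-sided derivatives share one chain rule. *)
Definition dquot (E : normedModType R) (q : R -> E) (F : set_system R) (t : R) (v : E) :=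
  (s - t)^-1 *: (q s - q t) @[s --> F] --> v.

(** The quotient of f o q splits into the differential applied to the quotient of [q] and a
    remainder; the latter vanishes because the quotient of [q] is eventually bounded by |v| + 1. *)
Lemma dquot_comp (E F : normedModType R) (q : R -> E) (f : E -> F) (G : set_system R)
    (t : R) (v : E) : Filter G -> q s @[s --> G] --> q t ->
  differentiable f (q t) -> dquot q G t v -> dquot (f \o q) G t ('d f (q t) v).
Proof.
move=> FG cq df cv.
have Dq : 'd f (q t) ((s - t)^-1 *: (q s - q t)) @[s --> G] --> 'd f (q t) v.
  by apply: (cvg_comp _ _ cv); exact: diff_continuous.
rewrite /dquot -[X in _ --> X]addr0.
have E1 : (fun s => (s - t)^-1 *: ((f \o q) s - (f \o q) t)) =
    (fun s => 'd f (q t) ((s - t)^-1 *: (q s - q t)) +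
      (s - t)^-1 *: (f (q s) - f (q t) - 'd f (q t) (q s - q t))).
  by apply/funext => s /=; rewrite linearZ/= -scalerDr subrKC.
rewrite E1; apply: cvgD => //; apply/cvgr0Pnorm_le => e e0.
have v1 : 0 < `|v| + 1 by rewrite ltr_wpDl.
have /eqaddoP/(_ _ (divr_gt0 e0 v1)) Ho := diff_locally df.
have hs : (q s - q t) @[s --> G] --> (0 : E).
  by rewrite -(subrr (q t)); apply: cvgB => //; exact: cvg_cst.
have nq : \forall s \near G, `|(s - t)^-1 *: (q s - q t)| <= `|v| + 1.
  by apply: (cvgr_norm_le _ cv); rewrite ltrDl.
have {}Ho := hs _ Ho.
apply: filterS2 nq Ho => s qs /=; rewrite !fctE /= subrK opprD addrA => Ho.
rewrite normrZ; apply: le_trans (ler_wpM2l (normr_ge0 _) Ho) _.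
by rewrite mulrCA -normrZ mulrAC ler_pdivrMr// ler_pM2l.
Qed.

Lemma dquot_near (E : normedModType R) (q q' : R -> E) (F : set_system R) t v :
  Filter F -> q t = q' t -> (\forall s \near F, q s = q' s) ->
  dquot q F t v -> dquot q' F t v.
Proof.
move=> FF qt qq'; apply: cvg_trans; apply: near_eq_cvg.
by apply: filterS qq' => s ->; rewrite qt.
Qed.

Lemma dquot_is_derive (E : normedModType R) (q : R -> E) t v :
  dquot q t^' t v -> is_derive t (1 : R) q v.
Proof.
move=> H.
have K : h^-1 *: ((q \o shift t) (h *: (1 : R)) - q t) @[h --> 0^'] --> v.
  move=> W /H /nbhs_ballP[d /= d0 Hd]; apply/nbhs_ballP; exists d => //= h hd h0.
  have := Hd (h + t); rewrite addrK /= [h *: 1]mulr1; apply.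
    by move: hd; rewrite -!ball_normE/= sub0r opprD addrCA subrr addr0 normrN.
  by rewrite -subr_eq0 addrK.
by apply: DeriveDef; [apply/cvg_ex; exists v|exact/cvg_lim].
Qed.

End difference_quotient.

Section mdiff.
Context {R : realType}.

(** Differentiability at one point, which serves smooth maps, local trivializations and C^1 curves
    alike. Continuity is a separate clause because the chart expression carries no information where
    [f] leaves the domain of the chart at [f p]. *)
Definition mdiff (E F : normedModType R) (M : smoothSpaceType E) (N : smoothSpaceType F)
    (f : M -> N) (p : M) : Prop :=
  {for p, continuous f} /\
  differentiable (chart_at (f p) \o f \o cinv (chart_at p)) (chart_at p p).

Lemma Ckmap_mdiff (E F : normedModType R) (M : smoothSpaceType E)
    (N : smoothSpaceType F) (U : set M) (f : M -> N) (p : M) :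
  Ckmap 1 U f -> U p -> mdiff f p.
Proof.
move=> [cf kf] Up; split; first exact: cf.
have [+ _] := kf _ _ (chart_at_atlas p) (chart_at_atlas (f p)); apply.
have pp := mem_chart_at p; split; first exact: cmap_cod.
by rewrite /= !cmapK//; split => //; exact: mem_chart_at.
Qed.

Lemma smooth_mdiff (E F : normedModType R) (M : smoothSpaceType E)
    (N : smoothSpaceType F) (f : M -> N) (p : M) : smooth f -> mdiff f p.
Proof. by move=> fS; exact: Ckmap_mdiff (fS 1%N) _. Qed.

Lemma near_chart (E : normedModType R) (M : smoothSpaceType E) (phi : chart E M)
    (p : M) (W : set M) : cdom phi p -> nbhs p W ->
  \forall x \near phi p, ccod phi x /\ W (cinv phi x).
Proof.
move=> phip Wp; apply: filterI.
  by apply: open_nbhs_nbhs; split; [exact: ccod_open|exact: cmap_cod].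
by apply: (cinv_continuous (cmap_cod phip)); rewrite /= cmapK.
Qed.

Lemma nbhs_cdom (E : normedModType R) (M : smoothSpaceType E) (phi : chart E M)
    (p : M) : cdom phi p -> nbhs p (cdom phi).
Proof. by move=> ?; apply: open_nbhs_nbhs; split => //; exact: cdom_open. Qed.

Lemma tmap_near (E F : normedModType R) (M : smoothSpaceType E) (N : smoothSpaceType F)
    (f g : M -> N) p : {near p, f =1 g} -> mdiff f p ->
  mdiff g p /\ (tmap f p : E -> F) = tmap g p.
Proof.
move=> fg [cf df]; have pp := mem_chart_at p.
have fgp : f p = g p by exact: nbhs_singleton fg.
have near1 := near_chart pp fg.
have near2 : {near chart_at p p, chart_at (f p) \o f \o cinv (chart_at p) =1
    chart_at (f p) \o g \o cinv (chart_at p)}.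
  by apply: filterS near1 => x [_ /= ->].
have [dg E1] := near_eq_diff near2 df; split.
  split; last by rewrite -fgp.
  suff : g y @[y --> p] --> g p by [].
  by rewrite -fgp; apply: cvg_trans cf; apply: near_eq_cvg.
by rewrite /tmap -E1 -fgp.
Qed.

Lemma tmap_comp (E F G : normedModType R) (M : smoothSpaceType E)
    (N : smoothSpaceType F) (L : smoothSpaceType G) (f : M -> N) (g : N -> L) p :
  mdiff f p -> mdiff g (f p) ->
  mdiff (g \o f) p /\
  forall v, (tmap (g \o f) p : E -> G) v = tmap g (f p) (tmap f p v).
Proof.
move=> [cf df] [cg dg].
have pp := mem_chart_at p; have fp := mem_chart_at (f p).
pose f' := chart_at (f p) \o f \o cinv (chart_at p).
pose g' := chart_at (g (f p)) \o g \o cinv (chart_at (f p)).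
have Ef : f' (chart_at p p) = chart_at (f p) (f p) by rewrite /f' /= cmapK.
have dg' : differentiable g' (f' (chart_at p p)) by rewrite Ef.
have near1 : {near chart_at p p, g' \o f' =1
    chart_at (g (f p)) \o (g \o f) \o cinv (chart_at p)}.
  have : nbhs p (f @^-1` cdom (chart_at (f p))) by apply: cf; exact: nbhs_cdom.
  move=> /(near_chart pp); apply: filterS => x [_ fx].
  by rewrite /g' /f' /= cmapK.
have [dgf E1] := near_eq_diff near1 (differentiable_comp df dg').
split; first by split => //; exact: continuous_comp cf cg.
by move=> v; rewrite /tmap E1 diff_comp//= Ef.
Qed.

Lemma mdiff_id (E : normedModType R) (M : smoothSpaceType E) (p : M) :
  mdiff (@id M) p /\ forall v, (tmap (@id M) p : E -> E) v = v.
Proof.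
have pp := mem_chart_at p.
have near1 : {near chart_at p p, id =1 chart_at p \o id \o cinv (chart_at p)}.
  by apply: filterS (near_chart pp (nbhs_cdom pp)) => x [cx _] /=; rewrite cinvK.
have Did := is_diff_id (chart_at p p).
have [d1 E1] := near_eq_diff near1 (@ex_diff _ _ _ _ _ _ _ Did).
split; first by split => //; exact: cvg_id.
by move=> v; rewrite /tmap E1 (@diff_val _ _ _ _ _ _ _ Did).
Qed.

Lemma mdiff_cst (E F : normedModType R) (M : smoothSpaceType E)
    (N : smoothSpaceType F) (a : N) (p : M) :
  mdiff (fun _ : M => a) p /\ forall v, (tmap (fun _ : M => a) p : E -> F) v = 0.
Proof.
have -> : (fun _ : M => a) = cst a by [].
have E1 : chart_at a \o cst a \o cinv (chart_at p) = cst (chart_at a a) :> (E -> F) by [].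
split; last by move=> v; rewrite /tmap E1 diff_cst.
by split; [exact: cvg_cst|rewrite E1; exact: differentiable_cst].
Qed.

Lemma mdiff_pair (E F G : normedModType R) (M : smoothSpaceType E)
    (N : smoothSpaceType F) (L : smoothSpaceType G) (f : L -> M) (g : L -> N) p :
  mdiff f p -> mdiff g p ->
  mdiff (fun x => (f x, g x)) p /\
  forall v, (tmap (fun x => (f x, g x)) p : G -> (E * F)%type) v =
    (tmap f p v, tmap g p v).
Proof.
move=> [cf df] [cg dg]; split.
  by split; [exact: cvg_pair|exact: (differentiable_pair df dg)].
by move=> v; rewrite /tmap; have /= -> := diff_pair df dg.
Qed.

Lemma tmap_inj (E F : normedModType R) (M : smoothSpaceType E) (N : smoothSpaceType F)
    (f : M -> N) (g : N -> M) p v :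
  mdiff f p -> mdiff g (f p) -> g \o f = id -> tmap f p v = 0 -> v = 0.
Proof.
move=> df dg gf fv; have [_ /(_ v)] := tmap_comp df dg.
by rewrite fv linear0 gf (mdiff_id p).2.
Qed.

(** The source of the product rules below: (v, w) is the sum of vectors tangent to the two slices
    through (p, q). *)
Lemma tmap_partial (E F G : normedModType R) (M : smoothSpaceType E)
    (N : smoothSpaceType F) (L : smoothSpaceType G) (f : M -> N -> L) p q
    (v : E) (w : F) :
  mdiff (fun z => f z.1 z.2) (p, q) ->
  (tmap (fun z : M * N => f z.1 z.2) (p, q) : (E * F)%type -> G) (v, w) =
  (tmap (fun x => f x q) p : E -> G) v + (tmap (f p) q : F -> G) w.
Proof.
move=> df.
have [d1 E1] := mdiff_pair (mdiff_id p).1 (mdiff_cst q p).1.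
have [d2 E2] := mdiff_pair (mdiff_cst p q).1 (mdiff_id q).1.
have [_ F1] := tmap_comp d1 df; have [_ F2] := tmap_comp d2 df.
have -> : (v, w) = (v, 0) + (0, w) :> (E * F)%type.
  by rewrite /GRing.add/= /add_pair/= addr0 add0r.
rewrite linearD; congr (_ + _).
  by rewrite [RHS]F1 E1 (mdiff_id p).2 (mdiff_cst q p).2.
by rewrite [RHS]F2 E2 (mdiff_id q).2 (mdiff_cst p q).2.
Qed.

End mdiff.

Section velocity.
Context {R : realType}.

Lemma within_continuous_cvg (T : topologicalType) (c : R -> T) a b t :
  {within `[a, b], continuous c} -> t \in `[a, b] ->
  c s @[s --> within `[a, b] t^'] --> c t.
Proof.
move=> /(@subspace_continuousP R) cc tab W /(cc _ tab) /=.
exact: nbhs_dnbhs.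
Qed.

Section one.
Variables (E : normedModType R) (M : smoothSpaceType E).
Implicit Types (c : R^o -> M) (a b t : R).

(** Differentiability at the single point [c t] suffices, as needed for trivializations, which are
    smooth only over an open set. *)
Lemma has_velocity_mdiff (F : normedModType R) (N : smoothSpaceType F) (f : M -> N)
    c a b t v : {within `[a, b], continuous c} -> mdiff f (c t) ->
  has_velocity c a b t v -> has_velocity (f \o c) a b t (tmap f (c t) v).
Proof.
move=> cc [cf df] [ab tab cv]; split => //.
pose phi := chart_at (c t); pose psi := chart_at (f (c t)).
have ct : cdom phi (c t) by exact: mem_chart_at.
have FG : Filter (within [set` `[a, b]] t^') by exact: within_filter.
have ccv := within_continuous_cvg cc tab.
have qv : phi (c s) @[s --> within [set` `[a, b]] t^'] --> phi (c t).
  exact: (cvg_comp _ _ ccv (cmap_continuous ct)).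
have := dquot_comp FG qv df cv.
apply: dquot_near => /=; first by rewrite cmapK.
have H : within [set` `[a, b]] t^' [set s | cdom phi (c s)] := ccv _ (nbhs_cdom ct).
by apply: (@filterS _ _ FG _ _ _ H) => s cs; rewrite /= cmapK.
Qed.

End one.

Section two.
Variables (E : normedModType R) (M : smoothSpaceType E).
Implicit Types (c : R^o -> M) (a b t : R).

(** A curve is its own composition with the identity of the line, whose velocity is 1. *)
Lemma has_velocity_mdiff_curve c a b t : a < b -> t \in `[a, b] -> mdiff c t ->
  has_velocity c a b t (tmap c t (1 : R)).
Proof.
move=> ab tab dc.
have H : has_velocity (@id R^o) a b t (1 : R).
  split => //; have FG : Filter (within [set` `[a, b]] t^') by exact: within_filter.
  apply: (@cvg_trans _ (cst (1 : R) @ within [set` `[a, b]] t^')); last exact: cvg_cst.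
  apply: near_eq_cvg; apply: (@filterS _ t^' _ [set s | s != t]).
    by move=> s st _; rewrite /= [_ *: _]mulVf// subr_eq0.
  exact: withinT.
apply: (has_velocity_mdiff _ dc H).
by apply: continuous_subspaceT => x; exact: cvg_id.
Qed.

Lemma C1_on_velocity c a b : C1_on c a b -> a < b ->
  exists (U : set R^o) (c' : R^o -> M), [/\ open U, `[a, b] `<=` U, Ckmap 1 U c',
    {in `[a, b], c =1 c'} &
    forall t, t \in `[a, b] -> has_velocity c a b t (tmap c' t (1 : R))].
Proof.
move=> [U [c' [oU sub Uc cc']]] ab; exists U, c'; split => // t tab.
apply: (@has_velocity_eq _ _ _ c'); first by move=> s /cc'.
by apply: has_velocity_mdiff_curve => //; apply: (Ckmap_mdiff Uc); exact: sub.
Qed.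

Lemma has_velocity_cst (p : M) a b t : a < b -> t \in `[a, b] ->
  has_velocity (fun=> p) a b t 0.
Proof.
move=> ab tab; split => //.
have -> : (fun s => (s - t)^-1 *: (chart_at p p - chart_at p p)) = cst 0.
  by apply/funext => s; rewrite subrr scaler0.
exact: cvg_cst.
Qed.

End two.

Lemma has_velocity_pair (E F : normedModType R) (M : smoothSpaceType E)
    (N : smoothSpaceType F) (c : R^o -> M) (d : R^o -> N) a b t v w :
  has_velocity c a b t v -> has_velocity d a b t w ->
  has_velocity (fun s => (c s, d s)) a b t ((v, w) : (E * F)%type).
Proof. by move=> [ab tab cv] [_ _ dv]; split => //; exact: (cvg_pair cv dv). Qed.

Lemma has_velocity_op (E F G : normedModType R) (M : smoothSpaceType E)
    (N : smoothSpaceType F) (L : smoothSpaceType G) (f : M -> N -> L)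
    (c : R^o -> M) (d : R^o -> N) a b t v w :
  {within `[a, b], continuous c} -> {within `[a, b], continuous d} ->
  mdiff (fun z => f z.1 z.2) (c t, d t) ->
  has_velocity c a b t v -> has_velocity d a b t w ->
  has_velocity (fun s => f (c s) (d s)) a b t
    ((tmap (fun x => f x (d t)) (c t) : E -> G) v + (tmap (f (c t)) (d t) : F -> G) w).
Proof.
move=> cc cd df cv dw; rewrite -tmap_partial//.
apply: (has_velocity_mdiff _ df (has_velocity_pair cv dw)).
apply/(@subspace_continuousP R) => x xab; apply: cvg_pair.
  by move/(@subspace_continuousP R) : cc; apply.
by move/(@subspace_continuousP R) : cd; apply.
Qed.

End velocity.

(** * Closure properties of smooth and C^k maps *)

Section smooth_maps.
Context {R : realType}.

Lemma Ckmap_id k (E : normedModType R) (M : smoothSpaceType E) (U : set M) :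
  Ckmap k U (@id M).
Proof.
split; first by move=> x _; exact: cvg_id.
move=> phi psi Aphi Apsi.
by apply: Ck_sub (atlas_compat _ _ Aphi Apsi k) => x [? [_ ?]].
Qed.

Lemma Ckmap_pair k (E F G : normedModType R) (M : smoothSpaceType E)
    (N : smoothSpaceType F) (L : smoothSpaceType G) (U : set L)
    (f : L -> M) (g : L -> N) : open U ->
  Ckmap k U f -> Ckmap k U g -> Ckmap k U (fun x => (f x, g x)).
Proof.
move=> oU [cf kf] [cg kg]; split.
  by move=> x Ux; apply: cvg_pair; [exact: cf|exact: cg].
move=> phi _ Aphi [psi Apsi [chi Achi <-]].
have oW : open (ccod phi `&` cinv phi @^-1`
    (U `&` (fun x => (f x, g x)) @^-1` cdom (prod_chart psi chi))).
  apply: open_preimage_on; [exact: ccod_open|by move=> x; exact: cinv_continuous|].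
  apply: open_preimage_on => //; last exact: cdom_open.
  by move=> x Ux; apply: cvg_pair; [exact: cf|exact: cg].
apply: (@Ck_pair _ k G E F _ (psi \o f \o cinv phi) (chi \o g \o cinv phi)) => //.
- by apply: Ck_sub (kf _ _ Aphi Apsi) => x [? [? []]].
- by apply: Ck_sub (kg _ _ Aphi Achi) => x [? [? []]].
Qed.

Lemma smooth_comp (E F G : normedModType R) (M : smoothSpaceType E)
    (N : smoothSpaceType F) (L : smoothSpaceType G) (f : M -> N) (g : N -> L) :
  smooth f -> smooth g -> smooth (g \o f).
Proof.
move=> fS gS k; apply: (Ckmap_comp (V := setT)) (fS k) (gS k) => //; exact: openT.
Qed.

Lemma smooth_pair (E F G : normedModType R) (M : smoothSpaceType E)
    (N : smoothSpaceType F) (L : smoothSpaceType G) (f : L -> M) (g : L -> N) :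
  smooth f -> smooth g -> smooth (fun x => (f x, g x)).
Proof. by move=> fS gS k; apply: Ckmap_pair; [exact: openT|exact: fS|exact: gS]. Qed.

Lemma smooth_id (E : normedModType R) (M : smoothSpaceType E) : smooth (@id M).
Proof. by move=> k; exact: Ckmap_id. Qed.

Lemma smooth_cst (E F : normedModType R) (M : smoothSpaceType E)
    (N : smoothSpaceType F) (a : N) : smooth (fun _ : M => a).
Proof. by move=> k; exact: Ckmap_cst. Qed.

Lemma smooth_op (E F G K : normedModType R) (M : smoothSpaceType E)
    (N : smoothSpaceType F) (L : smoothSpaceType G) (O : smoothSpaceType K)
    (op : M -> N -> L) (f : O -> M) (g : O -> N) :
  smooth (fun z => op z.1 z.2) -> smooth f -> smooth g ->
  smooth (fun x => op (f x) (g x)).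
Proof. by move=> opS fS gS; exact: smooth_comp (smooth_pair fS gS) opS. Qed.

Lemma Ckmap_op k (E F G K : normedModType R) (M : smoothSpaceType E)
    (N : smoothSpaceType F) (L : smoothSpaceType G) (O : smoothSpaceType K)
    (U : set O) (op : M -> N -> L) (f : O -> M) (g : O -> N) : open U ->
  smooth (fun z => op z.1 z.2) -> Ckmap k U f -> Ckmap k U g ->
  Ckmap k U (fun x => op (f x) (g x)).
Proof.
move=> oU opS fU gU; have := Ckmap_pair oU fU gU.
by move=> H; apply: (Ckmap_comp (V := setT) oU openT _ H (opS k)).
Qed.

Lemma Ckmap_comp_smooth k (E F G : normedModType R) (M : smoothSpaceType E)
    (N : smoothSpaceType F) (L : smoothSpaceType G) (U : set M)
    (f : M -> N) (g : N -> L) : open U ->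
  Ckmap k U f -> smooth g -> Ckmap k U (g \o f).
Proof. by move=> oU fU gS; exact: (Ckmap_comp (V := setT) oU openT _ fU (gS k)). Qed.

Lemma Ckmap_cinv k (E : normedModType R) (M : smoothSpaceType E) (phi : chart E M)
    (U : set R^o) (x : R^o -> E) : atlas phi -> open U -> Ck k U x ->
  (forall t, U t -> {for t, continuous x}) ->
  (forall t, U t -> ccod phi (x t)) -> Ckmap k U (cinv phi \o x : R^o -> M).
Proof.
move=> Aphi oU Ux cx xphi.
have cc t : U t -> {for t, continuous (cinv phi \o x)}.
  move=> Ut; apply: continuous_comp; first exact: cx.
  exact/cinv_continuous/xphi.
split => // _ psi -> Apsi /=.
have oW : open (U `&` (cinv phi \o x) @^-1` cdom psi).
  by apply: open_preimage_on => //; exact: cdom_open.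
apply: (@Ck_sub _ _ _ _ (U `&` (cinv phi \o x) @^-1` cdom psi)).
  by move=> t [_ [? ?]].
apply: (Ck_comp oW _ _ (atlas_compat _ _ Aphi Apsi k)).
  by move=> t [Ut pt]; split => //; exact: xphi.
by apply: Ck_sub Ux => t [].
Qed.

End smooth_maps.

Section zero_velocity.
Context {R : realType} {n : nat} {M : smoothSpaceType 'rV[R]_n}.

(** In a fixed chart around [c t0] the mean value inequality applies with bound 0. The velocity is
    given in the preferred chart at each point, but the differential of the transition map sends 0
    to 0. *)
Lemma zero_velocity_cst (c : R^o -> M) (a b : R) : a <= b ->
  {within `[a, b], continuous c} ->
  (forall t, t \in `]a, b[ -> has_velocity c a b t 0) ->
  forall t, t \in `[a, b] -> c t = c a.
Proof.
move=> ab cc H; apply: (@piecewise_eq _ _ c (cst (c a))) => //.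
apply: piecewise_local => // t0 t0ab.
have t0I : t0 \in `[a, b] by rewrite in_itv.
pose phi := chart_at (c t0).
have [d /= d0 Hd] : within [set` `[a, b]] (nbhs t0) [set s | cdom phi (c s)].
  move/(@subspace_continuousP R) : cc => /(_ _ t0I); apply.
  by apply: nbhs_cdom; exact: mem_chart_at.
have {}Hd s : s \in `[a, b] -> t0 - d < s < t0 + d -> cdom phi (c s).
  by move=> sI sd; apply: Hd => //; rewrite /= ltr_norml; lra.
exists d => // s s' as_ ss s'b ds sd csa t; rewrite in_itv/= => /andP[st ts].
have sub y : y \in `[s, t] -> y \in `[a, b] by rewrite !in_itv/=; lra.
have dom y : y \in `[s, t] -> cdom phi (c y).
  by move=> yst; apply: (Hd _ (sub _ yst)); move: yst; rewrite in_itv/=; lra.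
have tI : t \in `[s, t] by rewrite in_itv/= st lexx.
have sI : s \in `[s, t] by rewrite in_itv/= st lexx.
rewrite -csa -[LHS](cmapK (dom _ tI)) -[RHS](cmapK (dom _ sI)); congr (cinv _ _).
apply/eqP; rewrite -subr_eq0 -normr_le0.
have -> : 0 = 0 * (t - s) :> R by rewrite mul0r.
apply: (@mvt_rV R n (phi \o c) (cst 0)) => //; last by move=> *; rewrite normr0.
- move=> y; rewrite in_itv/= => /andP[sy yt].
  have yI : y \in `[a, b] by apply: sub; rewrite in_itv/= !ltW.
  have yI' : y \in `]a, b[ by rewrite in_itv/=; lra.
  have dy : cdom phi (c y) by apply: dom; rewrite in_itv/= !ltW.
  have [_ _ cv] := H y yI'; pose psi := chart_at (c y).
  have psiy : cdom psi (c y) by exact: mem_chart_at.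
  apply: dquot_is_derive.
  (* At an interior point the limit within [a, b] is an ordinary two-sided limit. *)
  have toy W : within [set` `[a, b]] y^' W -> y^' W.
    move=> Wy; have nI : y^' [set z | z \in `[a, b]].
      apply: nbhs_dnbhs; apply: filterS (near_in_itvoo yI') => z.
      exact: subset_itv_oo_cc.
    by apply: (@filterS2 _ (y^') _ _ _ _ _ nI Wy) => z zI /=; exact.
  have ccv : c s @[s --> y^'] --> c y.
    by move=> W /(within_continuous_cvg cc yI) /toy.
  have {}cv : dquot (psi \o c) y^' y 0 by move=> W /cv /toy.
  have qv : (psi \o c) s @[s --> y^'] --> (psi \o c) y.
    exact: (cvg_comp _ _ ccv (cmap_continuous psiy)).
  have dphi : differentiable (phi \o cinv psi) ((psi \o c) y).
    have [+ _] := atlas_compat _ _ (chart_at_atlas (c y)) (chart_at_atlas (c t0)) 1%N.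
    by apply; split; [exact: cmap_cod|rewrite /= cmapK].
  have FY : Filter (y^') by typeclasses eauto.
  have := dquot_comp FY qv dphi cv; rewrite linear0.
  apply: (@dquot_near _ _ ((phi \o cinv psi) \o (psi \o c)) (phi \o c) (y^') y 0).
    by rewrite /= cmapK.
  have Hc : y^' [set s | cdom psi (c s)] := ccv _ (nbhs_cdom psiy).
  by apply: (@filterS _ (y^') _ _ _ _ Hc) => z cz; rewrite /= cmapK.
- apply/(@subspace_continuousP R) => y yst.
  have cy : c z @[z --> within [set` `[s, t]] (nbhs y)] --> c y.
    apply: cvg_trans (_ : c @ within [set` `[a, b]] (nbhs y) --> c y).
      by apply: cvg_app; apply: within_subset => z /sub.
    by move/(@subspace_continuousP R) : cc; apply; exact: sub.
  exact: (cvg_comp _ _ cy (cmap_continuous (dom _ yst))).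
Qed.

End zero_velocity.

(** * Left-invariant differential equations *)

Lemma tmap_curve (R : realType) (E : normedModType R) (M : smoothSpaceType E)
  (c : R^o -> M) (s : R) :
  (tmap c s (1 : R) : E) = 'd (chart_at (c s) \o c) s (1 : R).
Proof.
rewrite /tmap.
have -> : (chart_at (c s) \o c \o cinv (chart_at (s : R^o))) = chart_at (c s) \o c.
  by apply/funext => r.
by [].
Qed.

Section form_along_curve.
Context {R : realType} {n : nat} {M : smoothSpaceType 'rV[R]_n}.
Local Notation E := 'rV[R]_n.

(* In the chart [phi], the velocity is a combination of the coordinate fields
   of [phi], on which a smooth form is smooth by definition. *)
Lemma form_continuous (V : normedModType R) (w : forall p : M, {linear tangent p -> V})
    (U : set R^o) (c : R^o -> M) t :
  smooth_form w -> open U -> Ckmap 1 U c -> U t ->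
  {for t, continuous (fun s : R^o => w (c s) (tmap c s (1 : R)) : V)}.
Proof.
move=> wS oU Uc Ut; have [cc kc] := Uc.
pose phi := chart_at (c t); pose x : R^o -> E := phi \o c.
have Aphi : atlas phi by exact: chart_at_atlas.
have phit : cdom phi (c t) by exact: mem_chart_at.
pose W := U `&` c @^-1` cdom phi.
have oW : open W by apply: open_preimage_on => //; exact: cdom_open.
have Wt : W t by split.
have [dx cx] : Ck 1 W x.
  by apply: Ck_sub (kc id_chart phi erefl Aphi) => s [? ?]; split.
pose basis i : E := delta_mx ord0 i.
pose wi i (y : E) := w (cinv phi y) ('d (chart_at (cinv phi y) \o cinv phi) y (basis i)) : V.
pose xi i (s : R^o) : R := ('d x s (1 : R) : E) ord0 i.
have key s : W s -> w (c s) (tmap c s (1 : R)) = \sum_i xi i s *: wi i (x s).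
  move=> [Us ps]; have xs : ccod phi (x s) by exact: cmap_cod.
  have dphi : differentiable (chart_at (c s) \o cinv phi) (x s).
    have [+ _] := atlas_compat _ _ Aphi (chart_at_atlas (c s)) 1%N.
    by apply; split => //; rewrite /= /x /= cmapK//; exact: mem_chart_at.
  have E1 : (tmap c s (1 : R) : E) = 'd (chart_at (c s) \o cinv phi) (x s) ('d x s (1 : R)).
    have nr : {near s, (chart_at (c s) \o cinv phi) \o x =1 chart_at (c s) \o c}.
      have : nbhs s W by exact: open_nbhs_nbhs.
      by apply: filterS => r [_ pr] /=; rewrite /x /= cmapK.
    have [_ E2] := near_eq_diff nr (differentiable_comp (dx s (conj Us ps)) dphi).
    apply: (etrans (tmap_curve c s)); apply: (etrans (congr1 (fun f => f (1 : R)) E2)).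
    exact: (congr1 (fun f => f (1 : R)) (diff_comp (dx s (conj Us ps)) dphi)).
  rewrite E1 (row_sum_delta ('d x s (1 : R) : E)) !linear_sum; apply: eq_bigr => i _.
  by rewrite !linearZ/= /wi /x /= cmapK.
have xc : {for t, continuous x}.
  apply: continuous_comp; first exact: cc.
  exact: cmap_continuous.
have S : {for t, continuous (fun s => \sum_i xi i s *: wi i (x s))}.
  have Ci i : {for t, continuous (fun s => xi i s *: wi i (x s))}.
    apply: cvgZ.
      have c1 : {for (t, (1 : R)), continuous (fun xv : R^o * R^o => 'd x (xv.1) (xv.2))}.
        exact: (cx (t, (1 : R)) (conj Wt I)).
      have c2 : {for t, continuous (fun s : R^o => (s, (1 : R)))}.
        exact: (cvg_pair (@cvg_id _ (nbhs t)) (cvg_cst (1 : R))).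
      have c3 := continuous_comp c2 c1.
      exact: (continuous_comp c3 (@coord_continuous _ _ _ ord0 i _)).
    have c4 : {for x t, continuous (wi i)}.
      by apply: (wS _ Aphi (basis i) 0%N); exact: cmap_cod.
    exact: (continuous_comp xc c4).
  elim: (index_enum _) => [|i r IH].
    rewrite (_ : (fun s => _) = cst 0); first exact: cvg_cst.
    by apply/funext => s; rewrite big_nil.
  rewrite (_ : (fun s => _) = (fun s => xi i s *: wi i (x s)) \+
    (fun s => \sum_(i <- r) xi i s *: wi i (x s))).
    exact: (cvgD (Ci i) IH).
  by apply/funext => s; rewrite big_cons.
have Wn : nbhs t W by exact: open_nbhs_nbhs.
suff : w (c s) (tmap c s (1 : R)) @[s --> t] --> (w (c t) (tmap c t (1 : R)) : V) by [].
rewrite key//; apply: cvg_trans S; apply: near_eq_cvg.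
by apply: filterS Wn => s Ws; rewrite key.
Qed.

End form_along_curve.

(** * Translations, the Maurer-Cartan form and the adjoint action *)

Section lie_group.
Context {R : realType} {n : nat} {G : lieGroupType 'rV[R]_n}.
Local Notation E := 'rV[R]_n.
Local Open Scope group_scope.

Lemma mulg_left_smooth (g : G) : smooth (fun x : G => g * x).
Proof.
apply: (@smooth_op R E E E E G G G G (fun x y : G => x * y) (fun=> g) id).
- exact: mulg_smooth.
- exact: smooth_cst.
- exact: smooth_id.
Qed.

Lemma mulg_right_smooth (g : G) : smooth (fun x : G => x * g).
Proof.
apply: (@smooth_op R E E E E G G G G (fun x y : G => x * y) id (fun=> g)).
- exact: mulg_smooth.
- exact: smooth_id.
- exact: smooth_cst.
Qed.

Lemma conjg_smooth (g : G) : smooth (fun x : G => g^-1 * x * g).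
Proof.
have H := @smooth_comp R E E E G G G (fun x => g^-1 * x) (fun x => x * g).
have H2 := H (mulg_left_smooth _) (mulg_right_smooth _).
exact: H2.
Qed.

(* The left Maurer-Cartan form. *)
Definition mcform (g : G) : {linear tangent g -> tangent (1 : G)} :=
  tmap (fun x : G => g^-1 * x) g.

(** The adjoint action of the inverse of [g]. The codomain sits at a point equal to 1 by a group law
    only; this is harmless since all tangent spaces have the same carrier. *)
Definition Ad_inv (g : G) : {linear tangent (1 : G) -> tangent (g^-1 * 1 * g)} :=
  tmap (fun x : G => g^-1 * x * g) 1.

(** Exchanges provably equal base points; the type of [tmap] depends on the point, so both sides are
    viewed as plain coordinates. *)
Lemma tmap_mcform (h g : G) (v : E) : h = g ->
  (tmap (fun x : G => g^-1 * x) h : E -> E) v = mcform g v.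
Proof. by move=> ->. Qed.

Lemma tmap_Ad_inv (g h : G) (v : E) : h = 1 ->
  (tmap (fun x : G => g^-1 * x * g) h : E -> E) v = Ad_inv g v.
Proof. by move=> ->. Qed.

Lemma mcform_inj (g : G) (v : tangent g) : mcform g v = 0%R -> v = 0%R.
Proof.
have m1 := smooth_mdiff g (mulg_left_smooth g^-1).
have m2 := smooth_mdiff (g^-1 * g) (mulg_left_smooth g).
have id12 : (fun x : G => g * x) \o (fun x => g^-1 * x) = id.
  by apply/funext => x /=; rewrite mulVKg.
exact: (tmap_inj m1 m2 id12).
Qed.

Lemma Ad_inv_inj (g : G) (v : E) : Ad_inv g v = 0%R -> v = 0%R.
Proof.
have m1 := smooth_mdiff (1 : G) (conjg_smooth g).
have m2 := smooth_mdiff (g^-1 * 1 * g) (conjg_smooth g^-1).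
have id12 : (fun x : G => g^-1^-1 * x * g^-1) \o (fun x => g^-1 * x * g) = id.
  by apply/funext => x /=; rewrite invgK !mulgA mulgV mul1g mulgK.
exact: (tmap_inj m1 m2 id12).
Qed.

(** Together with [mcform_equiv], this makes the Maurer-Cartan form behave as a connection form for
    [G] acting on itself from the right, so that [act_velocity] also yields the product rule in
    [G]. *)
Lemma mcform_fund (g : G) (X : E) :
  mcform g (tmap (fun x : G => g * x) 1 X) = X.
Proof.
have [_ H] := tmap_comp (smooth_mdiff (1 : G) (mulg_left_smooth g))
  (smooth_mdiff (g * 1) (mulg_left_smooth g^-1)).
apply: (etrans (esym (tmap_mcform _ (mulg1 g)))).
apply: (etrans (esym (H X))).
have -> : (fun x : G => g^-1 * x) \o (fun x => g * x) = id.
  by apply/funext => x /=; rewrite mulKg.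
by rewrite (mdiff_id 1).2.
Qed.

Lemma mcform_equiv (p g : G) (v : tangent p) :
  mcform (p * g) (tmap (fun x : G => x * g) p v) = Ad_inv g (mcform p v).
Proof.
have [_ H1] := tmap_comp (smooth_mdiff p (mulg_right_smooth g))
  (smooth_mdiff (p * g) (mulg_left_smooth (p * g)^-1)).
have [_ H2] := tmap_comp (smooth_mdiff p (mulg_left_smooth p^-1))
  (smooth_mdiff (p^-1 * p) (conjg_smooth g)).
apply: (etrans (esym (H1 v))).
have -> : (fun x : G => (p * g)^-1 * x) \o (fun x => x * g) =
    (fun x => g^-1 * x * g) \o (fun x => p^-1 * x).
  by apply/funext => x /=; rewrite invgM !mulgA.
apply: (etrans (H2 v)).
exact: (tmap_Ad_inv g _ (mulVg p)).
Qed.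

End lie_group.

(** * Velocities under a right action with an equivariant form *)

Section action_velocity.
Context {R : realType} {n : nat} {E : normedModType R} {G : lieGroupType 'rV[R]_n}
  {P : smoothSpaceType E}.
Local Open Scope group_scope.
Variables (act : P -> G -> P) (A : forall p : P, {linear tangent p -> tangent (1 : G)}).
Hypothesis act_smooth : smooth (fun z : P * G => act z.1 z.2).
Hypothesis actM : forall p g g', act p (g * g') = act (act p g) g'.
Hypothesis A_equiv : forall p g (v : tangent p),
  A (act p g) (tmap (act^~ g) p v) = Ad_inv g (A p v).
Hypothesis A_fund : forall p (X : tangent (1 : G)), A p (tmap (act p) 1 X) = X.

Lemma act_left_smooth p : smooth (act p).
Proof.
by apply: (@smooth_op R E _ E _ P G P G act (fun=> p) id);
  [|exact: smooth_cst|exact: smooth_id].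
Qed.

(** The orbit map of [p] is the orbit map of [act p g] after left translation by the inverse of [g],
    which reduces the claim to fundamental vectors. *)
Lemma form_orbit p (g : G) (w : tangent g) :
  A (act p g) (tmap (act p) g w) = mcform g w.
Proof.
have [_ H] := tmap_comp (smooth_mdiff g (mulg_left_smooth g^-1))
  (smooth_mdiff (g^-1 * g) (act_left_smooth (act p g))).
have E1 : act (act p g) \o (fun x => g^-1 * x) = act p.
  by apply/funext => x /=; rewrite -actM mulVKg.
rewrite E1 in H.
apply: (etrans (congr1 (A (act p g)) (H w))).
have K : forall h : G, h = 1 -> forall X : 'rV[R]_n,
    A (act p g) (tmap (act (act p g)) h X) = X :> 'rV[R]_n.
  by move=> h -> X; exact: A_fund.
exact: (K _ (mulVg g)).
Qed.

(** The gauge transformation formula A((p g)') = Ad(g^-1) A(p') + g^-1 g': in the product rule, the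
    first term is equivariance and the second is [form_orbit]. *)
Lemma act_velocity (p : R^o -> P) (g : R^o -> G) (a b t : R) v w :
  {within `[a, b]%classic, continuous p} -> {within `[a, b]%classic, continuous g} ->
  has_velocity p a b t v -> has_velocity g a b t w ->
  exists2 u, has_velocity (fun s => act (p s) (g s)) a b t u &
    A (act (p t) (g t)) u = (Ad_inv (g t) (A (p t) v) + mcform (g t) w)%R.
Proof.
move=> cp cg pv gw.
have d : mdiff (fun z : P * G => act z.1 z.2) (p t, g t) by exact: smooth_mdiff.
have := has_velocity_op cp cg d pv gw.
set u := (X in has_velocity _ _ _ _ X) => H; exists u => //.
rewrite /u linearD; congr (_ + _)%R; first exact: A_equiv.
exact: form_orbit.
Qed.

End action_velocity.

Section curves_in_charts.
Context {R : realType} {n : nat}.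
Local Notation E := 'rV[R]_n.

Lemma Ck1_is_derive (U : set R^o) (x : R -> E) (y : R -> E) : open U ->
  (forall t, U t -> is_derive t (1 : R) x (y t)) ->
  (forall t, U t -> {for t, continuous y}) -> Ck 1 U (x : R^o -> E).
Proof.
move=> oU dx cy.
have df t : U t -> differentiable (x : R^o -> E) t.
  by move=> /dx[? _]; exact/derivable1_diffP.
split => //; have oU' : open (U `*` [set: R^o]) by apply: openX => //; exact: openT.
pose dxy (tv : R^o * R^o) : E := tv.2 *: y tv.1.
apply: (@Ck_ext R 0 (R^o * R^o)%type E (U `*` [set: R^o]) dxy _ oU').
  move=> [t v] [/= Ut _]; rewrite diff1E; last exact: df.
  by rewrite derive1E; have [_ ->] := dx t Ut.
move=> [t v] [/= Ut _]; apply: cvgZ; first exact: cvg_snd.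
by apply: (@continuous_comp _ _ _ fst y (t, v)); [exact: cvg_fst|exact: cy].
Qed.

End curves_in_charts.

Section left_invariant_ode.
Context {R : realType} {n : nat} {G : lieGroupType 'rV[R]_n}.
Local Notation E := 'rV[R]_n.

(* In the chart at 1 the equation reads x' = d m (x, x0) (0, b t), where m is
   the multiplication. *)
Lemma left_invariant_ode (b : R -> E) (N : set R) (t0 : R) :
  open N -> N t0 -> (forall t, N t -> {for t, continuous b}) ->
  exists d (k : R^o -> G), [/\ 0 < d, Ckmap 1 (`]t0 - d, t0 + d[%classic : set R^o) k &
    forall t, t \in `]t0 - d, t0 + d[ ->
      N t /\ mcform (k t) (tmap k t (1 : R)) = b t].
Proof.
move=> oN Nt0 cb.
pose phi := chart_at (1%g : G); pose x0 := phi 1%g.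
have Aphi : atlas phi by exact: chart_at_atlas.
have phi1 : cdom phi 1%g by exact: mem_chart_at.
have x0c : ccod phi x0 by exact: cmap_cod.
have phix0 : cinv phi x0 = 1%g by rewrite cmapK.
pose phi2 := prod_chart phi phi.
have Aphi2 : atlas phi2 by exists phi => //; exists phi.
pose mul (z : G * G) : G := (z.1 * z.2)%g.
have mulS : smooth mul by exact: mulg_smooth.
pose m := phi \o mul \o cinv phi2 : E * E -> E.
pose W : set (E * E) := ccod phi2 `&` cinv phi2 @^-1` (setT `&` mul @^-1` cdom phi).
have oW : open W.
  apply: open_preimage_on; [exact: ccod_open|by move=> z; exact: cinv_continuous|].
  rewrite setTI -[X in open X]setTI; apply: open_preimage_on;
    [exact: openT| |exact: cdom_open].
  by move=> z _; case: (mulS 0%N) => + _; apply.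
(* Two derivatives of [m], because the right-hand side [F] is built from its differential and must
   be C^1. *)
have [dm Cm] : Ck 2 W m by have [_ /(_ _ _ Aphi2 Aphi)] := mulS 2.
have Wx0 : W (x0, x0).
  by do ! split => //=; rewrite /mul /= phix0 mulg1.
(* The vector (0, z.2) at the point (z.1, x0); the differential of [m] maps it to the left translate
   of z.2 from 1 to the point with coordinates z.1. *)
pose iota (z : E * E) : (E * E) * (E * E) := ((z.1, x0), (0, z.2)).
have Ciota k : Ck k setT iota.
  have C1 : Ck k [set: E * E] (fun z : E * E => z.1).
    have := @Ck_lin R k (E * E)%type E setT (fst : {linear (E * E)%type -> E}).
    by apply => z; exact: cvg_fst.
  have C2 : Ck k [set: E * E] (fun z : E * E => z.2).
    have := @Ck_lin R k (E * E)%type E setT (snd : {linear (E * E)%type -> E}).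
    by apply => z; exact: cvg_snd.
  apply: (@Ck_pair R k (E * E)%type (E * E)%type (E * E)%type _
    (fun z => (z.1, x0)) (fun z => (0, z.2))).
  - exact: openT.
  - by apply: (@Ck_pair R k (E * E)%type E E) => //;
      [exact: openT|exact: (@Ck_cst _ k (E * E)%type)].
  - by apply: (@Ck_pair R k (E * E)%type E E) => //;
      [exact: openT|exact: (@Ck_cst _ k (E * E)%type)].
pose F (z : E * E) : E := 'd m ((iota z).1) ((iota z).2).
pose U : set (E * E) := setT `&` iota @^-1` (W `*` setT).
have oU : open U.
  apply: open_preimage_on; [exact: openT|by move=> z _; exact: (Ciota 0%N)|].
  by apply: openX => //; exact: openT.
have CF : Ck 1 U F.
  have Ci : Ck 1 U iota by apply: Ck_sub (Ciota 1%N).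
  have H := @Ck_comp R 1 (E * E)%type ((E * E) * (E * E))%type E U (W `*` setT) iota
    (fun xv => 'd m (xv.1) (xv.2)) oU.
  by apply: H => // z [].
have Ub0 : U (x0, b t0) by split.
have [d [x [d0 xt0 Hx]]] := local_ode oU CF oN Nt0 cb Ub0.
pose J : set R^o := `]t0 - d, t0 + d[%classic.
have oJ : open J by exact: itv_open.
pose k : R^o -> G := cinv phi \o x.
have xc t : J t -> ccod phi (x t).
  by move=> /Hx[_ [_ [[[]]]]].
have xcont t : J t -> {for t, continuous (x : R^o -> E)}.
  by move=> /Hx[_ _]; exact: is_derive_continuous.
have Cx : Ck 1 J (x : R^o -> E).
  apply: (@Ck1_is_derive _ _ _ _ (fun t => F (x t, b t))) => //.
    by move=> t /Hx[].
  move=> t Jt; have [Nt Uxb _] := Hx t Jt.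
  have c1 : {for t, continuous (fun t : R => (x t, b t))}.
    exact: (cvg_pair (xcont t Jt) (cb t Nt)).
  have c2 : {for (x t, b t), continuous F}.
    by have [+ _] := CF => /(_ _ Uxb); exact: differentiable_continuous.
  exact: (continuous_comp c1 c2).
exists d, k; split => //.
  by apply: (Ckmap_cinv Aphi oJ Cx xcont xc).
move=> t Jt; have [Nt Uxb Dx] := Hx t Jt; split => //.
pose L (g : G) := ((k t)^-1 * g)%g.
have LS : smooth L by exact: mulg_left_smooth.
have Lk : L (k t) = 1%g by rewrite /L mulVg.
have mk : mdiff k t by apply: (Ckmap_mdiff (Ckmap_cinv Aphi oJ Cx xcont xc)).
have mL : mdiff L (k t) by exact: smooth_mdiff.
have [_ H1] := tmap_comp mk mL.
apply: (etrans (esym (H1 (1 : R)))).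
apply: (etrans (tmap_curve _ _)).
have -> : chart_at ((L \o k) t) = phi by rewrite /= Lk.
pose ell := phi \o L \o cinv phi.
have kxt : cdom phi (k t) by exact: cinv_dom (xc _ Jt).
have dell : differentiable ell (x t).
  have [_ /(_ _ _ Aphi Aphi)[+ _]] := LS 1%N; apply; split; first exact: xc.
  by split => //=; rewrite -/(k t) Lk.
have dx : differentiable (x : R^o -> E) t by have [+ _] := Cx; apply.
have E1 : phi \o (L \o k) = ell \o x by [].
rewrite E1.
apply: (etrans (congr1 (fun f => f (1 : R)) (diff_comp dx dell))).
(* In coordinates, [r] is left translation by [k t] and [ell] is left translation by its inverse.
   Their composition is the identity near [x0], so the differential of [ell] returns [b t]. *)
pose r (y : E) : E := m (x t, y).
have Wxt : W (x t, x0) by case: Uxb => _ [].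
have Did := is_diff_id x0.
have d1 : differentiable (cst (x t) : E -> E) x0 by exact: differentiable_cst.
have d2 : differentiable (id : E -> E) x0 := @ex_diff _ _ _ _ _ _ _ Did.
have dincl : differentiable (fun y : E => (x t, y)) x0.
  exact: (differentiable_pair d1 d2).
have dr : differentiable r x0.
  exact: (differentiable_comp dincl (dm _ Wxt)).
have xt1 : 'd x t (1 : R) = 'd r x0 (b t).
  have -> : 'd x t (1 : R) = F (x t, b t).
    by rewrite diff1E// derive1E; have [_ ->] := Dx; rewrite scale1r.
  apply: esym; apply: (etrans (congr1 (fun f => f (b t)) (diff_comp dincl (dm _ Wxt)))).
  rewrite /F /iota /=; congr ('d m _ _).
  have := congr1 (fun f => f (b t)) (diff_pair d1 d2).
  move=> /= ->; congr (_, _); first by rewrite diff_cst.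
  by rewrite (@diff_val _ _ _ _ _ _ _ Did).
have rx0 : r x0 = x t by rewrite /r /m /mul /= phix0 mulg1 cinvK//; exact: xc.
have dell' : differentiable ell (r x0) by rewrite rx0.
have near_id : {near x0, id =1 ell \o r}.
  have : nbhs x0 [set y | W (x t, y)].
    apply: (differentiable_continuous dincl); exact: open_nbhs_nbhs.
  apply: filterS => y [[_ yc] [_ my]] /=.
  by rewrite /ell /r /m /= cmapK// /L /mul /= -/(k t) mulKg cinvK.
have [_ E2] := near_eq_diff near_id d2.
rewrite /= xt1 -[in 'd ell _]rx0.
apply: (etrans (esym (congr1 (fun f => f (b t)) (diff_comp dr dell')))).
apply: (etrans (congr1 (fun f => f (b t)) E2)).
by rewrite (@diff_val _ _ _ _ _ _ _ Did).
Qed.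

End left_invariant_ode.

Section velocity_tools.
Context {R : realType}.

Lemma smooth_snd (E F : normedModType R) (M : smoothSpaceType E)
  (N : smoothSpaceType F) : smooth (fun z : M * N => z.2).
Proof.
move=> k; split; first by move=> z _; exact: cvg_snd.
move=> _ psi [a Aa [b Ab <-]] Apsi.
have o2 : open (ccod b `&` cinv b @^-1` cdom psi).
  apply: open_preimage_on; [exact: ccod_open| |exact: cdom_open].
  by move=> x; exact: cinv_continuous.
have o1 : open (ccod a `*` (ccod b `&` cinv b @^-1` cdom psi)).
  by apply: openX => //; exact: ccod_open.
apply: (@Ck_sub _ _ _ _ (ccod a `*` (ccod b `&` cinv b @^-1` cdom psi))).
  by move=> [x y] /= [[? ?] [_ ?]].
have H := @Ck_comp R k (E * F)%type F F _ _ snd (psi \o cinv b) o1 _ _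
  (atlas_compat _ _ Ab Apsi k).
apply: H; first by move=> x [].
have := @Ck_lin R k (E * F)%type F _ (snd : {linear (E * F)%type -> F}).
by apply => x; exact: cvg_snd.
Qed.

Lemma smooth_continuous (E F : normedModType R) (M : smoothSpaceType E)
  (N : smoothSpaceType F) (f : M -> N) : smooth f -> continuous f.
Proof. by move=> fS x; have [+ _] := fS 0%N; apply. Qed.

Lemma within_comp (T T' : topologicalType) (f : T -> T') (c : R -> T) (D : set R) :
  continuous f -> {within D, continuous c} -> {within D, continuous (f \o c)}.
Proof.
move=> cf /(@subspace_continuousP R) cc; apply/(@subspace_continuousP R) => x Dx.
exact: (cvg_comp _ _ (cc x Dx) (cf _)).
Qed.

Lemma within_pair (T T' : topologicalType) (c : R -> T) (d : R -> T') (D : set R) :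
  {within D, continuous c} -> {within D, continuous d} ->
  {within D, continuous (fun x => (c x, d x))}.
Proof.
move=> /(@subspace_continuousP R) cc /(@subspace_continuousP R) cd.
apply/(@subspace_continuousP R) => x Dx.
exact: (cvg_pair (cc x Dx) (cd x Dx)).
Qed.

Lemma within_op (E F K : normedModType R) (M : smoothSpaceType E)
    (N : smoothSpaceType F) (L : smoothSpaceType K) (op : M -> N -> L)
    (c : R -> M) (d : R -> N) (D : set R) :
  smooth (fun z => op z.1 z.2) ->
  {within D, continuous c} -> {within D, continuous d} ->
  {within D, continuous (fun x => op (c x) (d x))}.
Proof.
move=> opS cc cd; have cop := smooth_continuous opS.
exact: (within_comp cop (within_pair cc cd)).
Qed.

Variables (E : normedModType R) (M : smoothSpaceType E).
Implicit Types (c : R^o -> M) (a b s t x : R) (phi : R^o -> R^o).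

(** The side conditions exclude only a point [x] at an end of [s, t] that is interior to [a, b],
    where a one-sided limit says too little. *)
Lemma has_velocity_extend c a b s t x v : a <= s -> t <= b ->
  a = s \/ s < x -> t = b \/ x < t -> has_velocity c s t x v -> has_velocity c a b x v.
Proof.
move=> as_ tb sx xt [st xst cv]; split; first by lra.
  by move: xst; rewrite !in_itv/=; lra.
have near_sub : within [set` `[a, b]] x^' [set y | y \in `[s, t]].
  have H1 : \forall y \near x, a = s \/ s < y.
    case: sx => [->|sx]; first by near=> y; left.
    by near=> y; right; near: y; exact: lt_nbhsr.
  have H2 : \forall y \near x, t = b \/ y < t.
    case: xt => [->|xt]; first by near=> y; left.
    by near=> y; right; near: y; exact: lt_nbhsl.
  apply: nbhs_dnbhs; apply: filterS2 H1 H2 => y h1 h2 /=.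
  rewrite !in_itv/=; case: h1 h2 => ? []?; lra.
apply: cvg_trans cv; move=> W /= HW.
by apply: (@filterS2 _ (x^') _ _ _ _ _ near_sub HW) => y ys Wy yab; apply: Wy; exact: ys.
Unshelve. all: by end_near. Qed.

Lemma has_velocity_glue c a m b v : has_velocity c a m m v -> has_velocity c m b m v ->
  has_velocity c a b m v.
Proof.
move=> [am _ c1] [mb _ c2]; split; first exact: lt_trans mb.
  by rewrite in_itv/= !ltW.
move=> W HW; have W1 := c1 W HW; have W2 := c2 W HW.
apply: (@filterS2 _ (m^') _ _ _ _ _ W1 W2) => y Wy1 Wy2; rewrite /= in_itv/= => /andP[ay yb].
have [ym|/ltW my] := leP y m; first by apply: Wy1; rewrite /= in_itv/= ay.
by apply: Wy2; rewrite /= in_itv/= my.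
Qed.

(** [c] need not be differentiable at the ends of [a, b], so the chain rule is applied to its C^1
    extension. *)
Lemma has_velocity_comp c phi a b s t x (r : R) v : C1_on c a b -> a < b ->
  C1_on phi s t -> (forall y, y \in `[s, t] -> phi y \in `[a, b]) ->
  has_velocity phi s t x r -> has_velocity c a b (phi x) v ->
  has_velocity (c \o phi) s t x (r *: v : E).
Proof.
move=> Cc ab Cphi sub vphi vc.
have [st xst _] := vphi.
have [U [c' [oU subU Uc cc' vc']]] := C1_on_velocity Cc ab.
have mc : mdiff c' (phi x) by apply: (Ckmap_mdiff Uc); apply: subU; exact: sub.
have := has_velocity_mdiff (C1_on_continuous Cphi) mc vphi.
have -> : (tmap c' (phi x) r : E) = r *: v.
  have -> : r = r *: (1 : R^o) by rewrite [RHS]mulr1.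
  rewrite linearZ/= [r *: 1]mulr1; congr (_ *: _).
  exact: (has_velocity_unique (vc' _ (sub _ xst)) vc).
by apply: has_velocity_eq => y yst /=; rewrite cc'//; exact: sub.
Qed.

End velocity_tools.

(** * Curves in a Lie group *)

Section lie_curves.
Context {R : realType} {n : nat} {G : lieGroupType 'rV[R]_n}.
Local Notation E := 'rV[R]_n.
Implicit Types (g h : R^o -> G) (a b t : R).

Lemma mul_velocity g h a b t (v w : E) :
  {within `[a, b], continuous g} -> {within `[a, b], continuous h} ->
  has_velocity g a b t v -> has_velocity h a b t w ->
  exists2 u, has_velocity (fun s => (g s * h s)%g) a b t u &
    mcform (g t * h t)%g u = Ad_inv (h t) (mcform (g t) v) + mcform (h t) w.
Proof.
have mA (p x y : G) : (p * (x * y) = p * x * y)%g by rewrite mulgA.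
exact: (@act_velocity R n _ G G (fun x y => x * y)%g (@mcform R n G)
  (@mulg_smooth _ _ G) mA (@mcform_equiv R n G) (@mcform_fund R n G)).
Qed.

Lemma lmul_velocity (g0 : G) h a b t (w : E) :
  {within `[a, b], continuous h} -> has_velocity h a b t w ->
  exists2 u, has_velocity (fun s => (g0 * h s)%g) a b t u &
    mcform (g0 * h t)%g u = mcform (h t) w.
Proof.
move=> ch vh; have [ab tab _] := vh.
have cg : {within `[a, b], continuous (fun _ : R^o => g0)}.
  by apply: continuous_subspaceT => x; exact: cvg_cst.
have [u uv ue] := mul_velocity cg ch (has_velocity_cst g0 ab tab) vh.
exists u; first exact: uv.
have z : Ad_inv (h t) (mcform g0 0) = 0 :> E.
  by apply: (etrans (congr1 (Ad_inv (h t)) (linear0 (mcform g0)))); exact: linear0.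
exact: (etrans ue (etrans (congr1 (+%R^~ _) z) (add0r _))).
Qed.

(** Comes from differentiating the constant product of [h s] and its inverse. *)
Lemma inv_velocity h a b t (w : E) :
  {within `[a, b], continuous h} -> has_velocity h a b t w ->
  exists2 u, has_velocity (fun s => (h s)^-1%g) a b t u &
    mcform (h t)^-1%g u = - Ad_inv (h t)^-1%g (mcform (h t) w).
Proof.
move=> ch vh; have [ab tab _] := vh.
have iS : smooth (fun x : G => x^-1%g) by exact: invg_smooth.
have vi := has_velocity_mdiff ch (smooth_mdiff (h t) iS) vh.
exists (tmap (fun x : G => x^-1%g) (h t) w); first exact: vi.
have ci : {within `[a, b], continuous (fun s => (h s)^-1%g)}.
  exact: (within_comp (smooth_continuous iS) ch).
have [u uv ue] := mul_velocity ch ci vh vi.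
have u0 : u = 0.
  apply: (has_velocity_unique (c := fun s => (h s * (h s)^-1)%g) uv).
  apply: (has_velocity_eq (c := fun=> 1%g)); first by move=> s _; rewrite mulgV.
  exact: has_velocity_cst.
rewrite u0 in ue; have ue' := etrans (esym (linear0 (mcform _))) ue.
apply/eqP; rewrite -addr_eq0 addrC; apply/eqP; exact: (esym ue').
Qed.

(** Differentiating q h = g, the equal Maurer-Cartan terms of [g] and [h] cancel; what remains is
    the adjoint image of the form of [q], so [q] has zero velocity. *)
Lemma mcform_unique g h a b : a <= b ->
  {within `[a, b], continuous g} -> {within `[a, b], continuous h} ->
  (forall t, t \in `]a, b[ -> exists v w, [/\ has_velocity g a b t v,
    has_velocity h a b t w & mcform (g t) v = mcform (h t) w :> E]) ->
  g a = h a -> forall t, t \in `[a, b] -> g t = h t.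
Proof.
move=> ab cg ch H gha t tab.
pose q s := (g s * (h s)^-1)%g.
have iS : smooth (fun x : G => x^-1%g) by exact: invg_smooth.
have ci : {within `[a, b], continuous (fun s => (h s)^-1%g)}.
  exact: (within_comp (smooth_continuous iS) ch).
have cq : {within `[a, b], continuous q}.
  exact: (@within_op _ _ _ _ G G G (fun x y => x * y)%g _ _ _ (@mulg_smooth _ _ G) cg ci).
have qE s : (q s * h s)%g = g s by rewrite /q mulgVK.
suff : q t = q a.
  move=> qt; have := qE t; rewrite qt (_ : q a = 1%g) ?mul1g//.
  by rewrite /q gha mulgV.
apply: (zero_velocity_cst ab cq _ tab) => s sab.
have [v [w [gv hw E1]]] := H s sab.
(* This serves only to know that [q] has a velocity [u]; its value is then read off from the product
   of [q] and [h]. *)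
have [w' iw _] := inv_velocity ch hw.
have [u qu _] := mul_velocity cg ci gv iw.
have [v' gv' E2] := mul_velocity cq ch qu hw.
have vv' : v' = v.
  apply: (has_velocity_unique (c := g) _ gv).
  by apply: has_velocity_eq gv' => x _; exact: qE.
have K x : x = g s -> mcform x v = mcform (g s) v :> E by move=> ->.
have A0 : Ad_inv (h s) (mcform (q s) u) = 0 :> E.
  apply: (addIr (mcform (h s) w)); rewrite add0r; apply: (etrans (esym E2)).
  by rewrite vv'; exact: (etrans (K _ (qE s)) E1).
have u0 : u = 0 := mcform_inj (Ad_inv_inj A0).
by rewrite u0 in qu.
Qed.

Lemma tmap_point (f : G -> G) (p q : G) (v : E) : p = q ->
  (tmap f p : E -> E) v = (tmap f q : E -> E) v.
Proof. by move=> ->. Qed.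

(** A homomorphism intertwines left translations, hence the Maurer-Cartan forms, through its
    derivative at 1. Used for alpha(g^-1). *)
Lemma mcform_morph (f : G -> G) (h : G) (w : E) : smooth f ->
  {morph f : x y / (x * y)%g} ->
  mcform (f h) (tmap f h w) = (tmap f 1%g : E -> E) (mcform h w).
Proof.
move=> fS fM.
have f1 : f 1%g = 1%g by apply: (mulgI (f 1%g)); rewrite -fM !mulg1.
have fV x : f x^-1%g = (f x)^-1%g.
  by apply: (mulgI (f x)); rewrite -fM !mulgV.
have [_ H1] := tmap_comp (smooth_mdiff h fS)
  (smooth_mdiff (f h) (mulg_left_smooth (f h)^-1%g)).
have [_ H2] := tmap_comp (smooth_mdiff h (mulg_left_smooth h^-1%g))
  (smooth_mdiff (h^-1 * h)%g fS).
apply: (etrans (esym (H1 w))).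
have -> : (fun x : G => (f h)^-1 * x)%g \o f = f \o (fun x => h^-1 * x)%g.
  by apply/funext => x /=; rewrite fM fV.
apply: (etrans (H2 w)).
exact: (tmap_point f (mcform h w) (mulVg h)).
Qed.

End lie_curves.

(** * Horizontal lifts *)

Section bundle.
Context {R : realType} {nG nP nM : nat} {G : lieGroupType 'rV[R]_nG}
  {P : manifoldType 'rV[R]_nP} {M : manifoldType 'rV[R]_nM}
  (B : principalBundle G P M).
Local Notation EP := 'rV[R]_nP.
Implicit Types (p q : P) (g : G).

(** Invariance of the projection, transitivity on fibres and freeness are not fields of
    [principalBundle]; all are read off a trivialization, where the action is right
    multiplication. *)
Lemma bproj_act p g : bproj B (bact B p g) = bproj B p.
Proof.
have [U [psi [psi' [_ Ux _ _ [h1 h2 h3 h4 h5]]]]] := btriv B (bproj B p).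
have Up : U (psi p).1 by rewrite h3.
have := h5 (psi p) g Up; rewrite h1// => ->.
by rewrite h4//= h3.
Qed.

Lemma bact_transitive p q : bproj B p = bproj B q -> exists g, q = bact B p g.
Proof.
have [U [psi [psi' [_ Ux _ _ [h1 h2 h3 h4 h5]]]]] := btriv B (bproj B p) => pq.
have Uq : U (bproj B q) by rewrite -pq.
exists ((psi p).2^-1 * (psi q).2)%g.
have Up : U (psi p).1 by rewrite h3.
have := h5 (psi p) ((psi p).2^-1 * (psi q).2)%g Up; rewrite h1// => ->.
by rewrite mulVKg h3// pq -[LHS]h1//; congr psi'; case: (psi q) (h3 q Uq) => ? ? /= ->.
Qed.

Lemma bact_free p g : bact B p g = p -> g = 1%g.
Proof.
have [U [psi [psi' [_ Ux _ _ [h1 h2 h3 h4 h5]]]]] := btriv B (bproj B p).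
have Up : U (psi p).1 by rewrite h3.
have := h5 (psi p) g Up; rewrite h1// => -> pp.
have := h2 ((psi p).1, (psi p).2 * g)%g Up; rewrite pp => /(congr1 snd) /= E1.
by apply: (mulgI (psi p).2); rewrite mulg1 -E1.
Qed.

Lemma bproj_surj x : exists p, bproj B p = x.
Proof.
have [U [psi [psi' [_ Ux _ _ [h1 h2 h3 h4 h5]]]]] := btriv B x.
by exists (psi' (x, 1%g)); rewrite h4.
Qed.

Variable A : connectionForm B.

Lemma cform_orbit p (g : G) (w : tangent g) :
  A (bact B p g) (tmap (bact B p) g w) = mcform g w.
Proof.
exact: (form_orbit (@bact_smooth _ _ _ _ _ _ _ B) (@bactM _ _ _ _ _ _ _ B)
  (@cform_fund _ _ _ _ _ _ _ _ A)).
Qed.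

Lemma cform_act_velocity (p : R^o -> P) (g : R^o -> G) (a b t : R) v w :
  {within `[a, b], continuous p} -> {within `[a, b], continuous g} ->
  has_velocity p a b t v -> has_velocity g a b t w ->
  exists2 u, has_velocity (fun s => bact B (p s) (g s)) a b t u &
    A (bact B (p t) (g t)) u = (Ad_inv (g t) (A (p t) v) + mcform (g t) w)%R.
Proof.
exact: (@act_velocity _ _ _ _ _ _ _ (@bact_smooth _ _ _ _ _ _ _ B)
  (@bactM _ _ _ _ _ _ _ B) (@cform_equiv _ _ _ _ _ _ _ _ A) (@cform_fund _ _ _ _ _ _ _ _ A)).
Qed.

(* A vertical vector is tangent to the orbit, where [A] is the Maurer-Cartan
   form. *)
Lemma vertical_horizontal p (w : tangent p) :
  tmap (bproj B) p w = 0 -> A p w = 0 -> w = 0.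
Proof.
have [U [psi [psi' [oU Ux psiS psiS' [h1 h2 h3 h4 h5]]]]] := btriv B (bproj B p).
move=> pw Aw.
have oV : open (bproj B @^-1` U).
  rewrite -[X in open X]setTI; apply: open_preimage_on => //; first exact: openT.
  by move=> x _; exact: (smooth_continuous (@bproj_smooth _ _ _ _ _ _ _ B)).
have piS := @bproj_smooth _ _ _ _ _ _ _ B.
have mpsi : mdiff psi p := Ckmap_mdiff (psiS 1%N) Ux.
have oV' : open (U `*` [set: G]) by apply: openX => //; exact: openT.
pose x := bproj B p; pose g := (psi p).2.
pose sigma y : M * G := (bproj B y, (psi y).2).
have [m1 _] := tmap_comp mpsi (smooth_mdiff (psi p) (@smooth_snd _ _ _ M G)).
have [ms Es] := mdiff_pair (smooth_mdiff p piS) m1.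
pose f a b := psi' (a, b).
have Ef : psi' = (fun z => f z.1 z.2) by apply/funext => -[a b].
have mf : mdiff (fun z => f z.1 z.2) (x, g).
  by rewrite -Ef; apply: (Ckmap_mdiff (psiS' 1%N)); split.
have nearid : {near p, id =1 (fun z => f z.1 z.2) \o sigma}.
  have : nbhs p (bproj B @^-1` U) by exact: open_nbhs_nbhs.
  apply: filterS => y Uy /=; rewrite /f -(h3 y Uy) -[LHS](h1 y Uy).
  by case: (psi y).
have [_ E1] := tmap_near nearid (mdiff_id p).1.
have [_ E2] := tmap_comp ms mf.
pose y := tmap (snd \o psi) p w.
have E3 := tmap_partial 0 (y : 'rV[R]_nG) mf.
(* The point of the fibre with group coordinate 1: [psi'] restricted to the fibre over [x] is its
   orbit map, so [w] is tangent to its orbit. *)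
pose q := psi' (x, 1%g).
have fq : f x = bact B q.
  apply/funext => h; have E4 := h5 (x, 1%g) h Ux.
  by rewrite (mul1g h) in E4; exact: (esym E4).
have wE : w = (tmap (bact B q) g : _ -> EP) y.
  apply: (etrans (esym ((mdiff_id p).2 w))); apply: (etrans (congr1 (fun h => h w) E1)).
  apply: (etrans (E2 w)).
  have Esw := Es w; rewrite pw in Esw.
  apply: (etrans (congr1 (tmap (fun z => f z.1 z.2) (x, g)) Esw)).
  apply: (etrans E3); rewrite fq.
  exact: (etrans (congr1 (+%R^~ _) (linear0 _)) (add0r _)).
have qg : bact B q g = p.
  rewrite -fq /f /x -(h3 p Ux) -[RHS](h1 p Ux) /g.
  by case: (psi p).
have K p' (w' : EP) : p' = p -> w' = w -> A p' w' = 0 by move=> -> ->.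
have y0 : y = 0.
  by apply: (@mcform_inj _ _ _ g); rewrite -[LHS](cform_orbit q); exact: K.
rewrite wE y0; exact: linear0.
Qed.

End bundle.

Section lifts.
Context {R : realType} {nG nP nM : nat} {G : lieGroupType 'rV[R]_nG}
  {P : manifoldType 'rV[R]_nP} {M : manifoldType 'rV[R]_nM}
  (B : principalBundle G P M) (A : connectionForm B).
Local Notation EP := 'rV[R]_nP.
Local Notation EG := 'rV[R]_nG.

Let bactS : smooth (fun z : P * G => bact B z.1 z.2) := @bact_smooth _ _ _ _ _ _ _ B.
Let bprojS : smooth (bproj B) := @bproj_smooth _ _ _ _ _ _ _ B.

Lemma Ckmap_within k (E : normedModType R) (N : smoothSpaceType E) (U : set R^o)
    (c : R^o -> N) (a b : R) : Ckmap k U c -> (forall t, t \in `[a, b] -> U t) ->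
  {within `[a, b], continuous c}.
Proof.
move=> [cc _] sub; apply: continuous_in_subspaceT => t; rewrite inE => tab.
exact/cc/sub.
Qed.

Lemma local_horizontal_lift (U : set R^o) (c : R^o -> M) (t0 : R) :
  open U -> Ckmap 1 U c -> U t0 ->
  exists d (q : R^o -> P), [/\ 0 < d, Ckmap 1 (`]t0 - d, t0 + d[%classic : set R^o) q &
    forall t, t \in `]t0 - d, t0 + d[ ->
      [/\ U t, bproj B (q t) = c t & A (q t) (tmap q t (1 : R)) = 0]].
Proof.
move=> oU Uc Ut0.
have [V [psi [psi' [oV Vx _ psiS' [h1 h2 h3 h4 h5]]]]] := btriv B (c t0).
pose N := U `&` c @^-1` V.
have oN : open N by apply: open_preimage_on => // x Ux; case: Uc => + _; apply.
have oV' : open (V `*` [set: G]) by apply: openX => //; exact: openT.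
have Nc : Ckmap 1 N c by apply: Ckmap_sub Uc => x [].
pose p (s : R^o) : P := psi' (c s, 1%g).
have Np : Ckmap 1 N p.
  have H := Ckmap_pair oN Nc (Ckmap_cst 1 N (1%g : G)).
  by apply: (Ckmap_comp oN oV' _ H (psiS' 1%N)) => s [].
pose b (s : R) : EG := A (p s) (tmap p s (1 : R)).
have cb t : N t -> {for t, continuous b}.
  by move=> Nt; apply: (form_continuous (@cform_smooth _ _ _ _ _ _ _ _ A) oN Np Nt).
have [d [k [d0 kC Hk]]] := left_invariant_ode (G := G) oN (conj Ut0 Vx) cb.
pose I : set R^o := `]t0 - d, t0 + d[%classic.
have oI : open I by exact: itv_open.
have IN : I `<=` N by move=> t /Hk[].
have Ip : Ckmap 1 I p := Ckmap_sub IN Np.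
have iS : smooth (fun x : G => x^-1%g) by exact: invg_smooth.
have Ik : Ckmap 1 I (fun s => (k s)^-1%g).
  exact: (Ckmap_comp_smooth oI kC iS).
pose q s := bact B (p s) (k s)^-1%g.
have Iq : Ckmap 1 I q := Ckmap_op oI bactS Ip Ik.
exists d, q; split; [exact: d0|exact: Iq|move=> t tI].
have [[Ut Vt] kb] := Hk t tI; split; first exact: Ut.
  by rewrite bproj_act; exact: (h4 (c t, 1%g)).
(* Midpoints between [t] and the ends of the open interval: velocities are taken within a closed
   interval around [t] inside it. *)
pose a1 := (t0 - d + t) / 2; pose a2 := (t + (t0 + d)) / 2.
have tI' := tI; rewrite in_itv/= in tI'.
have a12 : a1 < a2 by rewrite /a1 /a2; lra.
have ta : t \in `[a1, a2] by rewrite in_itv/= /a1 /a2; lra.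
have sub s : s \in `[a1, a2] -> I s by rewrite /I /= !in_itv/= /a1 /a2; lra.
have vel (F : normedModType R) (L : smoothSpaceType F) (f : R^o -> L) :
    Ckmap 1 I f -> has_velocity f a1 a2 t (tmap f t (1 : R)).
  by move=> If; apply: has_velocity_mdiff_curve => //; exact: Ckmap_mdiff If tI.
have cp := Ckmap_within Ip sub; have ck := Ckmap_within kC sub.
have cki := Ckmap_within Ik sub.
have [u uv ue] := inv_velocity ck (vel _ _ _ kC).
have [w wv we] := cform_act_velocity A cp cki (vel _ _ _ Ip) uv.
have -> : tmap q t (1 : R) = w by exact: (has_velocity_unique (vel _ _ _ Iq) wv).
apply: (etrans we); apply: (etrans (congr1 (fun x => _ + x) ue)).
(* Both terms are images under the adjoint action of [k t], of [b t] and of the Maurer-Cartan image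
   of k'; these agree by the choice of [k]. *)
apply/eqP; rewrite subr_eq0; apply/eqP; apply: (congr1 (Ad_inv _)).
exact: (esym kb).
Qed.

(** The lifts differ by a curve [g] in [G]. In a trivialization [g] is a quotient of group
    coordinates, so it has velocities; in the formula for A along c1 g = c2 only its Maurer-Cartan
    term survives, which must vanish. *)
Lemma horizontal_lift_unique (c1 c2 : R^o -> P) (a b : R) : a <= b ->
  {within `[a, b], continuous c1} -> {within `[a, b], continuous c2} ->
  (forall t, t \in `[a, b] -> bproj B (c1 t) = bproj B (c2 t)) ->
  (forall t, t \in `]a, b[ -> exists v w, [/\ has_velocity c1 a b t v,
    has_velocity c2 a b t w, A (c1 t) v = 0 & A (c2 t) w = 0]) ->
  c1 a = c2 a -> forall t, t \in `[a, b] -> c1 t = c2 t.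
Proof.
move=> ab cc1 cc2 pc H; apply: piecewise_eq.
apply: piecewise_local => // t0 t0ab.
have t0I : t0 \in `[a, b] by rewrite in_itv.
have [V [psi [psi' [oV Vx psiS _ [h1 h2 h3 h4 h5]]]]] := btriv B (bproj B (c1 t0)).
have oV' : open (bproj B @^-1` V).
  rewrite -[X in open X]setTI; apply: open_preimage_on => //; first exact: openT.
  by move=> x _; exact: (smooth_continuous bprojS).
have [d /= d0 Hd] : within [set` `[a, b]] (nbhs t0) [set s | V (bproj B (c1 s))].
  have cvt := (@subspace_continuousP R _ _ _).1 cc1 t0 t0I.
  have nV : nbhs (c1 t0) (bproj B @^-1` V) by apply: open_nbhs_nbhs.
  exact: (cvt _ nV).
have {}Hd s : s \in `[a, b] -> t0 - d < s < t0 + d -> V (bproj B (c1 s)).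
  by move=> sI sd; apply: Hd => //; rewrite /= ltr_norml; lra.
exists d => // s s' as_ ss s'b ds sd cs.
have sub y : y \in `[s, s'] -> y \in `[a, b] by rewrite !in_itv/=; lra.
have dom1 y : y \in `[s, s'] -> V (bproj B (c1 y)).
  by move=> yst; apply: (Hd _ (sub _ yst)); move: yst; rewrite in_itv/=; lra.
have dom2 y : y \in `[s, s'] -> V (bproj B (c2 y)).
  by move=> yI; rewrite -pc ?sub//; exact: dom1.
have cc1' : {within `[s, s'], continuous c1}.
  by apply: continuous_subspaceW cc1 => y /=; exact: sub.
have cc2' : {within `[s, s'], continuous c2}.
  by apply: continuous_subspaceW cc2 => y /=; exact: sub.
pose g1 y := (psi (c1 y)).2; pose g2 y := (psi (c2 y)).2; pose g y := ((g1 y)^-1 * g2 y)%g.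
have c2E y : y \in `[s, s'] -> c2 y = bact B (c1 y) (g y).
  move=> yI; have D1 := dom1 y yI; have D2 := dom2 y yI.
  have D1' : V (psi (c1 y)).1 by rewrite h3.
  have := h5 (psi (c1 y)) (g y) D1'; rewrite h1// => ->.
  rewrite /g /g1 mulVKg h3// pc ?sub// -[LHS]h1// -h3//.
  by rewrite /g2; congr psi'; case: (psi (c2 y)).
have psic (c : R^o -> P) : {within `[s, s'], continuous c} ->
    (forall y, y \in `[s, s'] -> V (bproj B (c y))) ->
    {within `[s, s'], continuous (fun y => (psi (c y)).2)}.
  move=> /(@subspace_continuousP R) cc dom; apply/(@subspace_continuousP R) => y yI.
  have psiy : {for c y, continuous psi} by have [+ _] := psiS 0%N; apply; exact: dom.
  have := cvg_comp _ _ (cc y yI) psiy => H1.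
  by apply: (cvg_comp _ _ H1); exact: cvg_snd.
have cg1 := psic _ cc1' dom1; have cg2 := psic _ cc2' dom2.
have iS : smooth (fun x : G => x^-1%g) by exact: invg_smooth.
have cg1i : {within `[s, s'], continuous (fun y => (g1 y)^-1%g)}.
  exact: (within_comp (smooth_continuous iS) cg1).
have cg : {within `[s, s'], continuous g}.
  exact: (@within_op _ _ _ _ G G G (fun x y => x * y)%g _ _ _ (@mulg_smooth _ _ G) cg1i cg2).
have g_cst : forall y, y \in `[s, s'] -> g y = g s.
  apply: (zero_velocity_cst ss cg) => y yI.
  have yI' : y \in `[s, s'] by exact: subset_itv_oo_cc yI.
  have := yI; rewrite in_itv/= => /andP[sy ys].
  have yab : y \in `]a, b[ by rewrite in_itv/= (le_lt_trans as_ sy) (lt_le_trans ys s'b).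
  have lss : s < s' := lt_trans sy ys.
  have [v [w [vv wv Av Aw]]] := H y yab.
  have {}vv := has_velocity_sub as_ s'b lss yI' vv.
  have {}wv := has_velocity_sub as_ s'b lss yI' wv.
  have mpsi (x : P) : V (bproj B x) -> mdiff (fun x => (psi x).2) x.
    move=> Vx'; have m1 : mdiff psi x := Ckmap_mdiff (psiS 1%N) Vx'.
    by have [] := tmap_comp m1 (smooth_mdiff (psi x) (@smooth_snd _ _ _ M G)).
  have v1 := has_velocity_mdiff cc1' (mpsi _ (dom1 _ yI')) vv.
  have v2 := has_velocity_mdiff cc2' (mpsi _ (dom2 _ yI')) wv.
  have [u1 uv1 _] := inv_velocity cg1 v1.
  have [u uv _] := mul_velocity cg1i cg2 uv1 v2.
  have [z zv ze] := cform_act_velocity A cc1' cg vv uv.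
  have zw : z = w.
    apply: (has_velocity_unique (c := c2) _ wv).
    by apply: has_velocity_eq zv => x xI; rewrite c2E.
  have u0 : u = 0.
    apply: (@mcform_inj _ _ _ (g y)); apply: (etrans (esym (add0r _))).
    have E0 : Ad_inv (g y) (A (c1 y) v) = 0 :> EG.
      by apply: (etrans (congr1 (Ad_inv (g y)) Av)); exact: linear0.
    apply: (etrans (congr1 (+%R^~ _) (esym E0))); apply: (etrans (esym ze)).
    have K x (x' : EP) : x = c2 y -> x' = w -> A x x' = 0 :> EG by move=> -> ->.
    by apply: K => //; rewrite c2E.
  by rewrite u0 in uv.
move=> y yI; have sI : s \in `[s, s'] by rewrite in_itv/= lexx.
by rewrite c2E// g_cst// /g /g1 /g2 cs mulVg bact1.
Qed.

End lifts.

(** * Gluing of local solutions *)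

Section gluing.
Context {R : realType}.

Lemma piecewise_bind (Q Q' : R -> R -> Prop) a b : piecewise Q a b ->
  (forall s t, s <= t -> Q s t -> piecewise Q' s t) -> piecewise Q' a b.
Proof.
move=> K H; elim: K => {a b} [a b ab Qab|a m b _ IH1 _ IH2]; first exact: H.
exact: piecewise_cat IH1 IH2.
Qed.

(* [S t x] is the compatibility condition on the value at time t. *)
Lemma piecewise_glue (T : Type) (S : R -> T -> Prop)
    (D : (R -> T) -> R -> R -> Prop) a b :
  (forall f g s t, {in `[s, t], f =1 g} -> D f s t -> D g s t) ->
  piecewise (fun s t => forall u, S s u -> exists f, [/\ f s = u, D f s t & S t (f t)]) a b ->
  forall u, S a u -> exists f, [/\ f a = u, piecewise (D f) a b & S b (f b)].
Proof.
move=> Dext; elim=> {a b} [a b ab H u /H[f [fa Df Sf]]|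
  a m b H1 IH1 H2 IH2 u /IH1[f [fa Df Sf]]].
  by exists f; split => //; exact: piecewise1.
have [g [gm Dg Sg]] := IH2 _ Sf.
have am := piecewise_le H1; have mb := piecewise_le H2.
pose k t := if t <= m then f t else g t.
have kl t : t <= m -> k t = f t by rewrite /k => ->.
have kr t : m <= t -> k t = g t.
  move=> mt; rewrite /k; case: ifPn => // tm.
  by have -> : t = m; [apply/eqP; rewrite eq_le tm mt|rewrite gm].
exists k; split; [by rewrite kl| |by rewrite kr].
apply: (@piecewise_cat _ _ _ m).
  apply: piecewise_sub Df _ => s t _ _ tm; apply: Dext => x.
  by rewrite in_itv/= => /andP[_ xt]; rewrite kl//; exact: le_trans tm.
apply: piecewise_sub Dg _ => s t ms _ _; apply: Dext => x.
by rewrite in_itv/= => /andP[sx _]; rewrite kr//; exact: le_trans sx.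
Qed.

End gluing.

Section transport.
Context {R : realType} {nG nH nP nM : nat} {G : lieGroupType 'rV[R]_nG}
  {H : lieGroupType 'rV[R]_nH} {P : manifoldType 'rV[R]_nP} {M : manifoldType 'rV[R]_nM}
  (B : principalBundle G P M) (A : connectionForm B)
  (C : forall p : P, {linear tangent p -> tangent (1%g : H)}).
Hypothesis C_smooth : smooth_form C.
Local Notation EP := 'rV[R]_nP.
Local Notation EG := 'rV[R]_nG.
Local Notation EH := 'rV[R]_nH.
Implicit Types (c : R^o -> M) (ct : R^o -> P) (h : R^o -> H) (a b s t : R).

(** The guard s < t admits one-point pieces, which trivial paths need and which have no velocity. At
    the ends of a piece the velocity is one-sided. *)
Definition lift_piece c ct s t := [/\ C1_on ct s t,
  {in `[s, t], bproj B \o ct =1 c} &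
  s < t -> forall x, x \in `[s, t] -> exists w, has_velocity ct s t x w /\ A (ct x) w = 0].

Definition sol_piece ct h s t := C1_on h s t /\
  (s < t -> forall x, x \in `[s, t] -> exists w k,
    [/\ has_velocity ct s t x w, has_velocity h s t x k &
      mcform (h x) k = - C (ct x) w :> EH]).

Definition piece c ct h s t := lift_piece c ct s t /\ sol_piece ct h s t.

Lemma lift_piece_sub c ct : itv_closed_pred (lift_piece c ct).
Proof.
move=> s t s' t' ss st tt [C1 pc Hv].
have sub x : x \in `[s', t'] -> x \in `[s, t] by rewrite !in_itv/=; lra.
split; first exact: C1_on_sub C1.
  by move=> x /sub; exact: pc.
move=> lst x xI; have [|w [wv Aw]] := Hv _ x (sub x xI); first by lra.
by exists w; split => //; exact: has_velocity_sub wv.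
Qed.

Lemma sol_piece_sub ct h : itv_closed_pred (sol_piece ct h).
Proof.
move=> s t s' t' ss st tt [C1 Hv].
have sub x : x \in `[s', t'] -> x \in `[s, t] by rewrite !in_itv/=; lra.
split; first exact: C1_on_sub C1.
move=> lst x xI; have [|w [k [wv kv E1]]] := Hv _ x (sub x xI); first by lra.
by exists w, k; split; [exact: has_velocity_sub wv|exact: has_velocity_sub kv|].
Qed.

Lemma piece_sub c ct h : itv_closed_pred (piece c ct h).
Proof.
move=> s t s' t' ss st tt [H1 H2].
by split; [exact: lift_piece_sub H1|exact: sol_piece_sub H2].
Qed.

Lemma lift_piece_ext c ct ct' s t : {in `[s, t], ct =1 ct'} ->
  lift_piece c ct s t -> lift_piece c ct' s t.
Proof.
move=> E1 [C1 pc Hv]; split; first exact: C1_on_eq C1.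
  by move=> x xI /=; rewrite -E1//; exact: pc.
move=> st x xI; have [w [wv Aw]] := Hv st x xI.
by exists w; split; [exact: has_velocity_eq wv|rewrite -E1].
Qed.

Lemma sol_piece_ext ct h ct' h' s t :
  {in `[s, t], ct =1 ct'} -> {in `[s, t], h =1 h'} ->
  sol_piece ct h s t -> sol_piece ct' h' s t.
Proof.
move=> E1 E2 [C1 Hv]; split; first exact: C1_on_eq C1.
move=> st x xI; have [w [k [wv kv E3]]] := Hv st x xI.
exists w, k; split; [exact: has_velocity_eq wv|exact: has_velocity_eq kv|].
have K p (g : H) : p = ct x -> g = h x -> mcform g k = - C p w :> EH by move=> -> ->.
by apply: K; rewrite ?E1 ?E2.
Qed.

(** Any starting point in the fibre is reached from the local lift by a right translation, which
    preserves horizontality, so the step size does not depend on it and the pieces exhaust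
    [a, b]. *)
Lemma lift_exists c a b u : piecewise (C1_on c) a b -> bproj B u = c a ->
  exists ct, ct a = u /\ piecewise (lift_piece c ct) a b.
Proof.
move=> Hc ua.
have [] := @piecewise_glue R P (fun t x => bproj B x = c t) (lift_piece c) a b
  _ _ u ua; last by move=> f [fa Df _]; exists f.
  by move=> f g s t; exact: lift_piece_ext.
apply: piecewise_bind Hc _ => {a b ua} s t st [U [c' [oU sU Uc cc']]].
apply: piecewise_local => // t0 t0I.
have Ut0 : U t0 by apply: sU; rewrite /= in_itv.
have [d [q [d0 Iq Hq]]] := local_horizontal_lift A oU Uc Ut0.
exists d => // s1 s2 ss1 s12 s2t ds1 ds2 v vs.
have sub x : x \in `[s1, s2] -> x \in `]t0 - d, t0 + d[ by rewrite !in_itv/=; lra.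
have sub' x : x \in `[s1, s2] -> x \in `[s, t] by rewrite !in_itv/=; lra.
have s1I : s1 \in `[s1, s2] by rewrite in_itv/= lexx.
have s2I : s2 \in `[s1, s2] by rewrite in_itv/= s12 lexx.
have cq x : x \in `[s1, s2] -> bproj B (q x) = c x.
  by move=> xI; have [_ -> _] := Hq x (sub x xI); rewrite cc'//; exact: sub'.
have [g gv] : exists g, v = bact B (q s1) g.
  by apply: bact_transitive; rewrite cq.
exists (fun x => bact B (q x) g); split => //; last by rewrite bproj_act; exact: cq.
have gS : smooth (fun p => bact B p g) := bact_smoothr (B := B) g.
pose I : set R^o := `]t0 - d, t0 + d[%classic.
have oI : open I by exact: itv_open.
have Iqg : Ckmap 1 I (fun x => bact B (q x) g) := Ckmap_comp_smooth oI Iq gS.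
split.
- by exists I, (fun x => bact B (q x) g); split => // x /= /sub.
- by move=> x xI /=; rewrite bproj_act; exact: cq.
move=> s12' x xI; have [_ _ Aq] := Hq x (sub x xI).
have vq := has_velocity_mdiff_curve s12' xI (Ckmap_mdiff Iq (sub x xI)).
exists (tmap (fun p => bact B p g) (q x) (tmap q x (1 : R))); split.
  exact: (has_velocity_mdiff (Ckmap_within Iq sub) (smooth_mdiff (q x) gS) vq).
apply: (etrans (cform_equiv A g (tmap q x (1 : R)))).
exact: (etrans (congr1 (Ad_inv g) Aq) (linear0 _)).
Qed.

(** The analogue in [H]: left translation by [g0] moves the local solution to the prescribed start
    and leaves h^-1 h' unchanged. *)
Lemma sol_exists c ct a b (h0 : H) : piecewise (lift_piece c ct) a b ->
  exists h, h a = h0 /\ piecewise (piece c ct h) a b.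
Proof.
move=> Hct.
have [] := @piecewise_glue R H (fun _ _ => True) (piece c ct) a b
  _ _ h0 I; last by move=> f [fa Df _]; exists f.
  move=> f g s t fg [L1 S1]; split; first exact: L1.
  exact: (sol_piece_ext (fun _ _ => erefl) fg S1).
apply: piecewise_bind Hct _ => {a b h0} s t st LP.
have [C1 _ _] := LP; have [U [c' [oU sU Uc cc']]] := C1.
(* Taken along the C^1 extension of [ct], since the local solver needs a coefficient continuous on
   an open set. *)
pose b (x : R) : EH := - C (c' x) (tmap c' x (1 : R)).
have cb x : U x -> {for x, continuous b}.
  by move=> Ux; apply: cvgN; exact: (form_continuous C_smooth oU Uc Ux).
apply: piecewise_local => // t0 t0I.
have Ut0 : U t0 by apply: sU; rewrite /= in_itv.
have [d [k [d0 Ik Hk]]] := left_invariant_ode (G := H) oU Ut0 cb.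
exists d => // s1 s2 ss1 s12 s2t ds1 ds2 h0 _.
have sub x : x \in `[s1, s2] -> x \in `]t0 - d, t0 + d[ by rewrite !in_itv/=; lra.
have sub' x : x \in `[s1, s2] -> x \in `[s, t] by rewrite !in_itv/=; lra.
pose g0 := (h0 * (k s1)^-1)%g.
pose f (x : R^o) := (g0 * k x)%g.
have oI : open (`]t0 - d, t0 + d[%classic : set R^o) by exact: itv_open.
have If : Ckmap 1 (`]t0 - d, t0 + d[%classic : set R^o) f.
  exact: (Ckmap_comp_smooth oI Ik (mulg_left_smooth g0)).
exists f; split; [by rewrite /f /g0 mulgVK| |exact: I].
split; first exact: lift_piece_sub LP.
split.
  exists (`]t0 - d, t0 + d[%classic : set R^o), f; split.
  - exact: oI.
  - by move=> x /= /sub.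
  - exact: If.
  - by [].
move=> s12' x xI; have [Ux kb] := Hk x (sub x xI).
have vk := has_velocity_mdiff_curve s12' xI (Ckmap_mdiff Ik (sub x xI)).
have [u uv ue] := lmul_velocity g0 (Ckmap_within Ik sub) vk.
have vc : has_velocity c' s1 s2 x (tmap c' x (1 : R)).
  by apply: has_velocity_mdiff_curve => //; exact: Ckmap_mdiff Uc Ux.
exists (tmap c' x (1 : R)), u; split.
- by apply: has_velocity_eq vc => y yI; rewrite cc'//; exact: sub'.
- exact: uv.
apply: (etrans ue); apply: (etrans kb).
have K p : p = c' x -> b x = - C p (tmap c' x (1 : R)) :> EH by move=> ->.
by apply: K; rewrite cc'//; exact: sub'.
Qed.

End transport.

Section velocity_interior.
Context {R : realType}.

Lemma has_velocity_interior (E : normedModType R) (M : smoothSpaceType E)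
    (c : R^o -> M) a b s t x v : a <= s -> t <= b -> x \in `]s, t[ ->
  has_velocity c s t x v -> has_velocity c a b x v.
Proof.
move=> as_ tb; rewrite in_itv/= => /andP[sx xt]; apply: has_velocity_extend => //.
  by right.
by right.
Qed.

End velocity_interior.

Section transport.
Context {R : realType} {nG nH nP nM : nat} {G : lieGroupType 'rV[R]_nG}
  {H : lieGroupType 'rV[R]_nH} {P : manifoldType 'rV[R]_nP} {M : manifoldType 'rV[R]_nM}
  (B : principalBundle G P M) (A : connectionForm B)
  (C : forall p : P, {linear tangent p -> tangent (1%g : H)}).
Local Notation EP := 'rV[R]_nP.
Local Notation EG := 'rV[R]_nG.
Local Notation EH := 'rV[R]_nH.
Implicit Types (c : R^o -> M) (ct : R^o -> P) (h : R^o -> H) (a b s t : R).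

(** A velocity on the whole interval restricts to any piece of positive length containing [t]; at a
    break point one side is enough. *)
Lemma lift_piece_horizontal c ct a b : piecewise (lift_piece A c ct) a b ->
  forall t v, has_velocity ct a b t v -> A (ct t) v = 0.
Proof.
elim=> {a b} [a b ab [_ _ Hv] t v tv|a m b H1 IH1 H2 IH2 t v tv].
  have [lab tI _] := tv; have [w [wv Aw]] := Hv lab t tI.
  by rewrite (has_velocity_unique tv wv).
have am := piecewise_le H1; have mb := piecewise_le H2.
have [lab tI _] := tv; move: tI; rewrite in_itv/= => /andP[at_ tb].
have [am'|ma] := ltP a m; have [tm|mt] := leP t m.
- by apply: IH1; apply: has_velocity_sub tv => //; rewrite in_itv/= at_.
- apply: IH2; apply: has_velocity_sub tv => //; first exact: lt_le_trans tb.
  by rewrite in_itv/= (ltW mt).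
- have ? : t = m by lra.
  by apply: IH2; apply: has_velocity_sub tv => //; [lra|rewrite in_itv/=; lra].
- apply: IH2; apply: has_velocity_sub tv => //; first exact: lt_le_trans tb.
  by rewrite in_itv/= (ltW mt).
Qed.

Lemma lift_unique ct1 ct2 a b :
  piecewise (C1_on ct1) a b -> piecewise (C1_on ct2) a b ->
  (forall t v, has_velocity ct1 a b t v -> A (ct1 t) v = 0) ->
  (forall t v, has_velocity ct2 a b t v -> A (ct2 t) v = 0) ->
  {in `[a, b], bproj B \o ct1 =1 bproj B \o ct2} ->
  ct1 a = ct2 a -> {in `[a, b], ct1 =1 ct2}.
Proof.
move=> P1 P2 H1 H2 pc; apply: piecewise_eq.
apply: piecewise_sub (piecewise_and (@C1_on_sub _ _ _ ct1) (@C1_on_sub _ _ _ ct2) P1 P2) _.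
move=> s t as_ st tb [C1 C2] cs.
have sub x : x \in `[s, t] -> x \in `[a, b] by rewrite !in_itv/=; lra.
apply: (horizontal_lift_unique (A := A) st (C1_on_continuous C1) (C1_on_continuous C2) _ _ cs).
  by move=> x /sub; exact: pc.
move=> x xst.
have lst : s < t by move: xst; rewrite in_itv/=; lra.
have xI : x \in `[s, t] by exact: subset_itv_oo_cc xst.
have [_ [d1 [_ _ _ _ /(_ x xI) v1]]] := C1_on_velocity C1 lst.
have [_ [d2 [_ _ _ _ /(_ x xI) v2]]] := C1_on_velocity C2 lst.
exists (tmap d1 x (1 : R)), (tmap d2 x (1 : R)); split.
- exact: v1.
- exact: v2.
- exact: H1 (has_velocity_interior as_ tb xst v1).
- exact: H2 (has_velocity_interior as_ tb xst v2).
Qed.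

(** The difficult case is a break point at which [c] has a two-sided velocity. The one-sided
    velocities of [ct] are horizontal with the same projection, so they agree by
    [vertical_horizontal]; those of [h] then have equal Maurer-Cartan images and agree too, and the
    two halves glue. *)
Lemma piece_hsol c ct h a b : piecewise (piece A C c ct h) a b ->
  forall t v, has_velocity c a b t v -> exists w k,
    [/\ has_velocity ct a b t w, has_velocity h a b t k, A (ct t) w = 0 &
      mcform (h t) k = - C (ct t) w :> EH].
Proof.
have bprojS : smooth (bproj B) := @bproj_smooth _ _ _ _ _ _ _ B.
elim=> {a b} [a b ab [[_ _ Hv] [_ Hs]] t v [lab tI _]|a m b H1 IH1 H2 IH2 t v tv].
  have [w [wv Aw]] := Hv lab t tI; have [w' [k [wv' kv Ek]]] := Hs lab t tI.
  exists w', k; split; [exact: wv'|exact: kv| |exact: Ek].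
  by rewrite (has_velocity_unique wv' wv).
have am := piecewise_le H1; have mb := piecewise_le H2.
have [lab tI _] := tv; move: tI; rewrite in_itv/= => /andP[at_ tb].
have left : a < m -> t <= m -> exists w k,
    [/\ has_velocity ct a m t w, has_velocity h a m t k, A (ct t) w = 0 &
      mcform (h t) k = - C (ct t) w :> EH].
  move=> am' tm; apply: (IH1 t v).
  by apply: has_velocity_sub tv => //; rewrite in_itv/= at_.
have right : m < b -> m <= t -> exists w k,
    [/\ has_velocity ct m b t w, has_velocity h m b t k, A (ct t) w = 0 &
      mcform (h t) k = - C (ct t) w :> EH].
  move=> mb' mt; apply: (IH2 t v).
  by apply: has_velocity_sub tv => //; rewrite in_itv/= mt.
have [tm|mt|tm] := ltgtP t m.
- have [w [k [wv kv Aw Ek]]] := left (le_lt_trans at_ tm) (ltW tm).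
  exists w, k; split; [| |exact: Aw|exact: Ek].
    by apply: has_velocity_extend wv => //; [left|right].
  by apply: has_velocity_extend kv => //; [left|right].
- have [w [k [wv kv Aw Ek]]] := right (lt_le_trans mt tb) (ltW mt).
  exists w, k; split; [| |exact: Aw|exact: Ek].
    by apply: has_velocity_extend wv => //; [right|left].
  by apply: has_velocity_extend kv => //; [right|left].
have tm_le : t <= m by rewrite tm.
have mt_le : m <= t by rewrite tm.
(* If one of the two pieces is a single point, the other is the whole interval and nothing has to be
   glued. *)
have [am'|ma] := ltP a m; last first.
  have ma' : m = a by apply/eqP; rewrite eq_le ma am.
  have mb' : m < b by rewrite ma'.
  have [w [k [wv kv Aw Ek]]] := right mb' mt_le.
  by rewrite ma' in wv kv; exists w, k.
have [mb'|bm] := ltP m b; last first.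
  have mb' : m = b by apply/eqP; rewrite eq_le mb bm.
  have [w [k [wv kv Aw Ek]]] := left am' tm_le.
  by rewrite mb' in wv kv; exists w, k.
have [w [k [wv kv Aw Ek]]] := left am' tm_le.
have [w' [k' [wv' kv' Aw' Ek']]] := right mb' mt_le.
have H12 := piecewise_cat H1 H2.
have pc : {in `[a, b], bproj B \o ct =1 c}.
  apply: piecewise_eq.
    by apply: piecewise_sub H12 _ => s s' _ _ _ [[_ + _] _] _.
  have : piecewise (fun s t => (bproj B \o ct) s = c s) a m.
    by apply: piecewise_sub H1 _ => s s' _ ss _ [[_ pc _] _]; apply: pc; rewrite in_itv/= lexx.
  by elim=> //.
have ww' : w = w'.
  apply/eqP; rewrite -subr_eq0; apply/eqP.
  have piw x y z : a <= x -> x < y -> y <= b -> t \in `[x, y] -> has_velocity ct x y t z ->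
      {within `[x, y], continuous ct} ->
      tmap (bproj B) (ct t) z = v :> 'rV[R]_nM.
    move=> ax xy yb txy zv cct.
    have pv := has_velocity_mdiff cct (smooth_mdiff (ct t) bprojS) zv.
    have pv' : has_velocity c x y t (tmap (bproj B) (ct t) z).
      apply: has_velocity_eq pv => s; rewrite in_itv/= => /andP[xs sy].
      apply: pc; rewrite in_itv/=; apply/andP; split.
        exact: le_trans xs.
      exact: le_trans yb.
    exact: (has_velocity_unique pv' (has_velocity_sub ax yb xy txy tv)).
  have C1 : piecewise (C1_on ct) a m.
    by apply: piecewise_sub H1 _ => s s' _ _ _ [[]].
  have C2 : piecewise (C1_on ct) m b.
    by apply: piecewise_sub H2 _ => s s' _ _ _ [[]].
  have tI1 : t \in `[a, m] by rewrite in_itv/= at_ tm lexx.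
  have tI2 : t \in `[m, b] by rewrite in_itv/= tb tm lexx.
  have p1 := piw a m w (lexx _) am' mb tI1 wv (piecewise_continuous C1).
  have p2 := piw m b w' am mb' (lexx _) tI2 wv' (piecewise_continuous C2).
  apply: (@vertical_horizontal _ _ _ _ _ _ _ B A (ct t)).
    apply: (etrans (linearB _ _ _)); apply/eqP; rewrite subr_eq0; apply/eqP.
    exact: etrans p1 (esym p2).
  apply: (etrans (linearB _ _ _)); apply/eqP; rewrite subr_eq0; apply/eqP.
  exact: etrans Aw (esym Aw').
have kk' : k = k'.
  apply/eqP; rewrite -subr_eq0; apply/eqP; apply: (@mcform_inj _ _ _ (h t)).
  apply: (etrans (linearB _ _ _)); apply/eqP; rewrite subr_eq0; apply/eqP.
  by apply: (etrans Ek); rewrite ww'; exact: (esym Ek').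
exists w, k; split; [| |exact: Aw|exact: Ek].
  move: wv wv'; rewrite -ww' tm => wv wv'; exact: has_velocity_glue wv wv'.
move: kv kv'; rewrite -kk' tm => kv kv'; exact: has_velocity_glue kv kv'.
Qed.

(** The equation is assumed only where [c] has a velocity, so [c], [h1] and [h2] are refined
    together: inside a common C^1 piece that velocity exists. *)
Lemma hsol_unique c ct h1 h2 a b : piecewise (C1_on c) a b ->
  piecewise (C1_on h1) a b -> piecewise (C1_on h2) a b ->
  (forall t, (exists v, has_velocity c a b t v) -> exists w k,
    [/\ has_velocity ct a b t w, has_velocity h1 a b t k &
      mcform (h1 t) k = - C (ct t) w :> EH]) ->
  (forall t, (exists v, has_velocity c a b t v) -> exists w k,
    [/\ has_velocity ct a b t w, has_velocity h2 a b t k &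
      mcform (h2 t) k = - C (ct t) w :> EH]) ->
  h1 a = h2 a -> {in `[a, b], h1 =1 h2}.
Proof.
move=> Pc P1 P2 H1 H2; apply: piecewise_eq.
have P12 := piecewise_and (@C1_on_sub _ _ _ h1) (@C1_on_sub _ _ _ h2) P1 P2.
have sub12 : itv_closed_pred (fun s t => C1_on h1 s t /\ C1_on h2 s t).
  move=> s t s' t' ss st tt [? ?]; split.
    exact: (C1_on_sub ss st tt).
  exact: (C1_on_sub ss st tt).
apply: piecewise_sub (piecewise_and (@C1_on_sub _ _ _ c) sub12 Pc P12) _.
move=> s t as_ st tb [Cc [C1 C2]] hs.
have sub x : x \in `[s, t] -> x \in `[a, b] by rewrite !in_itv/=; lra.
move=> x xI; apply: (mcform_unique st (C1_on_continuous C1) (C1_on_continuous C2) _ hs xI).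
move=> {xI}x xst.
have lst : s < t by move: xst; rewrite in_itv/=; lra.
have xI : x \in `[s, t] by exact: subset_itv_oo_cc xst.
have [_ [d [_ _ _ _ /(_ x xI) vc]]] := C1_on_velocity Cc lst.
have ex : exists v, has_velocity c a b x v.
  by exists (tmap d x (1 : R)); exact: has_velocity_interior as_ tb xst vc.
have [w [k [wv kv E1]]] := H1 x ex; have [w' [k' [wv' kv' E2]]] := H2 x ex.
exists k, k'; split.
- exact: has_velocity_sub as_ tb lst xI kv.
- exact: has_velocity_sub as_ tb lst xI kv'.
- by apply: (etrans E1); rewrite (has_velocity_unique wv wv'); exact: (esym E2).
Qed.

(** No direction is imposed on [phi], so this serves reparametrizations, shifts and reversals: both
    sides of each equation are multiplied by its derivative. *)
Lemma piece_comp c ct h (phi : R^o -> R^o) s t s' t' :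
  piece A C c ct h s t -> C1_on phi s' t' ->
  (forall x, x \in `[s', t'] -> phi x \in `[s, t]) -> (s' < t' -> s < t) ->
  piece A C (c \o phi) (ct \o phi) (h \o phi) s' t'.
Proof.
move=> [[Cct pc Hv] [Ch Hs]] Cphi sub lt; split; split.
- exact: C1_on_comp Cphi Cct sub.
- by move=> x xI /=; exact: pc (sub x xI).
- move=> lst x xI; have [w [wv Aw]] := Hv (lt lst) (phi x) (sub x xI).
  have [_ [psi [_ _ _ _ /(_ x xI) rv]]] := C1_on_velocity Cphi lst.
  exists (tmap psi x (1 : R) *: w : EP); split.
    exact: (has_velocity_comp Cct (lt lst) Cphi sub rv wv).
  apply: (etrans (linearZZ (A _) _ _)).
  exact: (etrans (congr1 (fun x => _ *: x) Aw) (scaler0 _ _)).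
- exact: C1_on_comp Cphi Ch sub.
- move=> lst x xI; have [w [k [wv kv Ek]]] := Hs (lt lst) (phi x) (sub x xI).
  have [_ [psi [_ _ _ _ /(_ x xI) rv]]] := C1_on_velocity Cphi lst.
  exists (tmap psi x (1 : R) *: w : EP), (tmap psi x (1 : R) *: k : EH); split.
  + exact: (has_velocity_comp Cct (lt lst) Cphi sub rv wv).
  + exact: (has_velocity_comp Ch (lt lst) Cphi sub rv kv).
  apply: (etrans (linearZZ (mcform _) _ _)); apply: (etrans (congr1 (fun x => _ *: x) Ek)).
  apply: (etrans (scalerN _ _)); congr (- _).
  exact: (esym (linearZZ (C _) _ _)).
Qed.

Lemma piece_lmul c ct h (g : H) s t :
  piece A C c ct h s t -> piece A C c ct (fun x => g * h x)%g s t.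
Proof.
move=> [L1 [Ch Hs]]; split; first exact: L1.
split; first exact: C1_on_map (mulg_left_smooth g) Ch.
move=> lst x xI; have [w [k [wv kv Ek]]] := Hs lst x xI.
have [u uv ue] := lmul_velocity g (C1_on_continuous Ch) kv.
exists w, u; split; [exact: wv|exact: uv|exact: etrans ue Ek].
Qed.

Lemma piece_ext c ct h c' ct' h' s t : {in `[s, t], c =1 c'} ->
  {in `[s, t], ct =1 ct'} -> {in `[s, t], h =1 h'} ->
  piece A C c ct h s t -> piece A C c' ct' h' s t.
Proof.
move=> E0 E1 E2 [L1 S1]; split; last exact: sol_piece_ext E1 E2 S1.
have [C1 pc Hv] := lift_piece_ext E1 L1.
by split; [exact: C1|move=> x xI; rewrite -E0//; exact: pc|exact: Hv].
Qed.

End transport.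

(** * Decorated lifts *)

Section transport.
Context {R : realType} {nG nH nP nM : nat} {G : lieGroupType 'rV[R]_nG}
  {H : lieGroupType 'rV[R]_nH} {P : manifoldType 'rV[R]_nP} {M : manifoldType 'rV[R]_nM}
  (X : lieCrossedModule G H) (B : principalBundle G P M) (A : connectionForm B)
  (C : forall p : P, {linear tangent p -> tangent (1%g : H)}).
Hypothesis C_smooth : smooth_form C.
Hypothesis C_equiv : forall (p : P) (g : G) (v : tangent p),
  C (bact B p g) (tmap (fun q => bact B q g) p v) =
  tmap (xalpha X g^-1%g) 1%g (C p v).
Local Notation EP := 'rV[R]_nP.
Local Notation EH := 'rV[R]_nH.
Local Notation piece := (piece A C).
Implicit Types (c : pc1path M) (ct : pc1path P) (h : R^o -> H).

Definition decorated_lift c (u : P) ct h := [/\ pstart ct = pstart c, pstop ct = pstop c,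
  pinit ct = u, h (pstart c) = 1%g & piecewise (piece c ct h) (pstart c) (pstop c)].

(** Of the solution only the final value is kept, which is all that survives the passage to
    backtrack classes. *)
Definition lifts_to c u ct (g : H) := exists h, decorated_lift c u ct h /\ h (pstop c) = g.

Lemma dlift_lift c u ct h : decorated_lift c u ct h ->
  piecewise (lift_piece A c ct) (pstart ct) (pstop ct).
Proof.
by move=> [-> -> _ _ K]; apply: piecewise_sub K _ => s t _ _ _ [].
Qed.

Lemma dlift_horizontal c u ct h : decorated_lift c u ct h -> horizontal A ct.
Proof.
by move=> K t v; exact: (lift_piece_horizontal (dlift_lift K)).
Qed.

Lemma lift_piece_proj (c : R^o -> M) (ct : R^o -> P) a b :
  piecewise (lift_piece A c ct) a b -> {in `[a, b], bproj B \o ct =1 c}.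
Proof.
elim=> {a b} [a b ab [_ pc _]|a m b H1 IH1 H2 IH2 x]; first exact: pc.
rewrite in_itv/= => /andP[ax xb]; have [xm|/ltW mx] := leP x m.
  by apply: IH1; rewrite in_itv/= ax.
by apply: IH2; rewrite in_itv/= mx.
Qed.

Lemma dlift_proj c u ct h : decorated_lift c u ct h ->
  {in `[pstart c, pstop c], bproj B \o ct =1 c}.
Proof.
by move=> K; have := lift_piece_proj (dlift_lift K); case: K => -> -> _ _ _.
Qed.

Lemma dlift_init c u ct h : decorated_lift c u ct h -> bproj B u = pinit c.
Proof.
move=> K; have pc := dlift_proj K; case: K => e1 _ <- _ _.
by rewrite /pinit e1; apply: pc; rewrite in_itv/= lexx pc1path_le.
Qed.

Lemma dlift_final c u ct h : decorated_lift c u ct h -> bproj B (pfinal ct) = pfinal c.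
Proof.
move=> K; have pc := dlift_proj K; case: K => _ e2 _ _ _.
by rewrite /pfinal e2; apply: pc; rewrite in_itv/= lexx pc1path_le.
Qed.

Lemma dlift_solC1 c u ct h : decorated_lift c u ct h ->
  piecewise (C1_on h) (pstart c) (pstop c).
Proof. by move=> [_ _ _ _ K]; apply: piecewise_sub K _ => s t _ _ _ [_ []]. Qed.

Lemma dlift_exists c u : bproj B u = pinit c -> exists ct h, decorated_lift c u ct h.
Proof.
move=> uc; have [f [fa Pf]] := lift_exists A (ppiecewise c) uc.
have [h [ha Ph]] := sol_exists C_smooth (1%g : H) Pf.
have Cf : piecewise (C1_on f) (pstart c) (pstop c).
  by apply: piecewise_sub Pf _ => s t _ _ _ [].
by exists (mkpath Cf), h; split.
Qed.

Lemma dlift_hsol c u ct h : decorated_lift c u ct h ->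
  forall t v, velocity c t v -> exists w k,
    [/\ velocity ct t w, has_velocity h (pstart c) (pstop c) t k &
      mcform (h t) k = - C (ct t) w :> EH].
Proof.
move=> [e1 e2 _ _ K] t v tv; have [w [k [wv kv _ Ek]]] := piece_hsol K tv.
by exists w, k; split => //; rewrite /velocity e1 e2.
Qed.

Lemma dlift_lift_unique c u ct h ct' : decorated_lift c u ct h ->
  pstart ct' = pstart c -> pstop ct' = pstop c -> pinit ct' = u ->
  {in `[pstart c, pstop c], bproj B \o ct' =1 c} -> horizontal A ct' ->
  {in `[pstart c, pstop c], ct' =1 ct}.
Proof.
move=> K e1 e2 iu pc' H'; have [e1' e2' iu' _ _] := K.
have Cc := ppiecewise ct; have Cc' := ppiecewise ct'.
rewrite e1 e2 in Cc'; rewrite e1' e2' in Cc.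
apply: (lift_unique (A := A) Cc' Cc).
- by move=> t v tv; apply: H'; rewrite /velocity e1 e2.
- by move=> t v tv; apply: (dlift_horizontal K); rewrite /velocity e1' e2'.
- by move=> t tI; rewrite pc'// (dlift_proj K).
- by rewrite -e1 -/(pinit ct') iu -iu' /pinit e1' e1.
Qed.

Lemma dlift_unique c u ct h ct' h' : decorated_lift c u ct h -> decorated_lift c u ct' h' ->
  {in `[pstart c, pstop c], ct =1 ct'} /\ {in `[pstart c, pstop c], h =1 h'}.
Proof.
move=> K K'; have [e1 e2 iu h1 Ph] := K; have [e1' e2' iu' h1' Ph'] := K'.
have E1 : {in `[pstart c, pstop c], ct =1 ct'}.
  exact: (dlift_lift_unique K' e1 e2 iu (dlift_proj K) (dlift_horizontal K)).
split => //.
have Ph2 : piecewise (piece c ct h') (pstart c) (pstop c).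
  apply: piecewise_sub Ph' _ => s t as_ st tb; apply: piece_ext => // x xI.
  by rewrite E1//; move: xI; rewrite !in_itv/=; lra.
apply: (hsol_unique (C := C) (ct := ct) (ppiecewise c) (dlift_solC1 K) (dlift_solC1 K')).
- by move=> t [v tv]; have [w [k [wv kv _ Ek]]] := piece_hsol Ph tv; exists w, k.
- by move=> t [v tv]; have [w [k [wv kv _ Ek]]] := piece_hsol Ph2 tv; exists w, k.
- by rewrite h1 h1'.
Qed.

Lemma lifts_to_exists c u : bproj B u = pinit c -> exists ct g, lifts_to c u ct g.
Proof. by move=> /dlift_exists[ct [h K]]; exists ct, (h (pstop c)), h. Qed.

Lemma lifts_to_unique c u ct g ct' g' : lifts_to c u ct g -> lifts_to c u ct' g' ->
  reparam ct ct' /\ g = g'.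
Proof.
move=> [h [K <-]] [h' [K' <-]]; have [E1 E2] := dlift_unique K K'.
have [e1 e2 _ _ _] := K; have [e1' e2' _ _ _] := K'.
split; last by apply: E2; rewrite in_itv/= lexx pc1path_le.
by apply: reparam_eq; rewrite ?e1 ?e2.
Qed.

Lemma lifts_to_init c u ct g : lifts_to c u ct g -> bproj B u = pinit c.
Proof. by move=> [h [K _]]; exact: dlift_init K. Qed.

Lemma lifts_to_final c u ct g : lifts_to c u ct g -> bproj B (pfinal ct) = pfinal c.
Proof. by move=> [h [K _]]; exact: dlift_final K. Qed.

Lemma lifts_to_start c u ct g : lifts_to c u ct g -> pinit ct = u.
Proof. by move=> [h [[]]]. Qed.

Lemma lifts_to_horizontal c u ct g : lifts_to c u ct g -> horizontal A ct.
Proof. by move=> [h [K _]]; exact: dlift_horizontal K. Qed.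

(** Makes the results on lifts available for arbitrary horizontal paths: the lift of the projection
    is constructed and identified with [ct] by uniqueness. *)
Lemma lifts_to_of_horizontal ct : horizontal A ct ->
  exists g, lifts_to (path_map (@bproj_smooth _ _ _ _ _ _ _ B) ct) (pinit ct) ct g.
Proof.
move=> Hct; set c := path_map _ ct.
have [ct' [h K]] : exists ct' h, decorated_lift c (pinit ct) ct' h by exact: dlift_exists.
have E1 : {in `[pstart c, pstop c], ct =1 ct'}.
  exact: (dlift_lift_unique K).
have [e1 e2 iu h1 Ph] := K.
exists (h (pstop c)), h; split => //; split => //.
apply: piecewise_sub Ph _ => s t as_ st tb; apply: piece_ext => // x xI.
by rewrite E1//; move: xI; rewrite !in_itv/=; lra.
Qed.

Lemma lifts_to_reparam c1 c2 u ct1 g : reparam c1 c2 -> lifts_to c1 u ct1 g ->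
  exists ct2, lifts_to c2 u ct2 g /\ reparam ct1 ct2.
Proof.
move=> /reparamP[phi [Pphi Iphi c2E]] [h [[e1 e2 iu h1 Ph] <-]].
have le1 := pc1path_le c1; have le2 := pc1path_le c2.
have [Ea Eb] := increasing_onto_ends le2 le1 Iphi.
(* The bounds are recorded because [phi] is monotone only on the domain of [c2], and monotonicity is
   what makes [Q] pass to subintervals. *)
pose Q s t := [/\ pstart c2 <= s, t <= pstop c2 & piece c1 ct1 h (phi s) (phi t)].
have mon := increasing_onto_le Iphi.
have PQ : piecewise Q (pstart c2) (pstop c2).
  have := piecewise_pullback le2 Iphi Ph => PQ.
  by apply: piecewise_sub PQ _ => s t ? ? ? ?; split.
have Qclosed : itv_closed_pred Q.
  move=> s t s' t' ss st tt [as_ tb Pst].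
  have I x : s <= x -> x <= t -> x \in `[pstart c2, pstop c2].
    by move=> ? ?; rewrite in_itv/=; lra.
  split; [lra|lra|].
  have m1 : phi s <= phi s' by apply: mon; rewrite ?I//; lra.
  have m2 : phi s' <= phi t' by apply: mon; rewrite ?I//; lra.
  have m3 : phi t' <= phi t by apply: mon; rewrite ?I//; lra.
  exact: (@piece_sub _ _ _ _ _ _ _ _ _ _ A C c1 ct1 h _ _ _ _ m1 m2 m3 Pst).
have P2 : piecewise (piece c2 (ct1 \o phi) (h \o phi)) (pstart c2) (pstop c2).
  apply: piecewise_sub (piecewise_and (@C1_on_sub _ _ _ phi) Qclosed Pphi PQ) _.
  move=> s t as_ st tb [Cphi [_ _ Pst]].
  have I x : x \in `[s, t] -> x \in `[pstart c2, pstop c2].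
    by rewrite !in_itv/=; lra.
  have sI : s \in `[s, t] by rewrite in_itv/= lexx.
  have tI : t \in `[s, t] by rewrite in_itv/= st lexx.
  have sub x : x \in `[s, t] -> phi x \in `[phi s, phi t].
    move=> xI; have := xI; rewrite !in_itv/= => /andP[sx xt].
    by rewrite (mon _ _ (I _ sI) (I _ xI) sx) (mon _ _ (I _ xI) (I _ tI) xt).
  have lt : s < t -> phi s < phi t by move=> lst; exact: (Iphi.1 _ _ (I _ sI) (I _ tI) lst).
  have := piece_comp Pst Cphi sub lt; apply: piece_ext => // x xI /=.
  by rewrite c2E//; exact: I.
have Cf : piecewise (C1_on (ct1 \o phi)) (pstart c2) (pstop c2).
  by apply: piecewise_sub P2 _ => s t _ _ _ [[]].
exists (mkpath Cf); split.
  exists (h \o phi); split; last by rewrite /= Eb.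
  split => //; last by rewrite /= Ea.
  by rewrite /pinit /= Ea -e1.
by apply/reparamP; exists phi; rewrite e1 e2.
Qed.

Lemma lifts_to_cst (m : M) u : bproj B u = m -> lifts_to (path_cst m) u (path_cst u) 1%g.
Proof.
move=> um; exists (fun=> 1%g); split => //; split => //.
apply: piecewise1 => //=.
have Ccst (F : normedModType R) (N : smoothSpaceType F) (y : N) (s t : R) :
    C1_on (cst y : R^o -> N) s t.
  by exists setT, (cst y); split => //; [exact: openT|exact: Ckmap_cst].
split; split; try exact: Ccst.
- by move=> x _ /=.
- by rewrite ltxx.
- by rewrite ltxx.
Qed.

(** Past the first path the solution is the final value of [h1] times [h2]; it is continuous at the
    junction since [h2] starts at 1, and left multiplication preserves the equation. *)
Lemma lifts_to_cat c1 c2 u ct1 ct2 g1 g2 : pfinal c1 = pinit c2 ->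
  lifts_to c1 u ct1 g1 -> lifts_to c2 (pfinal ct1) ct2 g2 ->
  lifts_to (path_cat c1 c2) u (path_cat ct1 ct2) (g1 * g2)%g.
Proof.
move=> c12 [h1 [[e1 e1' i1 h11 P1] <-]] [h2 [[e2 e2' i2 h21 P2] <-]].
have ct12 : pfinal ct1 = pinit ct2 by rewrite i2.
have le1 := pc1path_le c1; have le2 := pc1path_le c2.
pose h t := if t <= pstop c1 then h1 t else (h1 (pstop c1) * h2 (pstart c2 - pstop c1 + t))%g.
have hl t : t <= pstop c1 -> h t = h1 t by rewrite /h => ->.
have hr t : pstop c1 <= t -> h t = (h1 (pstop c1) * h2 (pstart c2 - pstop c1 + t))%g.
  move=> mt; rewrite /h; case: ifPn => // tm.
  have -> : t = pstop c1 by apply/eqP; rewrite eq_le tm mt.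
  by rewrite subrK h21 mulg1.
exists h; split; last first.
  rewrite path_cat_stop// hr; last by lra.
  by congr (_ * h2 _)%g; lra.
split.
- by rewrite !path_cat_start.
- by rewrite !path_cat_stop// e1' e2 e2'.
- by rewrite path_cat_init.
- by rewrite path_cat_start hl.
rewrite path_cat_start path_cat_stop//; apply: (@piecewise_cat _ _ _ (pstop c1)).
  apply: piecewise_sub P1 _ => s t as_ st tb; apply: piece_ext => x.
  - by rewrite in_itv/= => ?; rewrite path_catEl//; lra.
  - by rewrite in_itv/= => ?; rewrite path_catEl// e1'; lra.
  - by rewrite in_itv/= => ?; rewrite hl//; lra.
have := @piecewise_shift R (piece c2 ct2 h2)
  (piece (path_cat c1 c2) (path_cat ct1 ct2) h) (pstop c1 - pstart c2) _ _ P2.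
rewrite subrK; apply => s t as_ st tb Pst.
pose phi (x : R^o) : R^o := pstart c2 - pstop c1 + x.
have sub x : x \in `[pstop c1 - pstart c2 + s, pstop c1 - pstart c2 + t] ->
    phi x \in `[s, t] by rewrite /phi !in_itv/=; lra.
have Cphi := C1_on_shift (pstart c2 - pstop c1)
  (pstop c1 - pstart c2 + s) (pstop c1 - pstart c2 + t).
have := piece_lmul (h1 (pstop c1)) (piece_comp Pst Cphi sub _).
move=> /(_ _) K; apply: piece_ext (K _); last by lra.
- by move=> x; rewrite in_itv/= => ?; rewrite path_catEr//; lra.
- by move=> x; rewrite in_itv/= => ?; rewrite path_catEr// e1' ?e2//; lra.
- by move=> x; rewrite in_itv/= => ?; rewrite hr//; lra.
Qed.

(** The reversed solution is made to start at 1 by left multiplication with the inverse of the old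
    final value, so it ends at that inverse. *)
Lemma lifts_to_rev c u ct g : lifts_to c u ct g ->
  lifts_to (path_rev c) (pfinal ct) (path_rev ct) g^-1%g.
Proof.
move=> [h [[e1 e2 iu h1 Ph] <-]].
have le := pc1path_le c.
exists (fun t => (h (pstop c))^-1 * h (pstart c + pstop c - t))%g.
split; last by rewrite /= addrK h1 mulg1.
split; [exact: e1|exact: e2|exact: path_rev_init| | ].
  by rewrite /= (addrC (pstart c)) addrK mulVg.
have := @piecewise_rev R (piece c ct h)
  (piece (path_rev c) (path_rev ct)
    (fun t => (h (pstop c))^-1 * h (pstart c + pstop c - t))%g) (pstart c + pstop c) _ _ Ph.
rewrite addrK (addrC (pstart c)) addrK; apply => s t as_ st tb Pst.
pose phi (x : R^o) : R^o := pstop c + pstart c - x.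
have phiE x : phi x = pstart c + pstop c - x by rewrite /phi (addrC (pstop c)).
have sub x : x \in `[pstop c + pstart c - t, pstop c + pstart c - s] ->
    phi x \in `[s, t] by rewrite /phi !in_itv/=; lra.
have Cphi : C1_on phi (pstop c + pstart c - t) (pstop c + pstart c - s).
  exists setT, (fun x => (pstop c + pstart c) + (-1) * x); split => //.
  - exact: openT.
  - exact: Ckmap_affine.
  - by move=> x _; rewrite mulN1r.
have := piece_lmul (h (pstop c))^-1%g (piece_comp Pst Cphi sub _).
move=> /(_ _) K; apply: piece_ext (K _); last by lra.
- by move=> x _; rewrite [LHS]/= phiE /= /path_rev_fun.
- by move=> x _; rewrite [LHS]/= phiE /= /path_rev_fun e1 e2.
- by move=> x _; congr (_ * h _)%g; exact: phiE.
Qed.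

Lemma xalpha_left_smooth (x : G) : smooth (xalpha X x).
Proof.
apply: (@smooth_op R _ _ _ _ G H H H (xalpha X) (fun=> x) id).
- exact: xalpha_smooth.
- exact: smooth_cst.
- exact: smooth_id.
Qed.

(** alpha(x^-1) is a homomorphism, so it carries a solution to a solution whose coefficient is
    transformed by its derivative at 1; by equivariance of C this is the coefficient along the
    translated lift. *)
Lemma lifts_to_act c u ct g (x : G) : lifts_to c u ct g ->
  lifts_to c (bact B u x) (path_act (B := B) ct x) (xalpha X x^-1%g g).
Proof.
move=> [h [[e1 e2 iu h1 Ph] <-]].
pose al := xalpha X x^-1%g.
have alS : smooth al := xalpha_left_smooth x^-1%g.
have alM : {morph al : y z / (y * z)%g} := xalphaM X x^-1%g.
have gS : smooth (fun p => bact B p x) := bact_smoothr (B := B) x.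
exists (al \o h); split => //; split => //.
- by rewrite -iu.
- by rewrite /= h1; apply: (mulgI (al 1%g)); rewrite -alM !mulg1.
apply: piecewise_sub Ph _ => s t as_ st tb [[Cct pc Hv] [Ch Hs]].
split; split.
- exact: C1_on_map gS Cct.
- by move=> y yI /=; rewrite bproj_act; exact: pc.
- move=> lst y yI; have [w [wv Aw]] := Hv lst y yI.
  exists (tmap (fun p => bact B p x) (ct y) w); split.
    exact: (has_velocity_mdiff (C1_on_continuous Cct) (smooth_mdiff (ct y) gS) wv).
  apply: (etrans (cform_equiv A x w)).
  exact: (etrans (congr1 (Ad_inv x) Aw) (linear0 _)).
- exact: C1_on_map alS Ch.
- move=> lst y yI; have [w [k [wv kv Ek]]] := Hs lst y yI.
  exists (tmap (fun p => bact B p x) (ct y) w), (tmap al (h y) k); split.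
  + exact: (has_velocity_mdiff (C1_on_continuous Cct) (smooth_mdiff (ct y) gS) wv).
  + exact: (has_velocity_mdiff (C1_on_continuous Ch) (smooth_mdiff (h y) alS) kv).
  apply: (etrans (mcform_morph (h y) k alS alM)).
  apply: (etrans (congr1 (tmap al 1%g) Ek)).
  apply: (etrans (linearN _ _)); congr (- _).
  exact: (esym (C_equiv x w)).
Qed.

(** Equal initial points are part of the relation to make it transitive: a lift of the middle path
    through the same [u] must exist. *)
Definition lift_invariant c1 c2 := pinit c1 = pinit c2 /\
  forall u ct1 g1 ct2 g2, lifts_to c1 u ct1 g1 -> lifts_to c2 u ct2 g2 ->
    bt_equiv ct1 ct2 /\ g1 = g2.

Lemma lift_invariant_of c1 c2 : pinit c1 = pinit c2 ->
  (forall u, bproj B u = pinit c1 -> exists ct1 ct2 g,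
    [/\ lifts_to c1 u ct1 g, lifts_to c2 u ct2 g & bt_equiv ct1 ct2]) ->
  lift_invariant c1 c2.
Proof.
move=> c12 K; split => // u ct1 g1 ct2 g2 T1 T2.
have [d1 [d2 [g [T1' T2' d12]]]] := K u (lifts_to_init T1).
have [r1 ->] := lifts_to_unique T1 T1'; have [r2 <-] := lifts_to_unique T2' T2.
split => //; apply: rst_trans (reparam_bt r1) _.
exact: rst_trans d12 (reparam_bt r2).
Qed.

Lemma lift_invariant_rst (r : pc1path M -> pc1path M -> Prop) c1 c2 :
  (forall c1 c2, r c1 c2 -> lift_invariant c1 c2) ->
  clos_refl_sym_trans _ r c1 c2 -> lift_invariant c1 c2.
Proof.
move=> K; elim=> {c1 c2} [c1 c2 /K//|c|c1 c2 _ [E1 IH]|c1 c2 c3 _ [E1 IH1] _ [E2 IH2]].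
- apply: lift_invariant_of => // u /lifts_to_exists[ct [g T]].
  by exists ct, ct, g; split => //; exact: rst_refl.
- split; first by rewrite E1.
  move=> u ct1 g1 ct2 g2 T1 T2; have [b ->] := IH _ _ _ _ _ T2 T1.
  by split => //; exact: rst_sym.
- split; first by rewrite E1.
  move=> u ct1 g1 ct3 g3 T1 T3.
  have [|ct2 [g2 T2]] := @lifts_to_exists c2 u; first by rewrite -E1; exact: lifts_to_init T1.
  have [b1 ->] := IH1 _ _ _ _ _ T1 T2; have [b2 ->] := IH2 _ _ _ _ _ T2 T3.
  by split => //; exact: rst_trans b1 b2.
Qed.

Lemma lift_invariant_reparam c1 c2 : reparam_equiv c1 c2 -> lift_invariant c1 c2.
Proof.
apply: lift_invariant_rst => {c1 c2} c1 c2 r12.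
apply: lift_invariant_of; first by have [] := reparam_ends r12.
move=> u /lifts_to_exists[ct1 [g T1]]; have [ct2 [T2 r]] := lifts_to_reparam r12 T1.
by exists ct1, ct2, g; split => //; exact: reparam_bt.
Qed.

Lemma lift_invariant_trans c1 c2 c3 : lift_invariant c1 c2 -> lift_invariant c2 c3 -> lift_invariant c1 c3.
Proof.
move=> i12 i23; apply: (@lift_invariant_rst lift_invariant) => //.
exact: rst_trans (rst_step _ _ _ _ i12) (rst_step _ _ _ _ i23).
Qed.

Lemma lift_invariant_bt c1 c2 : bt_equiv c1 c2 -> lift_invariant c1 c2.
Proof.
apply: lift_invariant_rst => {c1 c2} c1 c2 [a [b [d [ad ab r1 r2]]]].
apply: lift_invariant_trans (lift_invariant_reparam r1) _.
apply: lift_invariant_trans _ (lift_invariant_reparam (rst_sym _ _ _ _ r2)).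
have f1 := cat_rev_composable ad; have f2 := cat_rev_cat_composable ad ab.
apply: lift_invariant_of.
  by rewrite (path_cat_init f2) (path_cat_init f1) (path_cat_init ad) (path_cat_init ab).
rewrite (path_cat_init f2) (path_cat_init f1) (path_cat_init ad).
move=> u /lifts_to_exists[at_ [ga Ta]].
have ua := lifts_to_start Ta; have fa := lifts_to_final Ta.
have [|dt [gd Td]] := @lifts_to_exists d (pfinal at_); first by rewrite fa.
(* The same lift of [b] serves both paths, because the lifted spike returns to the end of [at_]. *)
have [|bt [gb Tb]] := @lifts_to_exists b (pfinal at_); first by rewrite fa.
have ud := lifts_to_start Td; have ub := lifts_to_start Tb.
have adt : pfinal at_ = pinit dt by rewrite ud.
have abt : pfinal at_ = pinit bt by rewrite ub.
have f1' := cat_rev_composable adt; have f2' := cat_rev_cat_composable adt abt.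
have T1 := lifts_to_cat ad Ta Td.
have T2 : lifts_to (path_rev d) (pfinal (path_cat at_ dt)) (path_rev dt) gd^-1%g.
  by rewrite (path_cat_final adt); exact: lifts_to_rev Td.
have T3 := lifts_to_cat f1 T1 T2.
have T4 : lifts_to b (pfinal (path_cat (path_cat at_ dt) (path_rev dt))) bt gb.
  by rewrite f2' ub.
have T5 := lifts_to_cat f2 T3 T4; rewrite mulgK in T5.
have T6 := lifts_to_cat ab Ta Tb.
exists (path_cat (path_cat (path_cat at_ dt) (path_rev dt)) bt),
  (path_cat at_ bt), (ga * gb)%g.
split => //; apply: rst_step; exists at_, bt, dt; split => //; exact: rst_refl.
Qed.

End transport.

(** * The categorical bundle *)

Section path_category_theory.
Context {R : realType} {E : normedModType R} (M : smoothSpaceType E).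

Lemma btclassP (c1 c2 : pc1path M) : btclass c1 = btclass c2 <-> bt_equiv c1 c2.
Proof.
split=> [/eqmodP/asboolP //|c12].
by apply/eqmodP/asboolP.
Qed.

Lemma repr_btclass (c : pc1path M) : bt_equiv (repr (btclass c)) c.
Proof. by apply/btclassP; exact: reprK. Qed.

Lemma btclass_repr (f : btpath M) : btclass (repr f) = f.
Proof. exact: reprK. Qed.

Lemma btcomp_class (c1 c2 : pc1path M) : pfinal c1 = pinit c2 ->
  btcomp (btclass c2) (btclass c1) = btclass (path_cat c1 c2).
Proof.
move=> c12; apply/btclassP; apply: bt_cat; [|exact: repr_btclass|exact: repr_btclass].
by rewrite (bt_final (repr_btclass c1)) (bt_init (repr_btclass c2)).
Qed.

Lemma path_category_is_category : is_category (path_category M).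
Proof.
split=> /=.
- by move=> x; rewrite (bt_init (repr_btclass _)).
- by move=> x; rewrite (bt_final (repr_btclass _)).
- move=> g f gf; rewrite (bt_init (repr_btclass _)); apply: path_cat_init; exact: esym.
- move=> g f gf; rewrite (bt_final (repr_btclass _)); apply: path_cat_final; exact: esym.
- move=> f; rewrite -[in X in btcomp X](btclass_repr f) btcomp_class// -[RHS]btclass_repr.
  by apply/btclassP/rst_sym/reparam_bt; exact: path_cat_cst_l.
- move=> f; rewrite -[in X in btcomp _ X](btclass_repr f) btcomp_class// -[RHS]btclass_repr.
  by apply/btclassP/reparam_bt; exact: path_cat_cst_r.
- move=> h g f; rewrite -(btclass_repr h) -(btclass_repr g) -(btclass_repr f).
  rewrite !(bt_init (repr_btclass _)) !(bt_final (repr_btclass _)) => hg gf.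
  rewrite !btcomp_class//; [|by rewrite path_cat_init|by rewrite path_cat_final].
  by apply/btclassP/reparam_bt; apply: path_catA.
Qed.

End path_category_theory.

Section crossed_module_theory.
Local Open Scope group_scope.
Context {R : realType} {E F : normedModType R} {G : lieGroupType E}
  {H : lieGroupType F} (X : lieCrossedModule G H).

Lemma xtau1 : xtau X 1 = 1.
Proof. by apply: (mulgI (xtau X 1)); rewrite -xtauM !mulg1. Qed.

Lemma xtauV h : xtau X h^-1 = (xtau X h)^-1.
Proof. by apply: (mulgI (xtau X h)); rewrite -xtauM !mulgV xtau1. Qed.

Lemma xalphag1 a : xalpha X a 1 = 1.
Proof. by apply: (mulgI (xalpha X a 1)); rewrite -xalphaM !mulg1. Qed.

Lemma xalphaV a h : xalpha X a h^-1 = (xalpha X a h)^-1.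
Proof. by apply: (mulgI (xalpha X a h)); rewrite -xalphaM !mulgV xalphag1. Qed.

Lemma xalphaVK a h : xalpha X a^-1 (xalpha X a h) = h.
Proof. by rewrite -xalphaA mulVg xalpha1. Qed.

Lemma xalpha_tauV h k : xalpha X (xtau X h)^-1 k = h^-1 * k * h.
Proof. by rewrite -xtauV xalpha_tau invgK. Qed.

Lemma xcatgroup_is_catgroup : is_catgroup (xcatgroup X).
Proof.
split.
- split=> //=.
  + by move=> a; rewrite xtau1 mul1g.
  + by move=> [h2 a2] [h1 a1] /= ->; rewrite xtauM mulgA.
  + by move=> [h a]; rewrite mulg1.
  + by move=> [h a]; rewrite mul1g.
  + by move=> [h3 a3] [h2 a2] [h1 a1] /= _ _; rewrite mulgA.
- by [].
- by move=> [h a] [k b] /=; rewrite xtauM xtau_alpha !mulgA mulgVK.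
- by move=> a b /=; congr (_, _); rewrite /= xalphag1 mulg1.
(* The interchange law, which rests on the Peiffer identity [xalpha_tau]. *)
- move=> [f2 a2] [f1 a1] [g2 b2] [g1 b1] /= -> _.
  congr (_, _) => /=; rewrite xalphaM xalphaA xalpha_tau -!mulgA; congr (_ * (_ * _)).
  by rewrite mulKg.
Qed.

End crossed_module_theory.

(** * The category of decorated horizontal paths *)

Section decorated_theory.
Context {R : realType} {nG nH nP nM : nat} {G : lieGroupType 'rV[R]_nG}
  {H : lieGroupType 'rV[R]_nH} {P : manifoldType 'rV[R]_nP} {M : manifoldType 'rV[R]_nM}
  (X : lieCrossedModule G H) (B : principalBundle G P M) (A : connectionForm B).
Implicit Types (c d : hpath A) (f : hbtpath A) (p : P) (g : G).

Lemma hclassP c d : hclass c = hclass d <-> bt_equiv c d.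
Proof.
split=> [/eqmodP/asboolP //|cd].
by apply/eqmodP/asboolP.
Qed.

Lemma repr_hclass c : bt_equiv (repr (hclass c)) c.
Proof. by apply/hclassP; exact: reprK. Qed.

Lemma hclass_repr f : hclass (repr f) = f.
Proof. exact: reprK. Qed.

Lemma hclass_init c : pinit (repr (hclass c)) = pinit c.
Proof. exact: bt_init (repr_hclass c). Qed.

Lemma hclass_final c : pfinal (repr (hclass c)) = pfinal c.
Proof. exact: bt_final (repr_hclass c). Qed.

Lemma hcomp_class c d : pfinal c = pinit d ->
  hcomp (hclass d) (hclass c) = hclass (hpath_cat c d).
Proof.
move=> cd; apply/hclassP; apply: bt_cat; [|exact: repr_hclass|exact: repr_hclass].
by rewrite hclass_final hclass_init.
Qed.

Lemma hact_class c g : hact (hclass c) g = hclass (hpath_act c g).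
Proof. by apply/hclassP; apply: bt_map; exact: repr_hclass. Qed.

Lemma hact1 f : hact f 1%g = f.
Proof.
rewrite -(hclass_repr f) hact_class; apply/hclassP/reparam_bt/reparam_eq => //.
by move=> t _; rewrite /= bact1.
Qed.

Lemma hactM f g g' : hact f (g * g')%g = hact (hact f g) g'.
Proof.
rewrite -(hclass_repr f) !hact_class; apply/hclassP/reparam_bt/reparam_eq => //.
by move=> t _; rewrite /= bactM.
Qed.

Lemma hact_cat c d g : pfinal c = pinit d ->
  hclass (hpath_act (hpath_cat c d) g) =
  hclass (hpath_cat (hpath_act c g) (hpath_act d g)).
Proof. by move=> cd; apply/hclassP/reparam_bt; exact: path_map_cat. Qed.

Lemma hact_cst p g : hclass (hpath_act (hpath_cst A p) g) =
  hclass (hpath_cst A (bact B p g)).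
Proof. by apply/hclassP/reparam_bt/reparam_eq. Qed.

Lemma hcat_cst_l c : hclass (hpath_cat (hpath_cst A (pinit c)) c) = hclass c.
Proof. by apply/hclassP/rst_sym/reparam_bt; exact: path_cat_cst_l. Qed.

Lemma hcat_cst_r c : hclass (hpath_cat c (hpath_cst A (pfinal c))) = hclass c.
Proof. by apply/hclassP/reparam_bt; exact: path_cat_cst_r. Qed.

Lemma hcatA c1 c2 c3 : pfinal c1 = pinit c2 -> pfinal c2 = pinit c3 ->
  hclass (hpath_cat (hpath_cat c1 c2) c3) = hclass (hpath_cat c1 (hpath_cat c2 c3)).
Proof. by move=> c12 c23; apply/hclassP/reparam_bt; exact: path_catA. Qed.

Lemma hact_init c g : pinit (hpath_act c g) = bact B (pinit c) g.
Proof. by []. Qed.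

Lemma hact_final c g : pfinal (hpath_act c g) = bact B (pfinal c) g.
Proof. by []. Qed.

Lemma hcat_init c d : pfinal c = pinit d -> pinit (hpath_cat c d) = pinit c.
Proof. exact: path_cat_init. Qed.

Lemma hcat_final c d : pfinal c = pinit d -> pfinal (hpath_cat c d) = pfinal d.
Proof. exact: path_cat_final. Qed.

Lemma btclass_proj_act c g :
  btclass (path_map (@bproj_smooth _ _ _ _ _ _ _ B) (hpath_act c g)) =
  btclass (path_map (@bproj_smooth _ _ _ _ _ _ _ B) c).
Proof.
apply/btclassP/reparam_bt/reparam_eq => // t _.
by rewrite /= bproj_act.
Qed.

Lemma btclass_proj c :
  btclass (path_map (@bproj_smooth _ _ _ _ _ _ _ B) (repr (hclass c))) =
  btclass (path_map (@bproj_smooth _ _ _ _ _ _ _ B) c).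
Proof. by apply/btclassP; apply: bt_map; exact: repr_hclass. Qed.

(** The twist by tau(h1^-1) in the target is undone by the right translation in the composition, so
    the underlying paths are composable. *)
Lemma dec_composable (h1 : H) c1 c2 :
  pinit (repr (hclass c2)) = bact B (pfinal (repr (hclass c1))) (xtau X h1^-1%g) ->
  pfinal c1 = pinit (hpath_act c2 (xtau X h1)).
Proof.
rewrite hclass_init hclass_final => E1.
by rewrite hact_init E1 -bactM -xtauM mulVg xtau1 bact1.
Qed.

Lemma decorated_is_category : is_category (decorated_category X A).
Proof.
split=> /=.
- by move=> p; rewrite hclass_init.
- by move=> p; rewrite hclass_final invg1 xtau1 bact1.
- move=> [f2 h2] [f1 h1] /=; rewrite -(hclass_repr f2) -(hclass_repr f1) hact_class.
  move: (repr f2) (repr f1) => c2 c1 /dec_composable E1.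
  by rewrite hcomp_class// !hclass_init hcat_init.
- move=> [f2 h2] [f1 h1] /=; rewrite -(hclass_repr f2) -(hclass_repr f1) hact_class.
  move: (repr f2) (repr f1) => c2 c1 /dec_composable E1.
  rewrite hcomp_class// !hclass_final hcat_final// hact_final -bactM -xtauM.
  by rewrite invgM mulVKg.
- move=> [f h] /=; rewrite xtau1 hact1 mulg1; congr (_, _).
  by rewrite -[in X in hcomp X](hclass_repr f) hcomp_class// hcat_cst_l hclass_repr.
- move=> [f h] /=; rewrite mul1g; congr (_, _).
  rewrite hact_class hact_cst -bactM -xtauM mulVg xtau1 bact1.
  by rewrite -[in X in hcomp _ X](hclass_repr f) hcomp_class// hcat_cst_r hclass_repr.
(* Associativity: both sides concatenate [c1], [c2] moved by tau(h1) and [c3] moved by tau(h2)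
   tau(h1) = tau(h2 h1). *)
- move=> [f3 h3] [f2 h2] [f1 h1] /=.
  rewrite -(hclass_repr f3) -(hclass_repr f2) -(hclass_repr f1).
  move: (repr f3) (repr f2) (repr f1) => c3 c2 c1; rewrite !(hact_class c3) (hact_class c2).
  move=> /dec_composable E2 /dec_composable E1.
  have E3 : pfinal (hpath_cat c1 (hpath_act c2 (xtau X h1))) =
      pinit (hpath_act c3 (xtau X (h2 * h1)%g)).
    by rewrite hcat_final// hact_final E2 !hact_init -bactM -xtauM.
  have E4 : pfinal c1 =
      pinit (hpath_act (hpath_cat c2 (hpath_act c3 (xtau X h2))) (xtau X h1)).
    by rewrite hact_init hcat_init.
  have E5 : pfinal (hpath_act c2 (xtau X h1)) =
      pinit (hpath_act (hpath_act c3 (xtau X h2)) (xtau X h1)).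
    by rewrite hact_final E2.
  have E6 : pfinal c1 = pinit (hpath_cat (hpath_act c2 (xtau X h1))
      (hpath_act (hpath_act c3 (xtau X h2)) (xtau X h1))).
    by rewrite (hcat_init E5).
  have E7 : pfinal (hpath_cat c1 (hpath_act c2 (xtau X h1))) =
      pinit (hpath_act (hpath_act c3 (xtau X h2)) (xtau X h1)).
    by rewrite (hcat_final E1).
  rewrite (hcomp_class E1) (hcomp_class E3) (hcomp_class E2) hact_class (hcomp_class E4).
  rewrite mulgA; congr (_, _).
  rewrite -(hcomp_class E4) (hact_cat _ E2) (hcomp_class E6) -(hcatA E1 E5).
  rewrite -(hcomp_class E3) -(hcomp_class E7); congr (hcomp _ _).
  by rewrite xtauM -!hact_class hactM.
Qed.

End decorated_theory.

(** * The principal categorical bundle and its connection *)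

Section decorated_bundle_theory.
Context {R : realType} {nG nH nP nM : nat} {G : lieGroupType 'rV[R]_nG}
  {H : lieGroupType 'rV[R]_nH} {P : manifoldType 'rV[R]_nP} {M : manifoldType 'rV[R]_nM}
  (X : lieCrossedModule G H) (B : principalBundle G P M) (A : connectionForm B)
  (C : forall p : P, {linear tangent p -> tangent (1%g : H)}).
Hypothesis C_smooth : smooth_form C.
Hypothesis C_equiv : forall (p : P) (g : G) (v : tangent p),
  C (bact B p g) (tmap (fun q => bact B q g) p v) =
  tmap (xalpha X g^-1%g) 1%g (C p v).
Implicit Types (c d : hpath A) (p : P).

Let bprojS := @bproj_smooth _ _ _ _ _ _ _ B.

Lemma lifts_to_hpath c : exists g, lifts_to A C (path_map bprojS c) (pinit c) c g.
Proof. exact: (lifts_to_of_horizontal C_smooth (@hpathP _ _ _ _ _ _ _ _ _ c)). Qed.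

(* Horizontal lifts of backtrack equivalent paths through the same point are
   backtrack equivalent. *)
Lemma proj_fiber c d :
  btclass (path_map bprojS c) = btclass (path_map bprojS d) ->
  exists g, hclass d = hclass (hpath_act c g).
Proof.
move=> /btclassP cd; have icd := bt_init cd.
have [g gE] := bact_transitive (B := B) icd; exists g.
apply/hclassP/rst_sym.
have [x1 T1] := lifts_to_hpath (hpath_act c g); have [x2 T2] := lifts_to_hpath d.
have e : bt_equiv (path_map bprojS (hpath_act c g)) (path_map bprojS d).
  by apply: rst_trans cd; apply/btclassP; exact: btclass_proj_act.
have [_ K] := lift_invariant_bt A C_smooth e.
have iE : pinit (hpath_act c g) = pinit d by rewrite hact_init -gE.
rewrite iE in T1.
by have [] := K _ _ _ _ _ T1 T2.
Qed.

Lemma proj_lift (f : pc1path M) u ct g : lifts_to A C f u ct g ->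
  reparam (path_map bprojS ct) f.
Proof.
move=> [h [K _]]; have [e1 e2 _ _ _] := K.
by apply: reparam_eq => //= t; rewrite e1 e2; exact: (dlift_proj K).
Qed.

Local Open Scope group_scope.

Lemma decorated_bundle_is_principal : is_principal_catbundle (decorated_bundle X A).
Proof.
split.
- exact: decorated_is_category.
- exact: path_category_is_category.
- exact: xcatgroup_is_catgroup.
- split=> /=.
  + by move=> [f h] /=; rewrite (bt_init (repr_btclass _)).
  + by move=> [f h] /=; rewrite (bt_final (repr_btclass _)) bproj_act.
  + move=> p; rewrite btclass_proj; apply/btclassP/reparam_bt; exact: reparam_eq.
  + move=> [f2 h2] [f1 h1] /=; rewrite -(hclass_repr f2) -(hclass_repr f1).
    move: (repr f2) (repr f1) => c2 c1 /dec_composable E1.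
    rewrite (hact_class c2) (hcomp_class E1) !btclass_proj btcomp_class; last first.
      move: E1; rewrite hact_init => E1.
      by rewrite /pfinal /pinit /= [c1 _]E1 bproj_act.
    apply/btclassP; apply: rst_trans (reparam_bt (path_map_cat bprojS E1)) _.
    apply: bt_catr; last by apply/btclassP; exact: btclass_proj_act.
    by rewrite /pfinal /pinit /= [c1 _]E1.
- by move=> x /=; rewrite bact1.
- by move=> x a b /=; rewrite bactM.
- by move=> [f h] /=; rewrite hact1 !invg1 mul1g xalpha1.
- move=> [f h] [k1 k2] [l1 l2] /=; rewrite hactM; congr (_, _).
  rewrite /= invgM xalphaA; congr (xalpha X _ _).
  by rewrite invgM -mulgA xalphaM -xalphaV xalphaVK.
- by move=> [f h] [k1 k2] /=; rewrite -(hclass_repr f) hact_class !hclass_init.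
- move=> [f h] [k1 k2] /=; rewrite -(hclass_repr f) hact_class !hclass_final hact_final.
  rewrite -!bactM -xalphaV xtau_alpha invgM invgK xtauM invgK; congr (bact B _ _).
  by rewrite !mulgA mulgV mul1g.
- by move=> p a /=; rewrite hact_class hact_cst !invg1 mulg1 xalphag1.
- move=> [f2 h2] [f1 h1] [l1 l2] [k1 k2] /=; rewrite -(hclass_repr f2) -(hclass_repr f1).
  move: (repr f2) (repr f1) => c2 c1 /dec_composable E1 ->.
  rewrite (hact_class c2) (hact_class c1) (hact_class c2) (hcomp_class E1).
  rewrite (hact_class (hpath_cat _ _)).
  rewrite (hact_class (hpath_act c2 _)).
  have E2 : pfinal (hpath_act c1 k2) = pinit (hpath_act (hpath_act c2 (xtau X h1)) k2).
    by rewrite hact_final E1.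
  (* The left side moves [c2] when the translated morphisms are composed, the right side when the
     composition is translated; equivariance of tau identifies them. *)
  have tE : xtau X k1 * k2 * xtau X (xalpha X k2^-1 (k1^-1 * h1)) = xtau X h1 * k2.
    by rewrite xtau_alpha invgK xtauM xtauV !mulgA mulgK mulgV mul1g.
  have E3 : hclass (hpath_act (hpath_act c2 (xtau X k1 * k2))
      (xtau X (xalpha X k2^-1 (k1^-1 * h1)))) =
      hclass (hpath_act (hpath_act c2 (xtau X h1)) k2).
    by rewrite -!hact_class -!hactM tE.
  rewrite E3 (hcomp_class E2) (hact_cat _ E1); congr (_, _).
  rewrite /= [(xtau X k1 * k2)^-1]invgM xalphaA xalpha_tauV -xalphaM; congr (xalpha X _ _).
  by rewrite invgM !mulgA mulgK.
- exact: bproj_surj.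
- move=> f /=; have [u uE] := bproj_surj B (pinit (repr f)).
  have [ct [g T]] := lifts_to_exists A C_smooth uE.
  (* The decoration is arbitrary, as the projection forgets it. *)
  exists (hclass (HPath (lifts_to_horizontal T)), 1).
  rewrite /= btclass_proj -[RHS]btclass_repr; apply/btclassP/reparam_bt.
  exact: (proj_lift T).
- by move=> x a /= /bact_free.
- move=> [f h] [k1 k2] /=; rewrite -(hclass_repr f) hact_class => -[E1 E2].
  have k21 : k2 = 1.
    apply: (@bact_free _ _ _ _ _ _ _ B (pinit (repr f))).
    by have := bt_init ((hclassP _ _).1 E1); rewrite hact_init.
  move: E2; rewrite k21 invg1 xalpha1 => /(congr1 (fun x => x * h^-1)).
  by rewrite mulgK mulgV => E3; rewrite -(invgK k1) E3 invg1.
- move=> x y /=; split; first exact: bact_transitive.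
  by move=> [a ->]; rewrite bproj_act.
- move=> [f h] [f' h'] /=; rewrite -(hclass_repr f) -(hclass_repr f').
  move: (repr f) (repr f') => c c'; rewrite !btclass_proj; split.
    (* The first component solves alpha(g^-1)(k1^-1 h) = h' for k1. *)
    move=> /proj_fiber[g cE]; exists (h * (xalpha X g h')^-1, g); congr (_, _).
      by rewrite hact_class.
    by rewrite /= invgM invgK mulgVK xalphaVK.
  move=> [[k1 k2]] [E1 _].
  by rewrite -(btclass_proj c') E1 hact_class btclass_proj btclass_proj_act.
Qed.

(** The lift is chosen on canonical representatives. Invariance under backtracking then gives the
    formula for every path in the class and every lift of it, so later arguments may use whichever
    is at hand. *)
Lemma lift_function : exists lift : P -> btpath M -> hbtpath A * H,
  forall u (c : pc1path M) ct g (T : lifts_to A C c u ct g),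
    lift u (btclass c) = (hclass (HPath (lifts_to_horizontal T)), g).
Proof.
pose Q (z : P * btpath M) (m : hbtpath A * H) :=
  forall ct g (T : lifts_to A C (repr z.2) z.1 ct g),
    m = (hclass (HPath (lifts_to_horizontal T)), g).

have ex z : exists m, Q z m.
  case: z => u f; have [uf|uf] := pselect (bproj B u = pinit (repr f)).
    have [ct [g T]] := lifts_to_exists A C_smooth uf.
    exists (hclass (HPath (lifts_to_horizontal T)), g) => ct' g' T'.
    have [r e] := lifts_to_unique T T'; apply: (congr2 pair _ e).
    by apply/hclassP; exact: reparam_bt.
  (* A default value: no lift starts at a point outside the fibre over the source, so [Q] holds
     vacuously. *)
  exists (hclass (hpath_cst A u), 1) => ct g T; case: uf; exact: lifts_to_init T.
have [F FP] := choice ex.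
exists (fun u f => F (u, f)) => u c ct g T.
have uf : bproj B u = pinit (repr (btclass c)).
  by rewrite (bt_init (repr_btclass c)); exact: lifts_to_init T.
have [ct' [g' T']] := lifts_to_exists A C_smooth uf.
rewrite (FP (u, btclass c) ct' g' T').
have [_ K] := lift_invariant_bt A C_smooth (repr_btclass c).
have [b e] := K _ _ _ _ _ T' T; apply: (congr2 pair _ e).
exact/hclassP.
Qed.

Lemma lifts_to_connection (lift : P -> btpath M -> hbtpath A * H) :
  (forall u (c : pc1path M) ct g (T : lifts_to A C c u ct g),
    lift u (btclass c) = (hclass (HPath (lifts_to_horizontal T)), g)) ->
  @is_catconnection (xcatgroup X) (decorated_bundle X A) lift.
Proof.
move=> liftE.
have ex (u : P) (f : btpath M) : pinit (repr f) = bproj B u ->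
    exists ct g, lifts_to A C (repr f) u ct g.
  by move=> e; apply: (lifts_to_exists A C_smooth); rewrite e.
split=> /=.
- move=> p f /ex[ct [g T]]; rewrite -[in lift p f](btclass_repr f) (liftE _ _ _ _ T) /=.
  by rewrite hclass_init; exact: lifts_to_start T.
- move=> p f /ex[ct [g T]]; rewrite -[in lift p f](btclass_repr f) (liftE _ _ _ _ T) /=.
  rewrite btclass_proj -[RHS]btclass_repr; apply/btclassP/reparam_bt.
  exact: (proj_lift T).
- move=> p; have T := lifts_to_cst A C (erefl (bproj B p)).
  by rewrite (liftE _ _ _ _ T); congr (_, _); apply/hclassP; exact: rst_refl.
- move=> p f g /ex[ct [x T]].
  have LE : lift p f = (hclass (HPath (lifts_to_horizontal T)), x).
    by rewrite -[in LHS](btclass_repr f) (liftE _ _ _ _ T).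
  rewrite LE /= hclass_final => /ex[dt [y T']].
  set q := bact B _ _ in T' *.
  have LE' : lift q g = (hclass (HPath (lifts_to_horizontal T')), y).
    by rewrite -[in LHS](btclass_repr g) (liftE _ _ _ _ T').
  have qE : bact B q (xtau X x) = pfinal ct.
    by rewrite /q -bactM -xtauM mulVg xtau1 bact1.
  (* The lift of [g] starts at the twisted target [q]. Moving it by tau(x) makes it start at the end
     of [ct] and turns its decoration into x^-1 y x, so the concatenation carries x (x^-1 y x) = y
     x, as the composition law demands. *)
  have T2 := lifts_to_act C_equiv (xtau X x) T'.
  rewrite qE xalpha_tauV in T2.
  have fg : pfinal (repr f) = pinit (repr g).
    rewrite -(lifts_to_init T') /q bproj_act; apply: esym; exact: lifts_to_final T.
  have T3 := lifts_to_cat fg T T2; rewrite !mulgA mulgV mul1g in T3.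
  rewrite LE' /= (hact_class (HPath _)) hcomp_class; last first.
    by rewrite hact_init [pinit _](lifts_to_start T') qE.
  rewrite (_ : btcomp g f = btclass (path_cat (repr f) (repr g)))//.
  by rewrite (liftE _ _ _ _ T3); congr (_, _); apply/hclassP; exact: rst_refl.
- move=> p f a /ex[ct [x T]].
  have T2 := lifts_to_act C_equiv a T.
  have -> : lift p f = (hclass (HPath (lifts_to_horizontal T)), x).
    by rewrite -[in LHS](btclass_repr f) (liftE _ _ _ _ T).
  have -> : lift (bact B p a) f = (hclass (HPath (lifts_to_horizontal T2)), xalpha X a^-1 x).
    by rewrite -[in LHS](btclass_repr f) (liftE _ _ _ _ T2).
  rewrite /= hact_class invg1 mul1g; congr (_, _).
  by apply/hclassP; exact: rst_refl.
Qed.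

End decorated_bundle_theory.

Theorem theorem7p1 (R : realType) (nG nH nP nM : nat)
    (G : lieGroupType 'rV[R]_nG) (H : lieGroupType 'rV[R]_nH)
    (P : manifoldType 'rV[R]_nP) (M : manifoldType 'rV[R]_nM)
    (X : lieCrossedModule G H) (B : principalBundle G P M)
    (A : connectionForm B)
    (C : forall p : P, {linear tangent p -> tangent (1%g : H)})
    (C_smooth : smooth_form C)
    (C_equiv : forall (p : P) (g : G) (v : tangent p),
      C (bact B p g) (tmap (fun q => bact B q g) p v) =
      tmap (xalpha X g^-1%g) 1%g (C p v)) :
  is_principal_catbundle (decorated_bundle X A) /\
  exists lift : P -> btpath M -> hbtpath A * H,
    (forall (c : pc1path M) (u : P), bproj B u = pinit c ->
      exists (ct : hpath A) (h : pc1path H),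
        [/\ is_hlift c u ct,
            forall ct' : hpath A, is_hlift c u ct' ->
              {in `[pstart c, pstop c], ct' =1 ct},
            is_hsol C c ct h,
            forall h' : pc1path H, is_hsol C c ct h' ->
              {in `[pstart c, pstop c], h' =1 h} &
            lift u (btclass c) = (hclass ct, pfinal h)]) /\
    @is_catconnection (xcatgroup X) (decorated_bundle X A) lift.
Proof.
split; first exact: (decorated_bundle_is_principal X A C_smooth).
have [lift liftE] := lift_function A C_smooth.
exists lift; split; last exact: (lifts_to_connection C_smooth C_equiv liftE).
move=> c u uc; have [ct [h K]] := dlift_exists A C_smooth uc.
have T : lifts_to A C c u ct (h (pstop c)) by exists h.
have [e1 e2 iu h1 Ph] := K.
(* The solution comes as a bare function; its C^1 pieces make it a path in [H]. *)
exists (HPath (lifts_to_horizontal T)), (mkpath (dlift_solC1 K)); split.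
- by split => //; exact: (dlift_proj K).
- move=> ct' [e1' e2' pc' iu'].
  exact: (dlift_lift_unique K e1' e2' iu' pc' (@hpathP _ _ _ _ _ _ _ _ _ ct')).
- split => // t [v tv].
  by have [w [k [wv kv E]]] := dlift_hsol K tv; exists w, k.
- move=> h' [e1' e2' iu' H'].
  have C1 := ppiecewise h'; rewrite e1' e2' in C1.
  apply: (hsol_unique (C := C) (ct := ct) (ppiecewise c) C1 (dlift_solC1 K)).
  + move=> t tv; have [w [k [wv kv E]]] := H' t tv.
    by exists w, k; split => //; move: wv kv; rewrite /velocity /= ?e1 ?e2 ?e1' ?e2'.
  + move=> t [v tv]; have [w [k [wv kv E]]] := dlift_hsol K tv.
    by exists w, k; split => //; move: wv; rewrite /velocity e1 e2.
  + by rewrite h1 -e1' -/(pinit h').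
- exact: liftE.
Qed.
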